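(* Let $G=\mathbb H^n\rtimes U(n)$ be the Heisenberg motion group. For $\xi>-\frac12$ consider the function $f_\xi(z,t,k)=g_\xi(z,t)$ on $G$, where, with $z=x+iy$ and $A=\{(x,y,t)\in\mathbb R^n\times\mathbb R^n\times\mathbb R:|x_l|\le1,\ |y_l|\le1,\ |t|\le1;\ l=1,\dots,n\}$, $$g_\xi(z,t)=g_\xi(x,y,t)=|t|^\xi\prod_{j=1}^n|x_j|^\xi\prod_{j=1}^n|y_j|^\xi\,\chi_A(z,t).$$ Then $f_\xi$ is square integrable and compactly supported. Further, for every $1<q<2$ there exists $\xi>-\frac12$ such that $$\int_{\mathbb R\setminus\{0\}}\sum_{\sigma\in\hat K}d_\sigma\|\hat f_\xi(\lambda,\sigma)\|_{S_q}^q\,|\lambda|^n\,d\lambda=\infty .$$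
   Context: The Heisenberg group is $\mathbb H^n=\mathbb C^n\times\mathbb R$ with $(z,t)\cdot(w,s)=(z+w,t+s+\frac12\mathrm{Im}(z\cdot\bar w))$. With $K=U(n)$ acting on $\mathbb H^n$ by $k\cdot(z,t)=(kz,t)$, the Heisenberg motion group $G$ is the semidirect product of $\mathbb H^n$ with $K$, with group law $(z,t,k_1)\cdot(w,s,k_2)=(z+k_1w,\,t+s-\frac12\mathrm{Im}(k_1w\cdot\bar z),\,k_1k_2)$ and Haar measure $dz\,dt\,dk$, where $dz\,dt$ and $dk$ are normalized Haar measures on $\mathbb H^n$ and $K$. For $\lambda\in\mathbb R\setminus\{0\}$ the Schrödinger representation $\pi_\lambda$ of $\mathbb H^n$ on $L^2(\mathbb R^n)$ is $\pi_\lambda(z,t)\varphi(\xi)=e^{i\lambda t}e^{i\lambda(x\cdot\xi+\frac12x\cdot y)}\varphi(\xi+y)$, $z=x+iy$. The metaplectic representation $\mu_\lambda$ is a unitary representation of $K$ on $L^2(\mathbb R^n)$ satisfying $\pi_\lambda(kz,t)=\mu_\lambda(k)\pi_\lambda(z,t)\mu_\lambda(k)^*$ for all $k\in K$, $(z,t)\in\mathbb H^n$. For $\sigma\in\hat K$ (the unitary dual of $K$), realized on $\mathcal H_\sigma$ of dimension $d_\sigma$, the representation $\rho^\lambda_\sigma$ of $G$ on $\mathcal H_\sigma^2=L^2(\mathbb R^n)\otimes\mathcal H_\sigma$ is $\rho^\lambda_\sigma(z,t,k)=\pi_\lambda(z,t)\mu_\lambda(k)\otimes\sigma(k)$. The Fourier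 transform of $f\in L^1(G)$ is the bounded operator on $\mathcal H_\sigma^2$ given by $$\hat f(\lambda,\sigma)=\int_K\int_{\mathbb R}\int_{\mathbb C^n}f(z,t,k)\rho^\lambda_\sigma(z,t,k)\,dz\,dt\,dk.$$ $\chi_A$ is the indicator function of $A$, and $S_q$ is the $q$-Schatten class with $\|T\|_{S_q}^q=\mathrm{tr}(T^*T)^{q/2}$ (taken to be $\infty$ if $T\notin S_q$). *)

(* Defs.v *)
From HB Require Import structures.
From mathcomp Require Import all_boot all_order all_algebra.
From mathcomp Require Import complex.
From mathcomp Require Import all_classical all_reals all_analysis.

Set Implicit Arguments.
Unset Strict Implicit.
Unset Printing Implicit Defensive.
Import Order.TTheory GRing.Theory Num.Theory.
Import numFieldNormedType.Exports.
Local Open Scope classical_set_scope.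
Local Open Scope complex_scope.
Local Open Scope ring_scope.

(** The library's sigma-finite instance on [m1 \x m2] is shadowed by its
   instance on products of subprobabilities, so we attach it to an alias. *)
Section prod_measure.
Context d1 d2 (T1 : measurableType d1) (T2 : measurableType d2) (R : realType).
Variable m1 : {sigma_finite_measure set T1 -> \bar R}.
Variable m2 : {sigma_finite_measure set T2 -> \bar R}.

Definition prod_measure : set (T1 * T2) -> \bar R := (m1 \x m2)%E.

HB.instance Definition _ := Measure.on prod_measure.

Let sigma_finite_prod_measure : sigma_finite setT prod_measure.
Proof.
have /sigma_finiteP[F [TF ndF Foo]] := sigma_finiteT m1.
have /sigma_finiteP[G [TG ndG Goo]] := sigma_finiteT m2.
exists (fun n => F n `*` G n).
  rewrite -setXTT TF TG predeqE => -[x y]; split.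
    move=> [/= [n _ Fnx] [k _ Gky]]; exists (maxn n k) => //; split.
    - by move: x Fnx; exact/subsetPset/ndF/leq_maxl.
    - by move: y Gky; exact/subsetPset/ndG/leq_maxr.
  by move=> [n _ []/= ? ?]; split; exists n.
move=> k; have [? ?] := Foo k; have [? ?] := Goo k.
split; first exact: measurableX.
by rewrite /prod_measure product_measure1E// lte_mul_pinfty// ge0_fin_numE.
Qed.

HB.instance Definition _ :=
  Measure_isSigmaFinite.Build _ _ _ prod_measure sigma_finite_prod_measure.

End prod_measure.

(** R^n is ['cV[R]_n], with the sigma-algebra generated by the coordinates
   (as the library does for [n.-tuple T]). *)

Definition measure_cV_display : measure_display -> measure_display.
Proof. exact. Qed.

Section measurable_cV.
Context {d} {T : measurableType d} (n : nat).

Let coors : 'I_n -> 'cV[T]_n -> T := fun i x => x i ord0.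

Let cV_set0 : g_sigma_preimage coors set0.
Proof. exact: sigma_algebra0. Qed.

Let cV_setC A : g_sigma_preimage coors A -> g_sigma_preimage coors (~` A).
Proof. exact: sigma_algebraC. Qed.

Let cV_bigcup (F : (set 'cV[T]_n)^nat) :
  (forall i, g_sigma_preimage coors (F i)) ->
  g_sigma_preimage coors (\bigcup_i (F i)).
Proof. exact: sigma_algebra_bigcup. Qed.

HB.instance Definition _ := @isMeasurable.Build (measure_cV_display d)
  'cV[T]_n (g_sigma_preimage coors) cV_set0 cV_setC cV_bigcup.

Lemma measurable_coord (i : 'I_n) :
  measurable_fun setT (fun x : 'cV[T]_n => x i ord0).
Proof.
move=> _ Y mY; rewrite setTI; apply: sub_sigma_algebra => /=.
rewrite -bigcup_seq/=; exists i => /=; first by rewrite mem_index_enum.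
by exists Y => //; rewrite setTI.
Qed.

Lemma measurable_fun_coord d1 (T1 : measurableType d1) (f : T1 -> 'cV[T]_n) :
  (forall i, measurable_fun setT (fun x => f x i ord0)) ->
  measurable_fun setT f.
Proof.
move=> mf.
apply: (@measurability _ _ _ _ _ _
  (\big[setU/set0]_(i < n) preimage_set_system setT (coors i) measurable)) => //.
move=> _ [B + <-]; rewrite -bigcup_seq/= => -[i _ [C mC <-]].
by rewrite setTI [X in measurable X](_ : _ = setT `&` (fun x => f x i ord0) @^-1` C);
  [exact: mf | rewrite !setTI].
Qed.

End measurable_cV.

Definition consV {R : realType} n (p : measurableTypeR R * 'cV[R]_n) :
    'cV[R]_n.+1 :=
  \col_i oapp (fun j => p.2 j ord0) p.1 (unlift ord0 i).

Definition unconsV {R : realType} n (v : 'cV[R]_n.+1) :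
    measurableTypeR R * 'cV[R]_n :=
  (v ord0 ord0, \col_i v (lift ord0 i) ord0).

Section consV.
Context {R : realType} (n : nat).

Lemma consVK : cancel (@consV R n) (@unconsV R n).
Proof.
move=> [x v]; rewrite /unconsV/consV mxE unlift_none/=; congr pair.
by apply/colP => i; rewrite !mxE liftK.
Qed.

Lemma unconsVK : cancel (@unconsV R n) (@consV R n).
Proof.
move=> v; apply/colP => i; rewrite mxE; case: unliftP => [j ->|->]//=.
by rewrite mxE.
Qed.

Lemma measurable_consV : measurable_fun setT (@consV R n).
Proof.
apply: measurable_fun_coord => i; case: (unliftP ord0 i) => [j|] ->.
  rewrite (_ : (fun _ => _) = (fun v : 'cV[R]_n => v j ord0) \o snd).
    by apply: measurableT_comp => //; exact: measurable_coord.
  by apply/funext => p; rewrite mxE liftK.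
rewrite (_ : (fun _ => _) = fst); first exact: measurable_fst.
by apply/funext => p; rewrite mxE unlift_none.
Qed.

Lemma measurable_unconsV : measurable_fun setT (@unconsV R n).
Proof.
apply: measurable_fun_pair => /=; first exact: measurable_coord.
apply: measurable_fun_coord => i.
rewrite (_ : (fun _ => _) = (fun v : 'cV[R]_n.+1 => v (lift ord0 i) ord0)).
  exact: measurable_coord.
by apply/funext => v; rewrite mxE.
Qed.

Variable m : {sigma_finite_measure set 'cV[R]_n -> \bar R}.

Definition lebesgue_cons : set 'cV[R]_n.+1 -> \bar R :=
  pushforward (prod_measure lebesgue_measure m) (@consV R n).

Let lebesgue_cons0 : lebesgue_cons set0 = 0%E.
Proof. by rewrite /lebesgue_cons /pushforward preimage_set0 measure0. Qed.

Let lebesgue_cons_ge0 A : (0 <= lebesgue_cons A)%E.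
Proof. by rewrite /lebesgue_cons /pushforward; exact: measure_ge0. Qed.

Let lebesgue_cons_sigma_additive : semi_sigma_additive lebesgue_cons.
Proof.
move=> F mF tF mUF; rewrite /lebesgue_cons /pushforward preimage_bigcup.
apply: measure_semi_sigma_additive.
- by move=> k; rewrite -[X in measurable X]setTI; exact: measurable_consV.
- apply/trivIsetP => /= i j _ _ ij; rewrite -preimage_setI.
  by move/trivIsetP : tF => /(_ _ _ _ _ ij) ->//; rewrite preimage_set0.
- rewrite -preimage_bigcup -[X in measurable X]setTI.
  exact: measurable_consV.
Qed.

HB.instance Definition _ := isMeasure.Build _ _ _ lebesgue_cons
  lebesgue_cons0 lebesgue_cons_ge0 lebesgue_cons_sigma_additive.

Let sigma_finite_lebesgue_cons : sigma_finite setT lebesgue_cons.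
Proof.
have [F FT Foo] := sigma_finiteT (prod_measure lebesgue_measure m).
exists (fun k => @unconsV R n @^-1` F k).
  by rewrite -preimage_bigcup -FT preimage_setT.
move=> k; have [mF mFoo] := Foo k; split.
  by rewrite -[X in measurable X]setTI; exact: measurable_unconsV.
rewrite /lebesgue_cons/pushforward -comp_preimage.
by rewrite (_ : _ \o _ = id) //; apply/funext => x /=; rewrite consVK.
Qed.

HB.instance Definition _ :=
  Measure_isSigmaFinite.Build _ _ _ lebesgue_cons sigma_finite_lebesgue_cons.

End consV.

Fixpoint lebesgueV (R : realType) (n : nat) :
    {sigma_finite_measure set 'cV[R]_n -> \bar R} :=
  match n with
  | 0 => \d_(0 : 'cV[R]_0)
  | n'.+1 => lebesgue_cons (lebesgueV R n')
  end.

(** The space underlying the Heisenberg motion group is H^n x U(n), where a point (z, t) of H^n with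
   z = x + iy is given by its real coordinates ((x, y), t). *)

Section unitary_group.
Variables (R : realType) (n : nat).

Definition unitary_group := {k : 'M[R[i]]_n | k \is unitarymx}.

HB.instance Definition _ := Choice.on unitary_group.

Fact unitary_one_subproof : (1%:M : 'M[R[i]]_n) \is unitarymx.
Proof. by apply/unitarymxP; rewrite trmx1 map_mx1 mulmx1. Qed.

Fact unitary_inv_subproof (k : unitary_group) : ((val k) ^t* )%sesqui \is unitarymx.
Proof. by rewrite trmxC_unitary (valP k). Qed.

Definition unitary_one : unitary_group := Sub 1%:M unitary_one_subproof.

Definition unitary_inv (k : unitary_group) : unitary_group :=
  Sub ((val k) ^t* )%sesqui (unitary_inv_subproof k).

Definition unitary_mul (k l : unitary_group) : unitary_group :=
  Sub (val k *m val l) (mul_unitarymx (valP k) (valP l)).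

Fact unitary_mulA : associative unitary_mul.
Proof. by move=> k l m; apply: val_inj; rewrite /= mulmxA. Qed.

Fact unitary_mul1g : left_id unitary_one unitary_mul.
Proof. by move=> k; apply: val_inj; rewrite /= mul1mx. Qed.

Fact unitary_mulg1 : right_id unitary_one unitary_mul.
Proof. by move=> k; apply: val_inj; rewrite /= mulmx1. Qed.

Fact unitary_mulgV : right_inverse unitary_one unitary_inv unitary_mul.
Proof. by move=> k; apply: val_inj; exact: unitarymxP (valP k). Qed.

Fact unitary_mulVg : left_inverse unitary_one unitary_inv unitary_mul.
Proof.
by move=> k; apply: val_inj; apply: mulmx1C; exact: unitarymxP (valP k).
Qed.

HB.instance Definition _ := isGroup.Build unitary_group
  unitary_mulA unitary_mul1g unitary_mulg1 unitary_mulVg unitary_mulgV.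

HB.instance Definition _ := isPointed.Build unitary_group unitary_one.

(** U(n) carries the topology induced by its embedding in R^(2 n^2), and the
   Borel sigma-algebra of that topology. *)
Definition unitary_ReIm (k : unitary_group) : 'M[R]_n * 'M[R]_n :=
  (map_mx (@complex.Re R) (val k), map_mx (@complex.Im R) (val k)).

HB.instance Definition _ :=
  Topological.copy unitary_group (initial_topology unitary_ReIm).

HB.instance Definition _ :=
  Measurable.copy unitary_group (g_sigma_algebraType (@open unitary_group)).

Definition is_haar (P : probability unitary_group R) : Prop :=
  forall (k : unitary_group) (A : set unitary_group),
    measurable A -> P [set (k * h)%g | h in A] = P A.

End unitary_group.

Section heisenberg_motion.
Variables (R : realType) (n : nat).

Definition heisenberg : Type := ('cV[R]_n * 'cV[R]_n * R)%type.

Definition heisenberg_motion : Type := (heisenberg * unitary_group R n)%type.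

Definition unitary_act (k : unitary_group R n) (z : heisenberg) : heisenberg :=
  let kz := val k *m \col_j (z.1.1 j ord0 +i* z.1.2 j ord0) in
  (map_mx (@complex.Re R) kz, map_mx (@complex.Im R) kz, z.2).

(** [haarG P] is dz dt dk, where dk is the Haar measure [P] of U(n). *)
Definition haarG (P : probability (unitary_group R n) R) :
    {sigma_finite_measure
       set ('cV[R]_n * 'cV[R]_n * measurableTypeR R * unitary_group R n)%type
       -> \bar R} :=
  prod_measure
    (prod_measure (prod_measure (lebesgueV R n) (lebesgueV R n))
       lebesgue_measure) P.

End heisenberg_motion.

Definition Cintegral d (T : measurableType d) (R : realType)
    (mu : {measure set T -> \bar R}) (f : T -> R[i]) : R[i] :=
  (\int[mu]_x complex.Re (f x)) +i* (\int[mu]_x complex.Im (f x)).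

(** An [hspace] is a complex vector space together with a subset [hmem] on which
   [hdot] is a semi-inner product; the Hilbert space meant is the quotient of
   [hmem] by the vectors of norm 0.  For L^2 the vectors are functions, equal
   in the Hilbert space iff equal almost everywhere.  Operators are maps on
   representatives, and identities between vectors are stated with [heq]. *)

Record hspace (R : realType) := HSpace {
  hvec :> lmodType R[i];
  hmem : set hvec;
  hdot : hvec -> hvec -> R[i] }.

Section operators.
Variables (R : realType) (H : hspace R).
Implicit Types (S T A B : H -> H) (u v : H).

Definition hnorm u : R := Num.sqrt (complex.Re (hdot u u)).

Definition heq u v : Prop := hnorm (u - v) = 0.

Definition op_bound T (M : R) : Prop :=
  forall u, hmem u -> hnorm (T u) <= M * hnorm u.

Definition bounded_op T : Prop :=
  [/\ forall u, hmem u -> hmem (T u),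
      forall (a : R[i]) u v, hmem u -> hmem v ->
        heq (T (a *: u + v)) (a *: T u + T v)
    & exists M, op_bound T M].

Definition is_adjoint T S : Prop :=
  bounded_op S /\
  forall u v, hmem u -> hmem v -> hdot (T u) v = hdot u (S v).

Definition unitary_op T : Prop :=
  [/\ bounded_op T,
      forall u v, hmem u -> hmem v -> hdot (T u) (T v) = hdot u v
    & forall v, hmem v -> exists2 u, hmem u & heq (T u) v].

Definition orthonormal_basis (E : set H) : Prop :=
  [/\ E `<=` @hmem R H,
      forall e e', E e -> E e' -> hdot e e' = (e == e')%:R
    & forall u, hmem u -> (forall e, E e -> hdot u e = 0) -> heq u 0].

Definition op_horner (p : {poly R}) A u : H :=
  \sum_(j < size p) (p`_j)%:C *: iter j A u.

(** [is_op_power A r B]: B = A^r, for a bounded positive operator A and r > 0,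
   by the continuous functional calculus: if the polynomials p_k converge
   uniformly to x |-> x^r on [0, M], where M bounds the norm of A, then p_k(A)
   converges in operator norm to A^r. *)
Definition is_op_power A (r : R) B : Prop :=
  bounded_op B /\
  forall (M : R) (p : nat -> {poly R}), op_bound A M ->
    (forall e : R, 0 < e ->
       \forall k \near \oo, forall x : R, 0 <= x <= M ->
         `|(p k).[x] - x `^ r| <= e) ->
    forall e : R, 0 < e ->
      \forall k \near \oo, op_bound (fun u => op_horner (p k) A u - B u) e.

(** [schatten_pow q T] is the q-th power of the q-Schatten norm of a bounded
   operator T, i.e. tr ((T^* T)^(q/2)), in [0, +oo].  All elements of the set
   below are equal: the adjoint and the power are unique (up to [heq]), and the
   trace of a positive operator does not depend on the orthonormal basis. *)
Definition schatten_pow (q : R) T : \bar R :=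
  ereal_inf [set tr | exists S B (E : set H),
    [/\ is_adjoint T S, is_op_power (S \o T) (q / 2) B, orthonormal_basis E
      & tr = \esum_(e in E) (complex.Re (hdot (B e) e))%:E]].

End operators.

Definition L2 (R : realType) (n : nat) : hspace R :=
  @HSpace R ('cV[R]_n -> R[i]^o)
    [set phi | (fun x => complex.Re (phi x)) \in Lfun (lebesgueV R n) 2%:E /\
               (fun x => complex.Im (phi x)) \in Lfun (lebesgueV R n) 2%:E]
    (fun phi psi => Cintegral (lebesgueV R n) (fun x => phi x * conjc (psi x))).

(** L^2(R^n) (x) C^d, realized as the C^d-valued functions with components in
   L^2(R^n); [tensor_op S M] is then the operator S (x) M. *)
Section tensor.
Variables (R : realType) (n d : nat).

Definition component (j : 'I_d) (u : 'cV[R]_n -> 'cV[R[i]]_d) : L2 R n :=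
  fun x => u x j ord0.

Definition L2tensor : hspace R :=
  @HSpace R ('cV[R]_n -> 'cV[R[i]]_d)
    [set u | forall j, hmem (component j u)]
    (fun u v => \sum_(j < d) hdot (component j u) (component j v)).

Definition tensor_op (S : L2 R n -> L2 R n) (M : 'M[R[i]]_d)
    (u : L2tensor) : L2tensor :=
  fun x => M *m \col_j S (component j u) x.

End tensor.

Section representations.
Variables (R : realType) (n : nat).

Definition expi (t : R) : R[i] := cos t +i* sin t.

Definition dotV (x y : 'cV[R]_n) : R := \sum_j x j ord0 * y j ord0.

Definition schrodinger (lambda : R) (z : heisenberg R n) (phi : L2 R n) :
    L2 R n :=
  let: (x, y, t) := z in
  fun xi => expi (lambda * t) *
            expi (lambda * (dotV x xi + dotV x y / 2)) * phi (xi + y).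

Definition is_metaplectic (lambda : R)
    (m : unitary_group R n -> L2 R n -> L2 R n) : Prop :=
  [/\ forall k, unitary_op (m k),
      forall k l phi, hmem phi -> heq (m (k * l)%g phi) (m k (m l phi)),
      forall phi, hmem phi -> forall k0 (e : R), 0 < e ->
        \forall k \near k0, hnorm (m k phi - m k0 phi) < e
    & forall k mk_adj z phi, is_adjoint (m k) mk_adj -> hmem phi ->
        heq (schrodinger lambda (unitary_act k z) phi)
            (m k (schrodinger lambda z (mk_adj phi)))].

Record matrix_rep := MatrixRep {
  rep_dim : nat;
  rep_mx :> unitary_group R n -> 'M[R[i]]_rep_dim }.

HB.instance Definition _ := gen_eqMixin matrix_rep.
HB.instance Definition _ := gen_choiceMixin matrix_rep.

Definition is_unitary_rep (sigma : matrix_rep) : Prop :=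
  [/\ forall k, sigma k \is unitarymx,
      forall k l, sigma (k * l)%g = sigma k *m sigma l
    & forall i j, continuous (fun k => complex.Re (sigma k i j)) /\
                  continuous (fun k => complex.Im (sigma k i j))].

(** Subspaces of C^d are column spaces of matrices W, hence the transposes in
   the row-space inclusion of the library. *)
Definition is_irreducible (sigma : matrix_rep) : Prop :=
  (0 < rep_dim sigma)%N /\
  forall W : 'M[R[i]]_(rep_dim sigma),
    (forall k, ((sigma k *m W)^T <= W^T)%MS) ->
    \rank W = 0%N \/ \rank W = rep_dim sigma.

Definition rep_equiv (sigma tau : matrix_rep) : Prop :=
  exists Q : 'M[R[i]]_(rep_dim tau, rep_dim sigma),
    [/\ Q \is unitarymx, (Q ^t* )%sesqui \is unitarymx
      & forall k, Q *m sigma k = tau k *m Q].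

(** [Khat] is a realization of the unitary dual of U(n): it contains exactly one
   representative of each equivalence class of irreducible unitary
   representations (all finite dimensional, U(n) being compact). *)
Definition is_unitary_dual (Khat : set matrix_rep) : Prop :=
  (forall sigma, Khat sigma -> is_unitary_rep sigma /\ is_irreducible sigma) /\
  (forall tau, is_unitary_rep tau -> is_irreducible tau ->
     exists! sigma, Khat sigma /\ rep_equiv tau sigma).

Definition rho (lambda : R) (m : unitary_group R n -> L2 R n -> L2 R n)
    (sigma : matrix_rep) (g : heisenberg_motion R n) :
    L2tensor R n (rep_dim sigma) -> L2tensor R n (rep_dim sigma) :=
  tensor_op (schrodinger lambda g.1 \o m g.2) (sigma g.2).

(** [T] is the group Fourier transform of [f] at (lambda, sigma); the
   operator-valued integral is understood in the weak sense. *)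
Definition is_fourier_transform (P : probability (unitary_group R n) R)
    (lambda : R) (m : unitary_group R n -> L2 R n -> L2 R n)
    (sigma : matrix_rep) (f : heisenberg_motion R n -> R[i])
    (T : L2tensor R n (rep_dim sigma) -> L2tensor R n (rep_dim sigma)) : Prop :=
  bounded_op T /\
  forall u v, hmem u -> hmem v ->
    hdot (T u) v =
    Cintegral (haarG P) (fun g => f g * hdot (rho lambda m g u) v).

End representations.

Section test_function.
Variables (R : realType) (n : nat).

Definition boxA : set (heisenberg R n) :=
  [set z : heisenberg R n |
    (forall l, `|z.1.1 l ord0| <= 1 /\ `|z.1.2 l ord0| <= 1) /\
    `|z.2| <= 1].

Definition g_xi (xi : R) (z : heisenberg R n) : R :=
  `|z.2| `^ xi * (\prod_(j < n) `|z.1.1 j ord0| `^ xi) *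
  (\prod_(j < n) `|z.1.2 j ord0| `^ xi) * \1_boxA z.

Definition f_xi (xi : R) (g : heisenberg_motion R n) : R := g_xi xi g.1.

End test_function.

(* Main.v *)
Require Import Defs.
From mathcomp Require Import all_boot all_order all_algebra.
From mathcomp Require Import complex.
From mathcomp Require Import finmap.
From mathcomp Require Import all_classical all_reals all_analysis.
From mathcomp Require Import measurable_realfun.
From mathcomp Require Import ring lra.
Import Order.TTheory GRing.Theory Num.Theory.
Import numFieldNormedType.Exports.
Set Implicit Arguments.
Unset Strict Implicit.
Unset Printing Implicit Defensive.
Local Open Scope classical_set_scope.
Local Open Scope complex_scope.
Local Open Scope ring_scope.

(** Since f_xi does not depend on k and the centre of the Heisenberg group acts by
   scalars, every matrix coefficient of the Fourier transform of f_xi at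
   (lambda, sigma) is c(lambda), the Fourier transform of |t|^xi on [-1, 1],
   times an integral over C^n x U(n) which is bounded uniformly in lambda and
   sigma ([fourier_dot], [sqn_fourier_dot_le]).

   For each lambda one of these coefficients is large.  The representation
   mu_lambda acts on the ground state of pi_lambda, a Gaussian, by a character of
   U(n): the diagonal matrix coefficient of the ground state is invariant under
   U(n), and it determines the ground state up to a phase, because averaging pi
   against it gives the projection to the ground state ([schrodinger_projection],
   [sqn_ground_char]).  The dual of U(n) contains a representation sigma with the
   conjugate character ([dual_ground_vector]), so the tensor product of the
   ground state with a vector of sigma is fixed by mu (x) sigma.  Its diagonal
   coefficient is c(lambda) times the 2 n-th power of a Gaussian average of
   |x|^xi, which is of order |lambda|^(-(1+xi)/2) ([fourier_ground_tensor],
   [gaussian_massE], [gaussian_average_ge]).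

   Let T be this Fourier transform.  All its coefficients are O(|c|), hence
   T^* T <= M with M = O(|c|^2), and for q < 2 this gives
   (T^* T)^(q/2) >= M^(q/2-1) T^* T.  So the q-th power of the Schatten norm
   dominates M^(q/2-1) times the square of the large coefficient
   ([schatten_pow_ge]).  The operator inequality is reduced to polynomials: the
   Bernstein polynomials of x^(q/2) converge to it uniformly and lie above the
   chord with positive coefficients ([powR_poly_cvg], [op_power_ge]).  The trace
   over an arbitrary orthonormal basis is handled by Parseval's inequality, which
   needs the completeness of L^2 ([parseval_le], [riesz_fischer]).

   The integrand of the theorem is therefore at least a constant times
   |c(lambda)|^q |lambda|^(-n(1+2 xi)) for |lambda| >= 1 ([schatten_sum_ge]).
   Now c(lambda) has size |lambda|^(-1-xi), and for xi close to -1/2 this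
   density decays about like |lambda|^(-q/2), so its integral diverges.  Instead
   of the pointwise asymptotics of c the proof uses averages: the integral of c
   against e^(-(lambda/L)^2) is at least a constant times L^(-xi), which the
   convergence of the integral would rule out
   ([tail_density_not_integrable]). *)

(** * Real and imaginary parts *)

Section complex_parts.
Variable R : realType.
Implicit Types (x y z : R[i]) (a : R).

(** The squared modulus, as an element of R and not of R[i]. *)
Definition sqn z : R := @complex.Re R z ^+ 2 + @complex.Im R z ^+ 2.

Lemma complex_eq x y :
  complex.Re x = complex.Re y -> complex.Im x = complex.Im y -> x = y.
Proof. by case: x y => [a b] [c d]/= -> ->. Qed.

Lemma ReD x y : @complex.Re R (x + y) = @complex.Re R x + @complex.Re R y.
Proof. by case: x y => [a b] [c d]. Qed.

Lemma ImD x y : @complex.Im R (x + y) = @complex.Im R x + @complex.Im R y.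
Proof. by case: x y => [a b] [c d]. Qed.

Lemma ReN x : @complex.Re R (- x) = - @complex.Re R x.
Proof. by case: x. Qed.

Lemma ImN x : @complex.Im R (- x) = - @complex.Im R x.
Proof. by case: x. Qed.

Lemma ReM x y : @complex.Re R (x * y) =
  @complex.Re R x * @complex.Re R y - @complex.Im R x * @complex.Im R y.
Proof. by case: x y => [a b] [c d]. Qed.

Lemma ImM x y : @complex.Im R (x * y) =
  @complex.Re R x * @complex.Im R y + @complex.Im R x * @complex.Re R y.
Proof. by case: x y => [a b] [c d]. Qed.

Lemma ReJ x : @complex.Re R x^* = @complex.Re R x. Proof. by case: x. Qed.

Lemma ImJ x : @complex.Im R x^* = - @complex.Im R x. Proof. by case: x. Qed.

Definition ReImE := (ReD, ImD, ReN, ImN, ReM, ImM, ReJ, ImJ).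

Lemma Re_sum I (r : seq I) (P : pred I) (F : I -> R[i]) :
  @complex.Re R (\sum_(i <- r | P i) F i) = \sum_(i <- r | P i) @complex.Re R (F i).
Proof. by apply: big_morph => //; exact: ReD. Qed.

Lemma Im_sum I (r : seq I) (P : pred I) (F : I -> R[i]) :
  @complex.Im R (\sum_(i <- r | P i) F i) = \sum_(i <- r | P i) @complex.Im R (F i).
Proof. by apply: big_morph => //; exact: ImD. Qed.

Lemma conjcM x y : (x * y)^* = x^* * y^*.
Proof. exact: rmorphM. Qed.

Lemma conjcD x y : (x + y)^* = x^* + y^*.
Proof. exact: rmorphD. Qed.

Lemma conjc_conjc z : z^*^* = z.
Proof. by case: z => a b; apply: complex_eq; rewrite /= ?opprK. Qed.

Lemma conjcR a : (a%:C)^* = a%:C.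
Proof. by apply: complex_eq; rewrite /= ?oppr0. Qed.

Lemma sqn_ge0 z : 0 <= sqn z.
Proof. by rewrite addr_ge0 ?sqr_ge0. Qed.

Lemma sqnM x y : sqn (x * y) = sqn x * sqn y.
Proof. by case: x y => [a b] [c d]; rewrite /sqn/=; ring. Qed.

Lemma sqnJ x : sqn x^* = sqn x.
Proof. by case: x => a b; rewrite /sqn/= sqrrN. Qed.

Lemma sqn_real a : sqn a%:C = a ^+ 2.
Proof. by rewrite /sqn/= expr0n addr0. Qed.

Lemma sqn0 : sqn 0 = 0. Proof. by rewrite sqn_real expr0n. Qed.

Lemma mulcJ z : z * z^* = (sqn z)%:C.
Proof.
by apply/eqP; rewrite eq_complex; case: z => a b; rewrite /sqn/=; apply/andP;
  split; apply/eqP; ring.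
Qed.

Lemma sqn_eq0 z : sqn z = 0 -> z = 0.
Proof.
move=> /eqP; rewrite paddr_eq0 ?sqr_ge0// !sqrf_eq0 => /andP[/eqP a /eqP b].
by apply/eqP; rewrite eq_complex a b/= !eqxx.
Qed.

Lemma sqr_Re_le z : complex.Re z ^+ 2 <= sqn z.
Proof. by rewrite lerDl sqr_ge0. Qed.

End complex_parts.

(** * Semi-inner product spaces *)

Section inner_space.
Variables (R : realType) (H : hspace R).
Implicit Types (u v w : H) (a : R[i]).

(** An [hspace] carries no axioms; these make [hdot] a semi-inner product on
   the subspace [hmem]. *)
Record inner_space : Prop := InnerSpace {
  inner_mem0 : hmem (0 : H);
  inner_memL : forall a u v, hmem u -> hmem v -> hmem (a *: u + v);
  inner_conj : forall u v, hmem u -> hmem v -> hdot v u = (hdot u v)^*;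
  inner_linear : forall a u v w, hmem u -> hmem v -> hmem w ->
    hdot (a *: u + v) w = a * hdot u w + hdot v w;
  inner_ge0 : forall u, hmem u -> 0 <= complex.Re (hdot u u) }.

Definition hsq u : R := complex.Re (hdot u u).

Hypothesis HH : inner_space.

Lemma hmem_scale a u : hmem u -> hmem (a *: u).
Proof. by move=> mu; rewrite -[_ *: _]addr0; apply: (inner_memL HH) => //; exact: inner_mem0. Qed.

Lemma hmem_add u v : hmem u -> hmem v -> hmem (u + v).
Proof. by move=> mu mv; rewrite -[u]scale1r; exact: (inner_memL HH). Qed.

Lemma hmem_opp u : hmem u -> hmem (- u).
Proof. by rewrite -scaleN1r; exact: hmem_scale. Qed.

Lemma hmem_sub u v : hmem u -> hmem v -> hmem (u - v).
Proof. by move=> mu /hmem_opp; exact: hmem_add. Qed.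

Lemma hmem_sum I (r : seq I) (P : pred I) (F : I -> H) :
  (forall i, hmem (F i)) -> hmem (\sum_(i <- r | P i) F i).
Proof.
move=> mF; elim/big_ind: _ => //; first exact: inner_mem0.
exact: hmem_add.
Qed.

Ltac hm := try solve [repeat first [assumption | exact: (inner_mem0 HH) |
  apply: hmem_sub | apply: hmem_opp | apply: hmem_scale | apply: hmem_add]].

Lemma hdot0l w : hmem w -> hdot 0 w = 0.
Proof.
move=> mw; have m0 := inner_mem0 HH.
have := inner_linear HH 1 m0 m0 mw.
rewrite scaler0 addr0 mul1r => /eqP.
by rewrite -subr_eq subrr eq_sym => /eqP.
Qed.

Lemma hdotDl u v w : hmem u -> hmem v -> hmem w ->
  hdot (u + v) w = hdot u w + hdot v w.
Proof.
by move=> mu mv mw; rewrite -{1}[u]scale1r (inner_linear HH)// mul1r.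
Qed.

Lemma hdotZl a u w : hmem u -> hmem w -> hdot (a *: u) w = a * hdot u w.
Proof.
move=> mu mw; rewrite -[_ *: _]addr0 (inner_linear HH)//; last exact: inner_mem0.
by rewrite hdot0l// addr0.
Qed.

Lemma hdotBl u v w : hmem u -> hmem v -> hmem w ->
  hdot (u - v) w = hdot u w - hdot v w.
Proof.
move=> mu mv mw; rewrite hdotDl; hm.
by rewrite -scaleN1r hdotZl// mulN1r.
Qed.

Lemma hdotDr u v w : hmem u -> hmem v -> hmem w ->
  hdot w (u + v) = hdot w u + hdot w v.
Proof.
move=> mu mv mw.
rewrite (inner_conj HH (hmem_add mu mv) mw) hdotDl// conjcD.
by rewrite -(inner_conj HH mu mw) -(inner_conj HH mv mw).
Qed.

Lemma hdotZr a u w : hmem u -> hmem w -> hdot w (a *: u) = a^* * hdot w u.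
Proof.
move=> mu mw.
rewrite (inner_conj HH (hmem_scale a mu) mw) hdotZl// conjcM.
by rewrite -(inner_conj HH mu mw).
Qed.

Lemma hdotBr u v w : hmem u -> hmem v -> hmem w ->
  hdot w (u - v) = hdot w u - hdot w v.
Proof.
move=> mu mv mw; rewrite hdotDr; hm.
by rewrite -scaleN1r hdotZr// rmorphN1 mulN1r.
Qed.

Lemma hdot_suml I (r : seq I) (P : pred I) (F : I -> H) w :
  (forall i, hmem (F i)) -> hmem w ->
  hdot (\sum_(i <- r | P i) F i) w = \sum_(i <- r | P i) hdot (F i) w.
Proof.
move=> mF mw; elim: r => [|i r IH]; first by rewrite !big_nil hdot0l.
rewrite !big_cons; case: ifP => // _.
by rewrite hdotDl// ?IH//; exact: hmem_sum.
Qed.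

Lemma hdot_sumr I (r : seq I) (P : pred I) (F : I -> H) w :
  (forall i, hmem (F i)) -> hmem w ->
  hdot w (\sum_(i <- r | P i) F i) = \sum_(i <- r | P i) hdot w (F i).
Proof.
move=> mF mw; rewrite (inner_conj HH)//; last exact: hmem_sum.
rewrite hdot_suml// rmorph_sum; apply: eq_bigr => i _.
by rewrite [RHS](inner_conj HH).
Qed.

Lemma hdot_hsq u : hmem u -> hdot u u = (hsq u)%:C.
Proof.
move=> mu; apply: complex_eq => //=.
have := congr1 (@complex.Im R) (inner_conj HH mu mu).
by rewrite ImJ => ?; lra.
Qed.

Lemma hsq_ge0 u : hmem u -> 0 <= hsq u.
Proof. exact: inner_ge0. Qed.

Lemma hnorm_ge0 u : 0 <= hnorm u. Proof. exact: sqrtr_ge0. Qed.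

Lemma sqr_hnorm u : hmem u -> hnorm u ^+ 2 = hsq u.
Proof. by move=> mu; rewrite sqr_sqrtr//; exact: hsq_ge0. Qed.

Lemma hnorm_sqrt u : hnorm u = Num.sqrt (hsq u). Proof. by []. Qed.

Lemma hsqZ a u : hmem u -> hsq (a *: u) = sqn a * hsq u.
Proof.
move=> mu; rewrite /hsq hdotZl; hm; rewrite hdotZr// mulrA mulcJ hdot_hsq//.
by rewrite -rmorphM.
Qed.

Lemma hsqB u v : hmem u -> hmem v ->
  hsq (u - v) = hsq u - 2 * complex.Re (hdot u v) + hsq v.
Proof.
move=> mu mv; rewrite /hsq hdotBl; hm; rewrite !hdotBr//.
by rewrite (inner_conj HH mu mv) !ReImE; ring.
Qed.

Lemma hsqD u v : hmem u -> hmem v ->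
  hsq (u + v) = hsq u + 2 * complex.Re (hdot u v) + hsq v.
Proof.
move=> mu mv; rewrite /hsq hdotDl; hm; rewrite !hdotDr//.
by rewrite (inner_conj HH mu mv) !ReImE; ring.
Qed.

Lemma cauchy_schwarz u v : hmem u -> hmem v -> sqn (hdot u v) <= hsq u * hsq v.
Proof.
move=> mu mv; set z := hdot u v.
have q (t : R) : 0 <= hsq u - 2 * t * sqn z + t ^+ 2 * sqn z * hsq v.
  have mw : hmem ((t%:C * z) *: v) by exact: hmem_scale.
  have := hsq_ge0 (hmem_sub mu mw).
  rewrite hsqB// hsqZ// hdotZr// sqnM sqn_real -/z conjcM conjcR.
  rewrite -mulrA [z^* * z]mulrC mulcJ -rmorphM/=.
  by rewrite !mulrA.
have z0 := sqn_ge0 z; have b0 := hsq_ge0 mv.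
have [b1|] := ltrP 0 (hsq v).
  have := q (hsq v)^-1; set c := (hsq v)^-1.
  have cb : c * hsq v = 1 by rewrite mulVf// gt_eqF.
  have -> : hsq u - 2 * c * sqn z + c ^+ 2 * sqn z * hsq v =
    hsq u - c * sqn z by rewrite expr2 -!mulrA [sqn z * _]mulrC (mulrA c (hsq v)) cb; ring.
  rewrite subr_ge0 => h.
  have -> : sqn z = c * sqn z * hsq v by rewrite mulrAC cb mul1r.
  exact: ler_wpM2r.
move=> bn; have be : hsq v = 0 by apply/eqP; rewrite eq_le bn b0.
rewrite be mulr0 leNgt; apply/negP => zp.
have := q ((hsq u + 1) / (2 * sqn z)); rewrite be mulr0 addr0.
have -> : hsq u - 2 * ((hsq u + 1) / (2 * sqn z)) * sqn z = - 1.
  by field; rewrite gt_eqF.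
by lra.
Qed.

Lemma hsq0_dot u w : hmem u -> hmem w -> hsq u = 0 -> hdot u w = 0.
Proof.
move=> mu mw u0; apply: sqn_eq0; apply/eqP; rewrite eq_le sqn_ge0 andbT.
by rewrite (le_trans (cauchy_schwarz mu mw))// u0 mul0r.
Qed.

Lemma heq_hsq u v : hmem u -> hmem v -> heq u v <-> hsq (u - v) = 0.
Proof.
move=> mu mv; rewrite /heq; split=> [h|]; last first.
  by rewrite hnorm_sqrt => ->; rewrite sqrtr0.
by rewrite -sqr_hnorm; hm; rewrite h expr0n.
Qed.

Lemma heq_dotl u v w : hmem u -> hmem v -> hmem w -> heq u v ->
  hdot u w = hdot v w.
Proof.
move=> mu mv mw /(heq_hsq mu mv) h.
by apply/eqP; rewrite -subr_eq0 -hdotBl// hsq0_dot//; hm.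
Qed.

Lemma heq_dotr u v w : hmem u -> hmem v -> hmem w -> heq u v ->
  hdot w u = hdot w v.
Proof.
move=> mu mv mw h.
by rewrite (inner_conj HH mu mw) (heq_dotl mu mv mw h) -(inner_conj HH mv mw).
Qed.

Lemma hnorm_dot_le u v : hmem u -> hmem v ->
  `|complex.Re (hdot u v)| <= hnorm u * hnorm v.
Proof.
move=> mu mv; rewrite -[leRHS]ger0_norm ?mulr_ge0 ?hnorm_ge0//.
rewrite -ler_sqr ?nnegrE// !real_normK ?num_real// exprMn !sqr_hnorm//.
exact: le_trans (sqr_Re_le _) (cauchy_schwarz mu mv).
Qed.

Lemma hnormD u v : hmem u -> hmem v -> hnorm (u + v) <= hnorm u + hnorm v.
Proof.
move=> mu mv; rewrite -ler_sqr ?nnegrE ?addr_ge0 ?hnorm_ge0//.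
rewrite sqr_hnorm; hm; rewrite hsqD// sqrrD !sqr_hnorm//.
rewrite lerD2r lerD2l -[leRHS]mulr_natl ler_wpM2l//.
exact: le_trans (ler_norm _) (hnorm_dot_le mu mv).
Qed.

Lemma hnormZ a u : hmem u -> hnorm (a *: u) = Num.sqrt (sqn a) * hnorm u.
Proof. by move=> mu; rewrite hnorm_sqrt hsqZ// sqrtrM ?sqn_ge0. Qed.

Lemma heq_refl u : hmem u -> heq u u.
Proof.
by move=> mu; apply/heq_hsq => //; rewrite subrr /hsq hdot0l//; exact: inner_mem0.
Qed.

Lemma heq_sym u v : hmem u -> hmem v -> heq u v -> heq v u.
Proof.
move=> mu mv /(heq_hsq mu mv) h; apply/heq_hsq => //.
by rewrite -opprB -scaleN1r hsqZ; hm; rewrite h mulr0.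
Qed.

Lemma heq_trans u v w : hmem u -> hmem v -> hmem w ->
  heq u v -> heq v w -> heq u w.
Proof.
move=> mu mv mw uv vw; rewrite /heq; apply/eqP; rewrite eq_le hnorm_ge0 andbT.
rewrite (_ : u - w = (u - v) + (v - w)); last by rewrite addrA subrK.
by apply: (le_trans (hnormD _ _)); hm; rewrite uv vw addr0.
Qed.

Lemma heqD u v u' v' : hmem u -> hmem v -> hmem u' -> hmem v' ->
  heq u u' -> heq v v' -> heq (u + v) (u' + v').
Proof.
move=> mu mv mu' mv' hu hv; rewrite /heq; apply/eqP; rewrite eq_le hnorm_ge0 andbT.
rewrite (_ : _ - _ = (u - u') + (v - v')); last by rewrite opprD addrACA.
by apply: (le_trans (hnormD _ _)); hm; rewrite hu hv addr0.
Qed.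

Lemma heqZ a u v : hmem u -> hmem v -> heq u v -> heq (a *: u) (a *: v).
Proof.
by move=> mu mv h; rewrite /heq -scalerBr hnormZ; hm; rewrite h mulr0.
Qed.

(** The linearity clause of [bounded_op] has no separate clause for 0; taking
   u = v = 0 in it yields T 0 = T 0 + T 0. *)
Lemma bounded_op0 (T : H -> H) : bounded_op T -> heq (T 0) 0.
Proof.
case=> mT lT _; have m0 := inner_mem0 HH; have mT0 := mT _ m0.
have := lT 1 _ _ m0 m0; rewrite scaler0 addr0 scale1r => h.
apply: heq_sym => //.
have := heqD mT0 (hmem_opp mT0) (hmem_add mT0 mT0) (hmem_opp mT0) h
  (heq_refl (hmem_opp mT0)).
by rewrite subrr addrK.
Qed.

Lemma bounded_opZ (T : H -> H) a u : bounded_op T -> hmem u ->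
  heq (T (a *: u)) (a *: T u).
Proof.
move=> bT mu; case: (bT) => mT lT _; have m0 := inner_mem0 HH.
have := lT a _ _ mu m0; rewrite addr0 => h.
have mTu := mT _ mu; have mT0 := mT _ m0.
have mTau := mT _ (hmem_scale a mu).
apply: (heq_trans mTau _ _ h); hm.
rewrite -[X in heq _ X]addr0; apply: heqD; hm.
- by apply: heq_refl; hm.
- exact: bounded_op0.
Qed.

End inner_space.

Ltac hmem_tac HH := try solve [repeat first [assumption | exact: (inner_mem0 HH) |
  apply: (hmem_sub HH) | apply: (hmem_opp HH) | apply: (hmem_scale HH) |
  apply: (hmem_add HH)]].

(** * Bernstein operators *)

Section bernstein.
Variables (R : realType).
Implicit Types (f g : nat -> R) (x : R).

(** With p = x, the value [bernstein p k f].[x] is the expectation of f at the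
   number of successes in k independent trials of success probability x; the
   recursion conditions on the first trial. *)
Fixpoint bernstein (p : {poly R}) k f : {poly R} :=
  if k is k'.+1 then p * bernstein p k' (f \o S) + (1 - p) * bernstein p k' f
  else (f 0%N)%:P.

Variable p : {poly R}.

Lemma bernsteinD k f g :
  bernstein p k (f \+ g) = bernstein p k f + bernstein p k g.
Proof.
elim: k f g => [|k IH] f g /=; first by rewrite polyCD.
by rewrite [_ \o _](_ : _ = (f \o S) \+ (g \o S))// !IH !mulrDr addrACA.
Qed.

Lemma bernsteinZ k c f : bernstein p k (c \*o f) = c *: bernstein p k f.
Proof.
elim: k f => [|k IH] f /=; first by rewrite polyCM mul_polyC.
by rewrite [_ \o _](_ : _ = c \*o (f \o S))// !IH -!scalerAr scalerDr.
Qed.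

Lemma bernstein1 k : bernstein p k (fun=> 1) = 1.
Proof.
elim: k => [//|k IH] /=.
by rewrite [_ \o _](_ : _ = fun=> 1)// IH !mulr1 subrKC.
Qed.

Lemma bernstein_cst k c : bernstein p k (fun=> c) = c%:P.
Proof.
rewrite (_ : (fun=> c) = c \*o (fun=> 1)); first by rewrite bernsteinZ bernstein1 alg_polyC.
by apply/funext => j /=; rewrite mulr1.
Qed.

Lemma bernstein_id k : bernstein p k (fun j => j%:R) = k%:R *: p.
Proof.
elim: k => [|k IH] /=; first by rewrite scale0r.
rewrite [_ \o _](_ : _ = (fun j => j%:R) \+ (fun=> 1)); last first.
  by apply/funext => j /=; rewrite -natr1.
rewrite bernsteinD bernstein1 IH -natr1 scalerDl scale1r; ring.
Qed.

Lemma ler_bernstein k f g x : 0 <= p.[x] <= 1 ->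
  (forall j, f j <= g j) -> (bernstein p k f).[x] <= (bernstein p k g).[x].
Proof.
move=> /andP[p0 p1]; elim: k f g => [|k IH] f g fg /=; first by rewrite !hornerC.
rewrite !hornerE lerD// ler_wpM2l ?subr_ge0//; apply: IH => // j.
exact: fg.
Qed.

Lemma bernstein_variance k x : (bernstein p k
  (fun j => (j%:R - k%:R * p.[x]) ^+ 2)).[x] = k%:R * (p.[x] * (1 - p.[x])).
Proof.
set t := p.[x].
suff H a : (bernstein p k (fun j => (j%:R + a - k%:R * t) ^+ 2)).[x] =
    k%:R * (t * (1 - t)) + a ^+ 2.
  rewrite [RHS](_ : _ = k%:R * (t * (1 - t)) + 0 ^+ 2); last by rewrite expr0n addr0.
  by rewrite -H; congr (bernstein _ _ _).[_];
    apply/funext => j; rewrite addr0.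
elim: k a => [|k IH] a /=; first by rewrite hornerC !mul0r; ring.
rewrite [_ \o _](_ : _ = fun j => (j%:R + (a + 1 - t) - k%:R * t) ^+ 2); last first.
  by apply/funext => j /=; rewrite -!natr1; congr (_ ^+ 2); ring.
rewrite [X in _ + _ * bernstein _ _ X](_ : _ =
  fun j => (j%:R + (a - t) - k%:R * t) ^+ 2); last first.
  by apply/funext => j /=; rewrite -!natr1; congr (_ ^+ 2); ring.
rewrite hornerD !hornerM hornerD hornerN hornerC !IH -/t -natr1. ring.
Qed.

End bernstein.

Section powR_modulus.
Variable R : realType.

Lemma ler_powRD (r x y : R) : 0 < r <= 1 -> 0 <= x -> 0 <= y ->
  (x + y) `^ r <= x `^ r + y `^ r.
Proof.
move=> /andP[r0 r1] x0 y0.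
have [->|xy] := eqVneq (x + y) 0.
  by rewrite powR0 ?gt_eqF// addr_ge0 ?powR_ge0.
have s0 : 0 < x + y by rewrite lt_neqAle eq_sym xy addr_ge0.
have le_frac a : 0 <= a -> a <= x + y -> a / (x + y) <= (a / (x + y)) `^ r.
  move=> a0 as_; have [->|az] := eqVneq a 0; first by rewrite mul0r powR_ge0.
  have a_gt0 : 0 < a by rewrite lt_neqAle eq_sym az.
  by rewrite ger1_powR// divr_gt0//= ler_pdivrMr// mul1r.
have h : 1 <= (x / (x + y)) `^ r + (y / (x + y)) `^ r.
  rewrite (le_trans _ (lerD (le_frac x _ _) (le_frac y _ _)))//.
  - by rewrite -mulrDl divff.
  - by rewrite lerDl.
  - by rewrite lerDr.
rewrite -[leLHS]mul1r (le_trans (ler_wpM2r (powR_ge0 _ _) h))//.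
rewrite mulrDl -!powRM ?divr_ge0 ?(ltW s0)//. by rewrite !divfK ?gt_eqF.
Qed.

Lemma dist_powR (r x y : R) : 0 < r <= 1 -> 0 <= x -> 0 <= y ->
  `|x `^ r - y `^ r| <= `|x - y| `^ r.
Proof.
move=> r01; wlog xy : x y / y <= x => [hw x0 y0|x0 y0].
  by have [/hw|/ltW/hw] := leP y x; [exact|rewrite distrC [X in _ <= X `^ _]distrC; exact].
rewrite !ger0_norm ?subr_ge0//; last first.
  by case/andP: r01 => /ltW r0 _; rewrite ge0_ler_powR.
by rewrite lerBlDr -{1}(subrK y x) ler_powRD// subr_ge0.
Qed.

End powR_modulus.

Section bernstein_powR.
Variables (R : realType) (M r : R).
Hypotheses (M0 : 0 < M) (r01 : 0 < r <= 1).

Definition powR_poly k : {poly R} :=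
  bernstein (M^-1 *: 'X) k (fun j => (j%:R / k%:R * M) `^ r).

(** On [0, M] the Bernstein polynomials of a function are averages of its
   values.  Subadditivity of the power makes x |-> x^r Hoelder continuous, so a
   value at distance s from x costs at most s^r <= d^r (1 + (s / d)^2), whose
   average is controlled by the variance, as in Chebyshev's inequality. *)
Lemma powR_poly_cvg (e : R) : 0 < e -> \forall k \near \oo,
  forall x, 0 <= x <= M -> `|(powR_poly k).[x] - x `^ r| <= e.
Proof.
move=> e0; have [r0 r1] := andP r01.
(* Points within distance d of x cost at most e / 2. *)
set d := (e / 2) `^ r^-1.
have d0 : 0 < d by apply: powR_gt0; rewrite divr_gt0.
have dr : d `^ r = e / 2.
  by rewrite -powRrM mulVf ?gt_eqF// powRr1// ltW// divr_gt0.
set C := e / 2 * (M ^+ 2 / d ^+ 2).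
have C0 : 0 < C by rewrite !mulr_gt0 ?invr_gt0 ?exprn_gt0.
near=> k => x /andP[x0 xM].
have k0 : 0 < k%:R :> R by rewrite ltr0n; near: k; exact: nbhs_infty_gt.
set p := M^-1 *: 'X; have pE : p.[x] = x / M by rewrite !hornerE mulrC.
have p01 : 0 <= p.[x] <= 1.
  by rewrite pE divr_ge0 ?(ltW M0)//= ler_pdivrMr// mul1r.
set g := fun j : nat => e / 2 + C / k%:R ^+ 2 * (j%:R - k%:R * p.[x]) ^+ 2.
have b j : `|(j%:R / k%:R * M) `^ r - x `^ r| <= g j.
  set y := j%:R / k%:R * M.
  have y0 : 0 <= y by rewrite !mulr_ge0 ?invr_ge0// ltW.
  have -> : g j = e / 2 * (1 + (`|y - x| / d) ^+ 2).
    rewrite /g expr_div_n real_normK ?num_real// pE /C /y.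
    by field; rewrite !gt_eqF.
  rewrite (le_trans (dist_powR r01 y0 x0))//.
  have -> : `|y - x| = d * (`|y - x| / d) by rewrite mulrC divfK ?gt_eqF.
  have s0 : 0 <= `|y - x| / d by rewrite divr_ge0// ltW.
  rewrite powRM ?(ltW d0)// dr [d * _]mulrC mulfK ?gt_eqF//.
  rewrite ler_pM2l ?divr_gt0//; have [s1|s1] := lerP (`|y - x| / d) 1.
    rewrite (@le_trans _ _ 1)// ?lerDl ?sqr_ge0//.
    by have := ge0_ler_powR (ltW r0) s0 ler01 s1; rewrite powR1; apply.
  rewrite (@le_trans _ _ ((`|y - x| / d) ^+ 2))// ?lerDr//.
  rewrite -powR_mulrn// ler_powR// ?(ltW s1)//.
  by rewrite (le_trans r1)// ler1n.
have xE : x `^ r = (bernstein p k (fun=> x `^ r)).[x] by rewrite bernstein_cst hornerC.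
have -> : (powR_poly k).[x] - x `^ r =
    (bernstein p k (fun j => (j%:R / k%:R * M) `^ r - x `^ r)).[x].
  rewrite [X in bernstein _ _ X](_ : _ =
    (fun j => (j%:R / k%:R * M) `^ r) \+ (-1 \*o (fun=> x `^ r))); last first.
    by apply/funext => j /=; rewrite mulN1r.
  by rewrite bernsteinD bernsteinZ scaleN1r hornerD hornerN -xE.
have gE : (bernstein p k g).[x] <= e.
  rewrite [g](_ : _ = (fun=> e / 2) \+
    ((C / k%:R ^+ 2) \*o (fun j => (j%:R - k%:R * p.[x]) ^+ 2)))//.
  rewrite bernsteinD bernsteinZ bernstein_cst hornerD hornerZ hornerC.
  rewrite bernstein_variance.
  have pp : p.[x] * (1 - p.[x]) <= 1.
    by have /andP[? ?] := p01; rewrite mulr_ile1 ?subr_ge0// lerBlDr lerDl.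
  have -> : C / k%:R ^+ 2 * (k%:R * (p.[x] * (1 - p.[x]))) =
      C / k%:R * (p.[x] * (1 - p.[x])) by field; rewrite gt_eqF.
  have : C / k%:R <= e / 2.
    rewrite ler_pdivrMr// mulrC -ler_pdivrMr ?divr_gt0//.
    by near: k; exact: nbhs_infty_ger.
  have : C / k%:R * (p.[x] * (1 - p.[x])) <= C / k%:R.
    by rewrite ler_piMr// divr_ge0 ?ltW.
  lra.
set F := fun j : nat => (j%:R / k%:R * M) `^ r - x `^ r.
rewrite ler_norml; apply/andP; split.
  rewrite lerNl; apply: le_trans gE.
  rewrite -hornerN -scaleN1r -bernsteinZ; apply: ler_bernstein => // j /=.
  by rewrite mulN1r; apply: le_trans (b j); rewrite -normrN; exact: ler_norm.
apply: le_trans gE; apply: ler_bernstein => // j.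
exact: le_trans (ler_norm _) (b j).
Unshelve. all: by end_near. Qed.

End bernstein_powR.

(** * Powers of a positive operator *)

Section op_power.
Variables (R : realType) (H : hspace R) (HH : inner_space H).
Variables (A : H -> H) (M : R).
Hypotheses (M0 : 0 < M) (mA : forall u, hmem u -> hmem (A u)).
Hypothesis symA : forall u v, hmem u -> hmem v -> hdot (A u) v = hdot u (A v).
Hypothesis posA : forall u, hmem u -> 0 <= complex.Re (hdot (A u) u).
Hypothesis boundA : op_bound A M.
Hypothesis sqA : forall u, hmem u -> hsq (A u) <= M * complex.Re (hdot (A u) u).
Variables (v : H) (mv : hmem v).

Ltac hm := hmem_tac HH.

Lemma hmem_iter j u : hmem u -> hmem (iter j A u).
Proof. by move=> mu; elim: j => //= j; exact: mA. Qed.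

Lemma hmem_op_horner p u : hmem u -> hmem (op_horner p A u).
Proof.
by move=> mu; apply: (hmem_sum HH) => i; apply: (hmem_scale HH); exact: hmem_iter.
Qed.

Lemma hdot_iter i j u w : hmem u -> hmem w ->
  hdot (iter i A u) (iter j A w) = hdot (iter (i + j) A u) w.
Proof.
move=> mu mw; elim: j i => [|j IH] i; first by rewrite addn0.
by rewrite iterS -symA; [rewrite -iterS IH addSnnS|exact: hmem_iter..].
Qed.

Let coef (p : {poly R}) j : R := p`_j.

Lemma op_hornerE p u :
  op_horner p A u = \sum_(j < size p) (coef p j)%:C *: iter j A u.
Proof. by []. Qed.

(** The functional p |-> <p(A) v, v>; operator inequalities between polynomials
   of A are inequalities between its values. *)
Definition moment (p : {poly R}) : R :=
  complex.Re (hdot (op_horner p A v) v).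

Lemma momentE (p : {poly R}) n : (size p <= n)%N ->
  moment p = \sum_(j < n) p`_j * complex.Re (hdot (iter j A v) v).
Proof.
move=> pn; rewrite /moment op_hornerE hdot_suml//; last first.
  by move=> i; apply: (hmem_scale HH); exact: hmem_iter.
rewrite Re_sum (big_ord_widen n (fun j => complex.Re (hdot ((coef p j)%:C *: iter j A v) v)) pn).
rewrite big_mkcond/=; apply: eq_bigr => j _; case: ifPn => [_|].
  by rewrite hdotZl//; [rewrite ReM/= mul0r subr0|exact: hmem_iter].
by rewrite -leqNgt => h; rewrite nth_default// mul0r.
Qed.

Lemma momentD p q : moment (p + q) = moment p + moment q.
Proof.
have h := size_polyD p q.
rewrite (momentE h) (momentE (leq_maxl _ _ : (_ <= maxn (size p) (size q))%N)).
rewrite (momentE (leq_maxr _ _ : (_ <= maxn (size p) (size q))%N)).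
by rewrite -big_split/=; apply: eq_bigr => j _; rewrite coefD mulrDl.
Qed.

Lemma momentZ c p : moment (c *: p) = c * moment p.
Proof.
rewrite (momentE (size_scale_leq c p)) (momentE (leqnn _)) mulr_sumr.
by apply: eq_bigr => j _; rewrite coefZ mulrA.
Qed.

Lemma moment_sum I (r : seq I) (F : I -> {poly R}) :
  moment (\sum_(i <- r) F i) = \sum_(i <- r) moment (F i).
Proof.
elim: r => [|i r IH]; last by rewrite !big_cons momentD IH.
by rewrite !big_nil -(scale0r 0) momentZ mul0r.
Qed.

Lemma momentXn n : moment 'X^n = complex.Re (hdot (iter n A v) v).
Proof.
rewrite (momentE (leqnn _)) size_polyXn big_ord_recr/= coefXn eqxx mul1r.
by rewrite big1 ?add0r// => i _; rewrite coefXn ltn_eqF// mul0r.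
Qed.

Lemma moment_sqr (q : {poly R}) k (w := op_horner q A v) :
  moment ('X^k * (q * q)) = complex.Re (hdot (iter k A w) w).
Proof.
have mw : hmem w by exact: hmem_op_horner.
have -> : 'X^k * (q * q) = \sum_(i < size q) \sum_(j < size q)
    (q`_i * q`_j) *: 'X^(i + j + k).
  rewrite {1 2}[q](_ : _ = \sum_(i < size q) q`_i *: 'X^i); last first.
    by rewrite -poly_def coefK.
  rewrite mulr_suml mulr_sumr; apply: eq_bigr => i _.
  rewrite mulr_sumr mulr_sumr; apply: eq_bigr => j _.
  by rewrite -scalerAl -scalerAr -scalerAr -scalerAr scalerA !exprD; congr (_ *: _); ring.
rewrite moment_sum {2}/w op_hornerE hdot_sumr//; first last.
- exact: hmem_iter.
- by move=> i; apply: (hmem_scale HH); exact: hmem_iter.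
rewrite Re_sum; apply: eq_bigr => i _.
rewrite moment_sum hdotZr//; [|exact: hmem_iter..].
rewrite conjcR (hdot_iter _ _ mw mv) ReM/= mul0r subr0.
have -> : hdot (iter (k + i) A w) v = hdot w (iter (k + i) A v).
  exact: esym (hdot_iter 0 (k + i)%N mw mv).
rewrite /w op_hornerE hdot_suml//; first last.
- exact: hmem_iter.
- by move=> j; apply: (hmem_scale HH); exact: hmem_iter.
rewrite Re_sum mulr_sumr; apply: eq_bigr => j _.
rewrite momentZ momentXn hdotZl//; [|exact: hmem_iter..].
rewrite ReM/= mul0r subr0 (hdot_iter _ _ mv mv) mulrA.
by rewrite (addnC k) addnA (addnC j).
Qed.

(** A product X^a (M - X)^b is a square times one of 1, X, M - X and X (M - X),
   and the hypotheses on A say exactly that these four are positive at A. *)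
Lemma moment_ge0 a b : 0 <= moment ('X^a * (M%:P - 'X) ^+ b).
Proof.
have base q : [/\ 0 <= moment (q * q), 0 <= moment ('X * (q * q)),
    0 <= moment ((M%:P - 'X) * (q * q)) &
    0 <= moment ('X * (M%:P - 'X) * (q * q))].
  have mw : hmem (op_horner q A v) by exact: hmem_op_horner.
  have m0 := moment_sqr q 0; rewrite expr0 mul1r/= in m0.
  have m1 := moment_sqr q 1; rewrite expr1/= in m1.
  have m2 := moment_sqr q 2; rewrite /= in m2.
  have e1 : moment ((M%:P - 'X) * (q * q)) =
      M * moment (q * q) - moment ('X * (q * q)).
    by rewrite mulrBl mul_polyC momentD momentZ -scaleN1r momentZ mulN1r.
  have e2 : moment ('X * (M%:P - 'X) * (q * q)) =
      M * moment ('X * (q * q)) - moment ('X^2 * (q * q)).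
    rewrite (_ : _ * (q * q) = M *: ('X * (q * q)) + -1 *: ('X^2 * (q * q))).
      by rewrite momentD !momentZ mulN1r.
    by rewrite scaleN1r -mul_polyC; ring.
  rewrite e1 e2 m0 m1 m2; split.
  - exact: hsq_ge0.
  - exact: posA.
  - rewrite subr_ge0 (le_trans (ler_norm _))//.
    rewrite (le_trans (hnorm_dot_le HH _ _))//; first exact: mA.
    rewrite (le_trans (ler_wpM2r (hnorm_ge0 _) (boundA mw)))//.
    by rewrite -mulrA -expr2 sqr_hnorm.
  - rewrite subr_ge0 (symA (mA mw) mw); exact: sqA.
rewrite -(odd_double_half a) -(odd_double_half b) !exprD -!mul2n !exprM.
set x := 'X; set y := _ - x.
have [h1 h2 h3 h4] := base (x ^+ a./2 * y ^+ b./2).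
have sq : x ^+ 2 ^+ a./2 * y ^+ 2 ^+ b./2 =
    (x ^+ a./2 * y ^+ b./2) * (x ^+ a./2 * y ^+ b./2).
  by rewrite -!exprM mulrACA -!exprD !addnn !mul2n.
rewrite mulrACA sq; case: (odd a); case: (odd b);
  by rewrite ?expr0 ?expr1 ?mul1r ?mulr1.
Qed.

Lemma moment_bernstein a b k (f : nat -> R) : (forall j, (j <= k)%N -> 0 <= f j) ->
  0 <= moment ('X^a * (M%:P - 'X) ^+ b * bernstein (M^-1 *: 'X) k f).
Proof.
elim: k f a b => [|k IH] f a b f0 /=.
  by rewrite mulrC mul_polyC momentZ mulr_ge0 ?f0// moment_ge0.
have -> : 1 - M^-1 *: 'X = M^-1 *: (M%:P - 'X) :> {poly R}.
  rewrite scalerBr -alg_polyC scalerA mulVf ?gt_eqF//.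
  by rewrite scale1r.
rewrite mulrDr -!scalerAl -!scalerAr momentD !momentZ.
apply: addr_ge0; apply: mulr_ge0; rewrite ?invr_ge0 ?(ltW M0)//.
  by rewrite mulrA [_ * 'X]mulrAC -exprSr; apply: IH => j jk; exact: f0.
rewrite mulrA -[X in moment (X * _)]mulrA -exprSr; apply: IH => j jk.
by apply: f0; exact: leqW.
Qed.

(** For 0 < r <= 1 and 0 <= x <= M, concavity gives M^(r-1) x <= x^r; the
   Bernstein polynomials of x^r lie above the chord as well, with positive
   coefficients, so the inequality passes to A. *)
Lemma op_power_ge r B : 0 < r <= 1 -> is_op_power A r B ->
  M `^ (r - 1) * complex.Re (hdot (A v) v) <= complex.Re (hdot (B v) v).
Proof.
move=> r01 [[mB _ _] hB]; have [r0 r1] := andP r01.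
have mBv := mB _ mv.
have le_k k : (0 < k)%N -> M `^ (r - 1) * complex.Re (hdot (A v) v) <=
    moment (powR_poly M r k).
  move=> k0; have kR : 0 < k%:R :> R by rewrite ltr0n.
  rewrite -[hdot (A v) v]/(hdot (iter 1 A v) v) -momentXn expr1 -momentZ.
  rewrite -subr_ge0 (_ : _ - _ = moment (powR_poly M r k + -1 *: (M `^ (r - 1) *: 'X))); last first.
    by rewrite momentD (momentZ (-1)) mulN1r.
  pose c := M `^ (r - 1) * (k%:R^-1 * M).
  have -> : powR_poly M r k + -1 *: (M `^ (r - 1) *: 'X) =
      'X^0 * (M%:P - 'X) ^+ 0 * bernstein (M^-1 *: 'X) k
        (fun j => (j%:R / k%:R * M) `^ r - c * j%:R).
    rewrite !expr0 !mul1r [X in bernstein _ _ X](_ : _ =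
      (fun j => (j%:R / k%:R * M) `^ r) \+ ((- c) \*o (fun j => j%:R))); last first.
      by apply/funext => j /=; rewrite mulNr.
    rewrite bernsteinD bernsteinZ bernstein_id !scalerA mulN1r; congr (_ + _ *: _).
    by rewrite /c; field; rewrite !gt_eqF.
  apply: moment_bernstein => j jk; rewrite subr_ge0.
  have t1 : j%:R / k%:R <= 1 :> R by rewrite ler_pdivrMr// mul1r ler_nat.
  have t0 : 0 <= j%:R / k%:R :> R by rewrite divr_ge0.
  rewrite powRM ?(ltW M0)//.
  have -> : c * j%:R = j%:R / k%:R * M `^ r.
    by rewrite /c -(mulr_powRB1 (ltW M0) r0); ring.
  rewrite ler_wpM2r ?powR_ge0//; have [->|tz] := eqVneq (j%:R / k%:R : R) 0.
    exact: powR_ge0.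
  by rewrite ger1_powR// t1 andbT lt_neqAle eq_sym tz.
apply/ler_addgt0Pr => e e0.
have e1 : 0 < e / (1 + hsq v).
  by rewrite divr_gt0// (lt_le_trans ltr01)// lerDl (hsq_ge0 HH).
have [k [k0 hk]] : exists k, (0 < k)%N /\
    op_bound (fun u => op_horner (powR_poly M r k) A u - B u) (e / (1 + hsq v)).
  have := hB M (powR_poly M r) boundA (@powR_poly_cvg R M r M0 r01) _ e1.
  move=> /(filterI (nbhs_infty_gt 0)) /filter_ex [k [k0 hk]].
  by exists k.
have := le_k k k0.
have mD : hmem (op_horner (powR_poly M r k) A v - B v).
  by apply: (hmem_sub HH) => //; exact: hmem_op_horner.
have := le_trans (ler_norm _) (hnorm_dot_le HH mD mv).
have /(ler_wpM2r (hnorm_ge0 v)) := hk v mv.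
rewrite hdotBl//; last exact: hmem_op_horner.
rewrite ReD ReN -/(moment (powR_poly M r k)) -mulrA -expr2 sqr_hnorm//.
have : e / (1 + hsq v) * hsq v <= e.
  rewrite -mulrA ler_piMr ?(ltW e0)// mulrC ler_pdivrMr.
    by rewrite mul1r lerDr.
  by rewrite (lt_le_trans ltr01)// lerDl (hsq_ge0 HH).
lra.
Qed.

End op_power.

(** * Parseval's inequality and the trace *)

(** Completeness for the seminorm, asked of sequences with geometrically small
   increments only; every Cauchy sequence has such a subsequence. *)
Definition fast_complete (R : realType) (H : hspace R) : Prop :=
  forall u : nat -> H, (forall k, hmem (u k)) ->
    (forall k, hsq (u k.+1 - u k) <= 4^-1 ^+ k) ->
  exists2 w, hmem w &
    forall e : R, 0 < e -> \forall k \near \oo, hsq (u k - w) <= e.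

Lemma sqnD (R : realType) (x y : R[i]) : sqn (x + y) <= 2 * (sqn x + sqn y).
Proof.
case: x y => [a b] [c d]; rewrite /sqn/=.
have := sqr_ge0 (a - c); have := sqr_ge0 (b - d); nra.
Qed.

Lemma sqnN1 (R : realType) : sqn (- 1 : R[i]) = 1.
Proof. by rewrite /sqn/= oppr0 expr0n addr0 sqrrN expr1n. Qed.

Lemma pow4_small (R : realType) (d : R) : 0 < d -> \forall k \near \oo, 4^-1 ^+ k <= d.
Proof.
move=> d0; have : `|4^-1 : R| < 1 by rewrite ger0_norm// invf_lt1// ltr1n.
move=> /cvg_expr /cvgrPdist_le /(_ _ d0); apply: filterS => k.
by rewrite sub0r normrN ger0_norm// exprn_ge0.
Qed.

Section parseval.
Variables (R : realType) (H : hspace R) (HH : inner_space H).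
Hypothesis complete_H : fast_complete H.
Variables (E : set H) (onb : orthonormal_basis E) (y : H) (my : hmem y).

Implicit Types u v w : H.

Ltac hm := hmem_tac HH.

Lemma hsq_add_le u v : hmem u -> hmem v -> hsq (u + v) <= 2 * (hsq u + hsq v).
Proof.
move=> mu mv; have := hsq_ge0 HH (hmem_sub HH mu mv).
by rewrite (hsqB HH)// (hsqD HH)//; lra.
Qed.

Lemma hmem_sum_seq (I : eqType) (r : seq I) (F : I -> H) :
  (forall i, i \in r -> hmem (F i)) -> hmem (\sum_(i <- r) F i).
Proof.
move=> mF; rewrite big_seq; elim/big_ind: _ => //; first exact: (inner_mem0 HH).
by move=> u v mu mv; hm.
Qed.

Lemma hdot_suml_seq (I : eqType) (r : seq I) (F : I -> H) w :
  (forall i, i \in r -> hmem (F i)) -> hmem w ->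
  hdot (\sum_(i <- r) F i) w = \sum_(i <- r) hdot (F i) w.
Proof.
move=> + mw; elim: r => [|i r IH] mF; first by rewrite !big_nil (hdot0l HH).
have mr j : j \in r -> hmem (F j) by move=> jr; apply: mF; rewrite inE jr orbT.
rewrite !big_cons (hdotDl HH) ?IH//; last exact: hmem_sum_seq.
by apply: mF; rewrite inE eqxx.
Qed.

Let subE G := forall e, e \in (G : {fset H}) -> E e.
Let memE e : E e -> hmem e. Proof. by case: onb => h _ _; exact: h. Qed.

Let coeff e := hdot y e.
Let proj (G : {fset H}) : H := \sum_(e <- G) coeff e *: e.
Let S (G : {fset H}) : R := \sum_(e <- G) sqn (coeff e).

Let mproj G : subE G -> hmem (proj G).
Proof.
by move=> GE; apply: hmem_sum_seq => e eG; apply: (hmem_scale HH); exact/memE/GE.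
Qed.

Let dot_proj G e : subE G -> E e ->
  hdot (proj G) e = if e \in G then coeff e else 0.
Proof.
move=> GE Ee; rewrite hdot_suml_seq; last exact: memE.
  have [_ on _] := onb.
  rewrite (eq_big_seq (fun e' => if e' == e then coeff e else 0)); last first.
    move=> e' e'G; rewrite (hdotZl HH); [|exact/memE/GE|exact: memE].
    rewrite on//; last exact: GE.
    by case: eqP => [->|]; rewrite ?mulr1 ?mulr0.
  rewrite -big_mkcond; case: ifPn => eG.
    by rewrite -big_filter filter_pred1_uniq ?fset_uniq// big_seq1.
  rewrite big_seq_cond big1// => e' /andP[e'G /eqP ee].
  by move: eG; rewrite -ee e'G.
by move=> e' e'G; apply: (hmem_scale HH); exact/memE/GE.
Qed.

Let dot_proj2 G G' : subE G -> subE G' -> (G `<=` G')%fset ->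
  hdot (proj G) (proj G') = (S G)%:C.
Proof.
move=> GE GE' /fsubsetP sub; rewrite {1}/proj hdot_suml_seq; last exact: mproj.
  rewrite rmorph_sum; apply: eq_big_seq => e eG; have Ee := GE _ eG.
  rewrite (hdotZl HH) ?(inner_conj HH (mproj GE') (memE Ee))//; first last.
  - exact: mproj.
  - exact: memE.
  by rewrite dot_proj// sub// mulcJ.
by move=> e' e'G; apply: (hmem_scale HH); exact/memE/GE.
Qed.

Let dot_proj_y G : subE G -> hdot (proj G) y = (S G)%:C.
Proof.
move=> GE; rewrite /proj hdot_suml_seq//.
  rewrite rmorph_sum; apply: eq_big_seq => e eG; have Ee := GE _ eG.
  rewrite (hdotZl HH)//; last exact: memE.
  by rewrite (inner_conj HH my (memE Ee)) mulcJ.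
by move=> e' e'G; apply: (hmem_scale HH); exact/memE/GE.
Qed.

Let hsq_proj2 G G' : subE G -> subE G' -> (G `<=` G')%fset ->
  hsq (proj G' - proj G) = S G' - S G.
Proof.
move=> GE GE' sub; have mG := mproj GE; have mG' := mproj GE'.
rewrite (hsqB HH)// (inner_conj HH mG mG') ReJ dot_proj2//.
by rewrite /hsq !dot_proj2//=; lra.
Qed.

Let hsq_y_proj G : subE G -> hsq (y - proj G) = hsq y - S G.
Proof.
move=> GE; have mG := mproj GE.
rewrite (hsqB HH)// (inner_conj HH mG my) ReJ dot_proj_y//.
by rewrite /hsq dot_proj2//=; lra.
Qed.

Let le_S G G' : subE G -> subE G' -> (G `<=` G')%fset -> S G <= S G'.
Proof.
move=> GE GE' sub; rewrite -subr_ge0 -hsq_proj2//.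
by apply: (hsq_ge0 HH); apply: (hmem_sub HH); exact: mproj.
Qed.

(** Completeness makes the partial Fourier sums of y converge, and the limit has
   the same coefficients as y, hence equals y because the system is maximal. *)
Lemma parseval_le : ((hsq y)%:E <= \esum_(e in E) (sqn (hdot y e))%:E)%E.
Proof.
set sE := esum _ _; have SE G : subE G -> ((S G)%:E <= sE)%E.
  move=> GE; apply: esum_ge; exists [set` G].
    by split; [exact: finite_fset|move=> e; exact: GE].
  by rewrite fsbig_finite// set_fsetK sumEFin.
have inE0 : subE fset0 by move=> e; rewrite in_fset0.
have s0 : (0 <= sE)%E by apply: esum_ge0 => e _; rewrite lee_fin sqn_ge0.
have [->|sfin] := eqVneq sE +oo%E; first exact: leey.
have {}sfin : sE \is a fin_num by rewrite ge0_fin_numE// ltey.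
set s := fine sE; have sEs : sE = s%:E by rewrite fineK.
rewrite sEs lee_fin; rewrite {}sEs in SE.
have {}SE G : subE G -> S G <= s by move/SE; rewrite lee_fin.
have ex_F k : exists G : {fset H}, subE G /\ s - 4^-1 ^+ k <= S G.
  have e0 : 0 < 4^-1 ^+ k :> R by rewrite exprn_gt0.
  have [_ [X [Xfin XE] <-]] := ub_ereal_sup_adherent e0 sfin.
  rewrite -/(esum _ _) -/sE -(fineK sfin) -EFinB fsbig_finite// sumEFin lte_fin => h.
  exists (fset_set X); split; last exact: ltW.
  by move=> e; rewrite in_fset_set// inE => /XE.
have [F hF] := choice ex_F.
(* The sets F k nearly exhaust the sum; their unions are increasing too. *)
pose G := fix g k := if k is k'.+1 then (g k' `|` F k'.+1)%fset else F 0%N.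
have FE k : subE (F k) by have [] := hF k.
have GE k : subE (G k).
  elim: k => [|k IH] e /=; first exact: FE.
  by rewrite in_fsetU => /orP[/IH//|]; exact: FE.
have Gsub k : (G k `<=` G k.+1)%fset by exact: fsubsetUl.
have GS k : s - 4^-1 ^+ k <= S (G k).
  have [_ h] := hF k; apply: (le_trans h); apply: le_S => //.
  by case: k {h} => [|k] //=; exact: fsubsetUr.
have [k|k|w mw cvg_w] := @complete_H (proj \o G).
- exact: mproj.
- by rewrite [leLHS](hsq_proj2 (GE k) (GE k.+1) (Gsub k)) lerBlDr (le_trans (SE _ (GE _)))// -lerBlDl.
have small (d : R) : 0 < d -> exists k, 4^-1 ^+ k <= d /\ hsq (proj (G k) - w) <= d.
  move=> d0; suff /filter_ex[k [h1 h2]] : \forall k \near \oo,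
      hsq (proj (G k) - w) <= d /\ 4^-1 ^+ k <= d by exists k.
  by near=> k; split; near: k; [exact: cvg_w|exact: pow4_small].
have yw : heq (y - w) 0.
  have [_ on maxE] := onb; apply: maxE => [|e Ee]; first by hm.
  have me := memE Ee; apply: sqn_eq0; apply/eqP; rewrite eq_le sqn_ge0 andbT.
  have he : hsq e = 1 by rewrite /hsq on// eqxx.
  apply/ler_addgt0Pr => d d0; rewrite add0r.
  have d4 : 0 < d / 4 by rewrite divr_gt0.
  have [k [k1 k2]] := small _ d4; have mG := mproj (GE k).
  have -> : hdot (y - w) e = hdot (y - proj (G k)) e + hdot (proj (G k) - w) e.
    by rewrite -(hdotDl HH); hm; rewrite addrA subrK.
  have := sqnD (hdot (y - proj (G k)) e) (hdot (proj (G k) - w) e).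
  have := cauchy_schwarz HH (hmem_sub HH mG mw) me.
  suff : sqn (hdot (y - proj (G k)) e) <= 4^-1 ^+ k by rewrite he mulr1; lra.
  rewrite (hdotBl HH)// dot_proj//; case: ifPn => eG.
    by rewrite /coeff subrr sqn0 exprn_ge0.
  have eGE : subE (e |` G k)%fset.
    by move=> e'; rewrite in_fset1U => /predU1P[->//|]; exact: GE.
  rewrite subr0; have := SE _ eGE; have := GS k.
  by rewrite {2}/S big_fsetU1//= -/(S (G k)) /coeff; lra.
rewrite leNgt; apply/negP => sy.
have d0 : 0 < (hsq y - s) / 4 by rewrite divr_gt0// subr_gt0.
have [k [k1 k2]] := small _ d0; have mG := mproj (GE k).
have h1 := hsq_y_proj (GE k); have h2 := SE _ (GE k).
have := hsq_add_le (hmem_sub HH my mw) (hmem_sub HH mw mG).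
have -> : hsq (w - proj (G k)) = hsq (proj (G k) - w).
  rewrite (_ : w - _ = -1 *: (proj (G k) - w)); last by rewrite scaleN1r opprB.
  by rewrite (hsqZ HH); hm; rewrite sqnN1 mul1r.
move: yw => /(heq_hsq HH (hmem_sub HH my mw) (inner_mem0 HH)); rewrite subr0 => ->.
rewrite addrA subrK h1; lra.
Unshelve. all: by end_near. Qed.

End parseval.

Section schatten.
Variables (R : realType) (H : hspace R) (HH : inner_space H).
Hypothesis complete_H : fast_complete H.

Ltac hm := hmem_tac HH.

(** If T^* T <= M then (T^* T)^(q/2) >= M^(q/2-1) T^* T for q <= 2, so the trace
   is at least M^(q/2-1) times the squared Hilbert-Schmidt norm of T, hence at
   least the corresponding multiple of any squared matrix coefficient. *)
Lemma schatten_pow_ge (T : H -> H) (M q : R) (u w : H) :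
  0 < M -> 0 < q <= 2 -> hmem u -> hmem w -> hsq u = 1 -> hsq w = 1 ->
  bounded_op T ->
  (forall a b : H, hmem a -> hmem b ->
    sqn (hdot (T a) b) <= M * hsq a * hsq b) ->
  ((M `^ (q / 2 - 1) * sqn (hdot (T u) w))%:E <= schatten_pow q T)%E.
Proof.
move=> M0 /andP[q0 q2] mu mw u1 w1 [mT _ _] TM; apply: le_ereal_inf_tmp.
move=> _ [S [B [E [[[mS _ _] TS] powB onb ->]]]].
have mSa a (ma : hmem a) : hmem (S a) by exact: mS.
have mTa a (ma : hmem a) : hmem (T a) by exact: mT.
have sqT a : hmem a -> hsq (T a) <= M * hsq a.
  move=> ma; have := TM _ _ ma (mTa _ ma); rewrite (hdot_hsq HH (mTa _ ma)) sqn_real expr2.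
  have := hsq_ge0 HH (mTa _ ma); rewrite le_eqVlt => /predU1P[<- _|h].
    by rewrite mulr_ge0 ?(ltW M0)//; exact: (hsq_ge0 HH).
  by rewrite ler_pM2r.
have sqS a : hmem a -> hsq (S a) <= M * hsq a.
  move=> ma; have := TM _ _ (mSa _ ma) ma.
  rewrite (TS _ _ (mSa _ ma) ma) (hdot_hsq HH (mSa _ ma)) sqn_real.
  have := hsq_ge0 HH (mSa _ ma); rewrite le_eqVlt => /predU1P[<- _|h].
    by rewrite mulr_ge0 ?(ltW M0)//; exact: (hsq_ge0 HH).
  by rewrite expr2 mulrAC ler_pM2r.
pose A := S \o T.
have mA a : hmem a -> hmem (A a) by move=> ma; exact/mSa/mTa.
have dotA a b : hmem a -> hmem b -> hdot (A a) b = hdot (T a) (T b).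
  move=> ma mb; rewrite (inner_conj HH mb (mA _ ma)) -(TS _ _ mb (mTa _ ma)).
  by rewrite -(inner_conj HH (mTa _ mb) (mTa _ ma)).
have symA a b : hmem a -> hmem b -> hdot (A a) b = hdot a (A b).
  by move=> ma mb; rewrite dotA// TS//; exact: mTa.
have posA a : hmem a -> 0 <= complex.Re (hdot (A a) a).
  by move=> ma; rewrite dotA//; exact/(hsq_ge0 HH)/mTa.
have sqA a : hmem a -> hsq (A a) <= M * complex.Re (hdot (A a) a).
  by move=> ma; rewrite dotA//; exact/sqS/mTa.
have boundA : op_bound A M.
  move=> a ma; rewrite -ler_sqr ?nnegrE ?mulr_ge0 ?hnorm_ge0 ?(ltW M0)//.
  rewrite exprMn (sqr_hnorm HH ma) (sqr_hnorm HH (mA _ ma)).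
  rewrite (le_trans (sqS _ (mTa _ ma)))// expr2 -mulrA.
  by rewrite ler_pM2l// sqT.
have r01 : 0 < q / 2 <= 1 by rewrite divr_gt0//= ler_pdivrMr// mul1r.
set c := M `^ (q / 2 - 1); have c0 : 0 <= c by exact: powR_ge0.
(* Parseval's inequality for this y bounds c |<T u, w>|^2 by the sum over e of
   c |<T e, w>|^2, and each term by <B e, e>. *)
pose y := (Num.sqrt c)%:C *: S w.
have my : hmem y by apply: (hmem_scale HH); exact: mSa.
have mE e : E e -> hmem e by have [h _ _] := onb; exact: h.
apply: (@le_trans _ _ (hsq y)%:E).
  rewrite lee_fin (hsqZ HH _ (mSa _ mw)) sqn_real sqr_sqrtr// ler_wpM2l//.
  rewrite (TS _ _ mu mw) -[leRHS]mul1r -u1; apply: cauchy_schwarz => //; exact: mSa.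
apply: (le_trans (parseval_le HH complete_H onb my)).
apply: le_esum => e Ee; have me := mE _ Ee; rewrite lee_fin.
apply: (le_trans _ (op_power_ge HH M0 mA symA posA boundA sqA me r01 powB)).
rewrite (hdotZl HH _ (mSa _ mw) me) sqnM sqn_real sqr_sqrtr// ler_wpM2l//.
rewrite (dotA _ _ me me) (inner_conj HH me (mSa _ mw)) sqnJ -(TS _ _ me mw).
rewrite (le_trans (cauchy_schwarz HH (mTa _ me) mw))// w1 mulr1//.
Qed.

End schatten.

(** * Integrals of complex functions *)

Section Cintegrable.
Context d (T : measurableType d) (R : realType).
Variable mu : {measure set T -> \bar R}.
Implicit Types (f g : T -> R[i]) (h : T -> R).

Definition Cmeasurable f : Prop :=
  measurable_fun setT (fun x => complex.Re (f x)) /\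
  measurable_fun setT (fun x => complex.Im (f x)).

Definition Cintegrable f : Prop :=
  mu.-integrable setT (EFin \o (fun x => complex.Re (f x))) /\
  mu.-integrable setT (EFin \o (fun x => complex.Im (f x))).

Lemma CmeasurableM f g : Cmeasurable f -> Cmeasurable g ->
  Cmeasurable (fun x => f x * g x).
Proof.
move=> [f1 f2] [g1 g2]; split.
  under eq_fun do rewrite ReM.
  by apply: measurable_funB; exact: measurable_funM.
under eq_fun do rewrite ImM.
by apply: measurable_funD; exact: measurable_funM.
Qed.

Lemma CmeasurableD f g : Cmeasurable f -> Cmeasurable g ->
  Cmeasurable (fun x => f x + g x).
Proof.
move=> [f1 f2] [g1 g2]; split.
  by under eq_fun do rewrite ReD; exact: measurable_funD.
by under eq_fun do rewrite ImD; exact: measurable_funD.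
Qed.

Lemma CmeasurableJ f : Cmeasurable f -> Cmeasurable (fun x => (f x)^*).
Proof.
move=> [f1 f2]; split; first by under eq_fun do rewrite ReJ.
by under eq_fun do rewrite ImJ; exact: measurableT_comp.
Qed.

Lemma Cmeasurable_real h : measurable_fun setT h ->
  Cmeasurable (fun x => (h x)%:C).
Proof. by move=> mh; split. Qed.

Lemma Cmeasurable_cst c : Cmeasurable (fun=> c).
Proof. by split. Qed.

Lemma Cmeasurable_sum I (r : seq I) (F : I -> T -> R[i]) :
  (forall i, Cmeasurable (F i)) -> Cmeasurable (fun x => \sum_(i <- r) F i x).
Proof.
move=> mF; elim: r => [|i r IH].
  by under eq_fun do rewrite big_nil; exact: Cmeasurable_cst.
by under eq_fun do rewrite big_cons; exact: CmeasurableD.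
Qed.

Lemma Cmeasurable_expi h : measurable_fun setT h ->
  Cmeasurable (fun x => expi (h x)).
Proof.
by move=> mh; split; apply: measurableT_comp => //;
  apply: continuous_measurable_fun; [exact: continuous_cos|exact: continuous_sin].
Qed.

Lemma measurable_sqn f : Cmeasurable f -> measurable_fun setT (fun x => sqn (f x)).
Proof. by move=> [f1 f2]; apply: measurable_funD; exact: measurable_funX. Qed.

Lemma Cintegrable_measurable f : Cintegrable f -> Cmeasurable f.
Proof.
move=> [/measurable_int f1 /measurable_int f2].
by split; apply/measurable_EFinP.
Qed.

Lemma le_Cintegrable f h : Cmeasurable f -> mu.-integrable setT (EFin \o h) ->
  (forall x, 0 <= h x) -> (forall x, sqn (f x) <= h x ^+ 2) -> Cintegrable f.
Proof.
move=> [f1 f2] ih h0 fh.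
have le_part (p : T -> R) : measurable_fun setT p ->
    (forall x, p x ^+ 2 <= sqn (f x)) -> mu.-integrable setT (EFin \o p).
  move=> mp pf; apply: (le_integrable measurableT _ _ ih).
    exact/measurable_EFinP.
  move=> x _; rewrite /= lee_fin (ger0_norm (h0 x)).
  rewrite -ler_sqr ?nnegrE// real_normK ?num_real//.
  exact: le_trans (pf x) (fh x).
by split; apply: le_part => // x; [exact: sqr_Re_le|rewrite lerDr sqr_ge0].
Qed.

Lemma integrable_ext h1 h2 : h1 =1 h2 ->
  mu.-integrable setT (EFin \o h1) -> mu.-integrable setT (EFin \o h2).
Proof. by move=> /funext ->. Qed.

Lemma integrable_add h1 h2 : mu.-integrable setT (EFin \o h1) ->
  mu.-integrable setT (EFin \o h2) ->
  mu.-integrable setT (EFin \o (fun x => h1 x + h2 x)).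
Proof. by move=> i1 i2; exact: (integrableD measurableT i1 i2). Qed.

Lemma integrable_sub h1 h2 : mu.-integrable setT (EFin \o h1) ->
  mu.-integrable setT (EFin \o h2) ->
  mu.-integrable setT (EFin \o (fun x => h1 x - h2 x)).
Proof. by move=> i1 i2; exact: (integrableB measurableT i1 i2). Qed.

Lemma integrable_scale (a : R) h : mu.-integrable setT (EFin \o h) ->
  mu.-integrable setT (EFin \o (fun x => a * h x)).
Proof. by move=> ih; exact: (integrableZl measurableT a ih). Qed.

Lemma integrable_opp h1 : mu.-integrable setT (EFin \o h1) ->
  mu.-integrable setT (EFin \o (fun x => - h1 x)).
Proof.
by move=> i1; apply: integrable_ext (integrable_scale (-1) i1) => x; rewrite mulN1r.
Qed.

Lemma CintegrableZ (a : R[i]) f : Cintegrable f -> Cintegrable (fun x => a * f x).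
Proof.
move=> [f1 f2]; split.
  apply: integrable_ext (integrable_sub (integrable_scale (complex.Re a) f1)
    (integrable_scale (complex.Im a) f2)) => x.
  by rewrite ReM.
apply: integrable_ext (integrable_add (integrable_scale (complex.Re a) f2)
  (integrable_scale (complex.Im a) f1)) => x.
by rewrite ImM.
Qed.

Lemma CintegrableJ f : Cintegrable f -> Cintegrable (fun x => (f x)^*).
Proof.
move=> [f1 f2]; split; first by apply: integrable_ext f1 => x; rewrite ReJ.
by apply: integrable_ext (integrable_opp f2) => x; rewrite ImJ.
Qed.

Lemma CintegralD f g : Cintegrable f -> Cintegrable g ->
  Cintegral mu (fun x => f x + g x) = Cintegral mu f + Cintegral mu g.
Proof.
move=> [f1 f2] [g1 g2]; apply: complex_eq; rewrite ?ReD ?ImD /=.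
  by rewrite -RintegralD//; apply: eq_Rintegral => x _; rewrite ReD.
by rewrite -RintegralD//; apply: eq_Rintegral => x _; rewrite ImD.
Qed.

Lemma CintegralZ (a : R[i]) f : Cintegrable f ->
  Cintegral mu (fun x => a * f x) = a * Cintegral mu f.
Proof.
move=> [f1 f2]; apply: complex_eq; rewrite ?ReM ?ImM /=.
  rewrite -!RintegralZl// -RintegralB//; try exact: integrable_scale.
  by apply: eq_Rintegral => x _; rewrite ReM.
rewrite -!RintegralZl// -RintegralD//; try exact: integrable_scale.
by apply: eq_Rintegral => x _; rewrite ImM.
Qed.

Lemma CintegralJ f : Cintegrable f ->
  Cintegral mu (fun x => (f x)^*) = (Cintegral mu f)^*.
Proof.
move=> [f1 f2]; apply: complex_eq; rewrite ?ReJ ?ImJ /=.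
  by apply: eq_Rintegral => x _; rewrite ReJ.
rewrite -mulN1r -RintegralZl//.
by apply: eq_Rintegral => x _; rewrite ImJ mulN1r.
Qed.

Lemma eq_Cintegral f g : f =1 g -> Cintegral mu f = Cintegral mu g.
Proof. by move=> /funext ->. Qed.

Lemma Cintegral_real h :
  Cintegral mu (fun x => (h x)%:C) = (\int[mu]_x h x)%:C.
Proof. by apply: complex_eq => //=; rewrite /Rintegral integral0. Qed.

Lemma Cintegrable_real h : mu.-integrable setT (EFin \o h) ->
  Cintegrable (fun x => (h x)%:C).
Proof. by move=> ih; split => //; exact: integrable0. Qed.

Lemma sqn_Cintegral_le f h : Cintegrable f -> mu.-integrable setT (EFin \o h) ->
  (forall x, 0 <= h x) -> (forall x, sqn (f x) <= h x ^+ 2) ->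
  sqn (Cintegral mu f) <= 2 * (\int[mu]_x h x) ^+ 2.
Proof.
move=> [f1 f2] ih h0 fh.
have bound (p : T -> R) : mu.-integrable setT (EFin \o p) ->
    (forall x, p x ^+ 2 <= sqn (f x)) ->
    (\int[mu]_x p x) ^+ 2 <= (\int[mu]_x h x) ^+ 2.
  move=> ip pf; rewrite -real_normK ?num_real// ler_sqr ?nnegrE ?normr_ge0//; last first.
    by apply: Rintegral_ge0 => x _.
  rewrite (le_trans (le_normr_Rintegral measurableT ip))//.
  apply: le_Rintegral => //; first exact: integrable_norm.
  move=> x _ /=; rewrite -(ger0_norm (h0 x)) -ler_sqr ?nnegrE//.
  by rewrite !real_normK ?num_real// (le_trans (pf x)).
rewrite /sqn/= mulr_natl mulr2n lerD// bound// => x; first exact: sqr_Re_le.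
by rewrite lerDr sqr_ge0.
Qed.

End Cintegrable.

Section Cfubini.
Context d1 d2 (T1 : measurableType d1) (T2 : measurableType d2) (R : realType).
Variable m1 : {sigma_finite_measure set T1 -> \bar R}.
Variable m2 : {sigma_finite_measure set T2 -> \bar R}.
Local Notation m12 := (prod_measure m1 m2).

Lemma Rfubini1 (f : T1 * T2 -> R) : m12.-integrable setT (EFin \o f) ->
  {ae m1, forall x, m2.-integrable setT (fun y => (f (x, y))%:E)}.
Proof. exact: ae_integrable1. Qed.

(** Where the section of f is not integrable its Lebesgue integral may be
   infinite, which [Rintegral] reads as 0; this happens on a null set only. *)
Lemma Rintegral12 (f : T1 * T2 -> R) : m12.-integrable setT (EFin \o f) ->
  m1.-integrable setT (EFin \o (fun x => \int[m2]_y f (x, y))) /\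
  \int[m12]_z f z = \int[m1]_x \int[m2]_y f (x, y).
Proof.
move=> fi; have mF := measurable_fubini_F fi; have iF := integrable_fubini_F fi.
have aeF : {ae m1, forall x, [set: T1] x -> fubini_F m2 (EFin \o f) x =
    (EFin \o (fun x => \int[m2]_y f (x, y))) x}.
  apply: filterS (Rfubini1 fi) => x ix _ /=.
  by rewrite /Rintegral fineK//; exact: (integrable_fin_num measurableT ix).
have mG : measurable_fun setT (EFin \o (fun x => \int[m2]_y f (x, y))).
  by apply/measurable_EFinP; apply: measurableT_comp mF.
split; last first.
  rewrite {1}/Rintegral -(integral12_prod_meas1 fi); congr fine.
  exact: ae_eq_integral.
apply/integrableP; split=> //.
have /integrableP[_] := iF; apply: le_lt_trans.
rewrite le_eqVlt; apply/orP; left; apply/eqP; apply: ae_eq_integral => //.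
- exact: measurableT_comp.
- exact: measurableT_comp.
- by apply: filterS aeF => x /(_ I) /= ->.
Qed.

Lemma Rintegral21 (f : T1 * T2 -> R) : m12.-integrable setT (EFin \o f) ->
  m2.-integrable setT (EFin \o (fun y => \int[m1]_x f (x, y))) /\
  \int[m12]_z f z = \int[m2]_y \int[m1]_x f (x, y).
Proof.
move=> fi; have mF := measurable_fubini_G fi.
have mf : measurable_fun setT (EFin \o f) by exact: measurable_int fi.
have aeF : {ae m2, forall y, [set: T2] y -> fubini_G m1 (EFin \o f) y =
    (EFin \o (fun y => \int[m1]_x f (x, y))) y}.
  apply: filterS (ae_integrable2 fi) => y iy _ /=.
  by rewrite /Rintegral fineK//; exact: (integrable_fin_num measurableT iy).
have mG : measurable_fun setT (EFin \o (fun y => \int[m1]_x f (x, y))).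
  by apply/measurable_EFinP; apply: measurableT_comp mF.
split; last first.
  rewrite {1}/Rintegral -(integral21_prod_meas1 fi); congr fine.
  exact: ae_eq_integral.
apply/integrableP; split=> //.
have fo := (@integrable21ltyP _ _ _ _ _ m1 m2 _ mf).1 fi; apply: le_lt_trans fo.
rewrite (_ : integral _ _ _ = \int[m2]_y `|fubini_G m1 (EFin \o f) y|)%E; last first.
  apply: ae_eq_integral => //; try exact: measurableT_comp.
  by apply: filterS aeF => x /(_ I) /= ->.
have mabs : measurable_fun setT (fun z : T1 * T2 => `|(EFin \o f) z|%E).
  exact: measurableT_comp.
apply: ge0_le_integral => //.
- exact: measurableT_comp.
- exact: (measurable_fun_fubini_tonelli_G (fun z => `|(EFin \o f) z|%E)).
- move=> y _; apply: le_abse_integral => //.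
  exact: (measurable_fun_pair1 _ mf).
Qed.

Lemma Cintegral12 (f : T1 * T2 -> R[i]) : Cintegrable m12 f ->
  Cintegrable m1 (fun x => Cintegral m2 (fun y => f (x, y))) /\
  Cintegral m12 f = Cintegral m1 (fun x => Cintegral m2 (fun y => f (x, y))).
Proof.
move=> [/Rintegral12[i1 e1] /Rintegral12[i2 e2]]; split => //.
by apply: complex_eq.
Qed.

Lemma Cintegral21 (f : T1 * T2 -> R[i]) : Cintegrable m12 f ->
  Cintegrable m2 (fun y => Cintegral m1 (fun x => f (x, y))) /\
  Cintegral m12 f = Cintegral m2 (fun y => Cintegral m1 (fun x => f (x, y))).
Proof.
move=> [/Rintegral21[i1 e1] /Rintegral21[i2 e2]]; split => //.
by apply: complex_eq.
Qed.

Lemma integrable_prod (f : T1 -> R) (g : T2 -> R) :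
  m1.-integrable setT (EFin \o f) -> m2.-integrable setT (EFin \o g) ->
  m12.-integrable setT (EFin \o (fun z => f z.1 * g z.2)).
Proof.
move=> fi gi; have /measurable_int/measurable_EFinP mf := fi.
have /measurable_int/measurable_EFinP mg := gi.
have mfg : measurable_fun setT (EFin \o (fun z : T1 * T2 => f z.1 * g z.2)).
  by apply/measurable_EFinP; apply: measurable_funM; exact: measurableT_comp.
apply: (@integrable12ltyP _ _ _ _ _ m1 m2 _ mfg).2 => /=.
under eq_integral => x _.
  under eq_integral => y _ do rewrite normrM EFinM.
  rewrite ge0_integralZl//=; last first.
    by apply/measurable_EFinP; exact: measurableT_comp.
  over.
have /integrableP[_ fo] := fi; have /integrableP[_ go] := gi.
rewrite ge0_integralZr//=.
- by rewrite lte_mul_pinfty ?integral_ge0// ge0_fin_numE ?integral_ge0.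
- by apply/measurable_EFinP; exact: measurableT_comp.
- exact: integral_ge0.
Qed.

Lemma Cintegrable_prod (f : T1 -> R[i]) (g : T2 -> R[i]) :
  Cintegrable m1 f -> Cintegrable m2 g ->
  Cintegrable m12 (fun z => f z.1 * g z.2).
Proof.
move=> [f1 f2] [g1 g2]; split.
  apply: integrable_ext (integrable_sub (integrable_prod f1 g1) (integrable_prod f2 g2)) => z.
  by rewrite ReM.
apply: integrable_ext (integrable_add (integrable_prod f1 g2) (integrable_prod f2 g1)) => z.
by rewrite ImM.
Qed.

Lemma Cintegral_prod (f : T1 -> R[i]) (g : T2 -> R[i]) :
  Cintegrable m1 f -> Cintegrable m2 g ->
  Cintegral m12 (fun z => f z.1 * g z.2) = Cintegral m1 f * Cintegral m2 g.
Proof.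
move=> fi gi; have [_ ->] := Cintegral12 (Cintegrable_prod fi gi).
rewrite mulrC -CintegralZ//; apply: eq_Cintegral => x /=.
by rewrite CintegralZ// mulrC.
Qed.

End Cfubini.

(** * Lebesgue measure on R^n *)

Section translation1.
Variable R : realType.
Local Notation leb := (@lebesgue_measure R).

Lemma measurable_addr (a : R) :
  measurable_fun setT (fun x : measurableTypeR R => x + a : measurableTypeR R).
Proof. exact: measurable_funD. Qed.

Lemma lebesgue_measure_translation (a : R) (A : set (measurableTypeR R)) :
  measurable A -> leb ((fun x => x + a) @^-1` A) = leb A.
Proof.
move=> mA; apply/esym.
rewrite -[RHS]/(pushforward leb (fun x => x + a : measurableTypeR R) A).
apply: lebesgue_measure_unique => //=; first exact: measurable_addr.
move=> _ _ [[b c]] _ <-; rewrite /pushforward.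
rewrite (_ : _ @^-1` _ = `]b - a, c - a]%classic); last first.
  by apply/seteqP; split=> x /=; rewrite !in_itv/= ltrBlDr lerBrDr.
rewrite !lebesgue_measure_itv/= !lte_fin ltrD2r; case: ifPn => // _.
by rewrite -!EFinB; congr EFin; lra.
Qed.

End translation1.

Section translation1_integral.
Variable R : realType.

Lemma ge0_integral_translation (a : R) (f : measurableTypeR R -> \bar R) :
  measurable_fun setT f -> (forall x, 0 <= f x)%E ->
  (\int[lebesgue_measure]_x f (x + a)%R = \int[lebesgue_measure]_x f x)%E.
Proof.
move=> mf f0.
have /= := ge0_integral_pushforward (@measurable_addr R a) lebesgue_measure measurableT mf
  (fun y _ => f0 y).
rewrite preimage_setT => <-; apply: eq_measure_integral; first exact: measurable_addr.
by move=> ? A mA _; exact: lebesgue_measure_translation.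
Qed.

End translation1_integral.

Section lebesgueV.
Variable R : realType.
Local Notation leb := (@lebesgue_measure R).
Local Notation mV n := (lebesgueV R n).

Lemma measurable_addV n (a : 'cV[R]_n) :
  measurable_fun setT (fun x : 'cV[R]_n => x + a).
Proof.
apply: measurable_fun_coord => i.
under eq_fun do rewrite mxE.
by apply: measurable_funD => //; exact: measurable_coord.
Qed.

Lemma lebesgueV_translation n (a : 'cV[R]_n) (A : set 'cV[R]_n) :
  measurable A -> mV n ((fun x => x + a) @^-1` A) = mV n A.
Proof.
elim: n a A => [|n IH] a A mA.
  by congr (mV 0 _); apply/seteqP; split=> x /=; rewrite [x + a]flatmx0 [x]flatmx0.
pose X := @consV R n @^-1` A.
have mX : measurable X.
  by rewrite /X -[X in measurable X]setTI; exact: measurable_consV.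
pose a0 := a ord0 ord0; pose a1 : 'cV[R]_n := \col_i a (lift ord0 i) ord0.
rewrite /= /lebesgue_cons /pushforward -/X.
transitivity (\int[leb]_s (mV n (xsection X (s + a0)%R)))%E; last first.
  apply: (ge0_integral_translation a0 (f := fun s => mV n (xsection X s))).
    exact: measurable_fun_xsection.
  by move=> s; exact: measure_ge0.
apply: eq_integral => s _ /=.
rewrite -(IH a1); last exact: measurable_xsection.
congr (mV n _); apply/seteqP; split => v; rewrite /xsection /= !inE /X /=;
  rewrite (_ : consV (s, v) + a = consV (s + a0, v + a1))//;
  apply/colP => i; rewrite !mxE; case: unliftP => [j ->|->] /=; rewrite ?mxE//.
Qed.

Lemma ge0_integralV_translation n (a : 'cV[R]_n) (f : 'cV[R]_n -> \bar R) :
  measurable_fun setT f -> (forall x, 0 <= f x)%E ->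
  (\int[mV n]_x f (x + a)%R = \int[mV n]_x f x)%E.
Proof.
move=> mf f0.
have /= := ge0_integral_pushforward (@measurable_addV n a) (mV n) measurableT mf
  (fun y _ => f0 y).
rewrite preimage_setT => <-; apply: eq_measure_integral; first exact: measurable_addV.
by move=> ? A mA _; exact: lebesgueV_translation.
Qed.

Lemma integralV_translation n (a : 'cV[R]_n) (f : 'cV[R]_n -> \bar R) :
  (mV n).-integrable setT f ->
  (mV n).-integrable setT (fun x : 'cV[R]_n => f (x + a)) /\
  (\int[mV n]_x f (x + a)%R = \int[mV n]_x f x)%E.
Proof.
move=> fi; have mf : measurable_fun setT f by exact: measurable_int fi.
have mfa : measurable_fun setT (fun x : 'cV[R]_n => f (x + a)).
  exact: measurableT_comp mf (measurable_addV a).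
split; last first.
  rewrite integralE [RHS]integralE; congr (_ - _)%E.
    rewrite -(ge0_integralV_translation a (measurable_funepos mf) (funepos_ge0 f)).
    by apply: eq_integral => x _; rewrite !funeposE.
  rewrite -(ge0_integralV_translation a (measurable_funeneg mf) (funeneg_ge0 f)).
  by apply: eq_integral => x _; rewrite !funenegE.
apply/integrableP; split => //.
have /integrableP[_] := fi.
by rewrite -(ge0_integralV_translation a (f := fun x => `|f x|%E))//; exact: measurableT_comp.
Qed.

Lemma Cintegral_translation n (a : 'cV[R]_n) (f : 'cV[R]_n -> R[i]) :
  Cintegrable (mV n) f ->
  Cintegrable (mV n) (fun x : 'cV[R]_n => f (x + a)) /\
  Cintegral (mV n) (fun x => f (x + a)) = Cintegral (mV n) f.
Proof.
move=> [/(integralV_translation a)[i1 e1] /(integralV_translation a)[i2 e2]].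
by split => //; apply: complex_eq => /=; congr fine.
Qed.

Lemma Cintegral_cons n (f : 'cV[R]_n.+1 -> R[i]) : Cmeasurable f ->
  Cintegrable (prod_measure leb (mV n)) (f \o @consV R n) ->
  Cintegrable (mV n.+1) f /\
  Cintegral (mV n.+1) f = Cintegral (prod_measure leb (mV n)) (f \o @consV R n).
Proof.
have aux (h : 'cV[R]_n.+1 -> R) : measurable_fun setT h ->
    (prod_measure leb (mV n)).-integrable setT (EFin \o (h \o @consV R n)) ->
    (mV n.+1).-integrable setT (EFin \o h) /\
    \int[mV n.+1]_x h x = \int[prod_measure leb (mV n)]_z h (consV z).
  move=> mh ih; have mEh : measurable_fun setT (EFin \o h) by exact/measurable_EFinP.
  split.
    by apply: (integrable_pushforward (@measurable_consV R n) mEh).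
  by congr fine; exact: (integral_pushforward (@measurable_consV R n) mEh).
move=> [m1 m2] [i1 i2].
have [j1 e1] := aux _ m1 i1; have [j2 e2] := aux _ m2 i2.
by split => //; apply: complex_eq.
Qed.

Lemma Cintegral_bigprod n (F : 'I_n -> R -> R[i]) :
  (forall i, Cintegrable leb (F i)) ->
  Cintegrable (mV n) (fun x => \prod_i F i (x i ord0)) /\
  Cintegral (mV n) (fun x => \prod_i F i (x i ord0)) =
    \prod_i Cintegral leb (F i).
Proof.
elim: n F => [|n IH] F iF.
  rewrite big_ord0; have -> : (fun x : 'cV[R]_0 => \prod_(i < 0) F i (x i ord0)) = fun=> 1%:C.
    by apply/funext => x; rewrite big_ord0.
  have i1 : (mV 0).-integrable setT (EFin \o (fun=> 1 : R)).
    apply/integrableP; split; first exact: measurable_cst.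
    by rewrite /= integral_dirac// diracT mul1e ltry.
  split; first exact: Cintegrable_real i1.
  rewrite Cintegral_real; congr (_%:C).
  by rewrite /Rintegral integral_dirac// diracT mul1e.
have [i1 e1] := IH (fun i => F (lift ord0 i)) (fun i => iF (lift ord0 i)).
have mP : Cmeasurable (fun x : 'cV[R]_n.+1 => \prod_i F i (x i ord0)).
  have mF i : Cmeasurable (fun x : 'cV[R]_n.+1 => F i (x i ord0)).
    have [m1 m2] := Cintegrable_measurable (iF i).
    by split; [apply: (measurableT_comp m1)|apply: (measurableT_comp m2)];
      exact: measurable_coord.
  elim: (index_enum _) => [|i r IHr].
    by under eq_fun do rewrite big_nil; exact: Cmeasurable_cst.
  by under eq_fun do rewrite big_cons; exact: CmeasurableM.
have E : (fun x : 'cV[R]_n.+1 => \prod_i F i (x i ord0)) \o @consV R n =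
    fun z => F ord0 z.1 * \prod_i F (lift ord0 i) (z.2 i ord0).
  apply/funext => z /=; rewrite big_ord_recl mxE unlift_none /=; congr (_ * _).
  by apply: eq_bigr => i _; rewrite mxE liftK.
have ip := Cintegrable_prod (m2 := mV n) (iF ord0) i1.
have [|j ->] := Cintegral_cons mP; first by rewrite E.
split => //; rewrite E (Cintegral_prod (m2 := mV n) (iF ord0) i1) e1.
by rewrite big_ord_recl.
Qed.

End lebesgueV.

(** * The Fourier transform of a Gaussian *)

Section gaussian1.
Variable (R : realType) (a : R).
Hypothesis a0 : 0 < a.
Local Notation leb := (@lebesgue_measure R).

Definition gaussian (s : R) : R := expR (- a * s ^+ 2).

Lemma gaussian_ge0 s : 0 <= gaussian s. Proof. exact: expR_ge0. Qed.

Lemma gaussian_le1 s : gaussian s <= 1.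
Proof. by rewrite -expR0 ler_expR mulNr oppr_le0 mulr_ge0 ?sqr_ge0 ?(ltW a0). Qed.

Lemma continuous_gaussian : continuous gaussian.
Proof.
move=> x; apply: (@continuous_comp _ _ _ (fun s : R => - a * s ^+ 2) expR).
  by apply: cvgM; [exact: cvg_cst|exact: exprn_continuous].
exact: continuous_expR.
Qed.

Lemma measurable_gaussian : measurable_fun setT gaussian.
Proof. apply: continuous_measurable_fun; exact: continuous_gaussian. Qed.

Lemma gaussian_integral :
  leb.-integrable setT (EFin \o gaussian) /\
  \int[leb]_s gaussian s = Num.sqrt (pi / a).
Proof.
pose sg := Num.sqrt (2 * a)^-1.
have sg2 : sg ^+ 2 = (2 * a)^-1 by rewrite sqr_sqrtr// invr_ge0 mulr_ge0// (ltW a0).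
have sg0 : sg != 0 by rewrite gt_eqF// sqrtr_gt0 invr_gt0 mulr_gt0.
have p0 : normal_peak sg != 0 by rewrite gt_eqF// normal_peak_gt0.
have E : gaussian = fun s => (normal_peak sg)^-1 * normal_pdf 0 sg s.
  apply/funext => s; rewrite normal_pdfE// /normal_fun mulKf// subr0 sg2 /gaussian.
  congr expR; rewrite -mulr_natl; field; rewrite gt_eqF//.
have i1 := integrable_normal_pdf (0 : R) sg.
split; first by rewrite E; exact: (integrable_scale _ i1).
rewrite E RintegralZl// /Rintegral integral_normal_pdf /= mulr1 /normal_peak invrK.
by congr Num.sqrt; rewrite sg2 -mulr_natl; field; rewrite gt_eqF.
Qed.

End gaussian1.

Lemma abs_gaussian_integrable (R : realType) (a : R) : 0 < a ->
  (@lebesgue_measure R).-integrable setT (EFin \o (fun s => `|s| * gaussian a s)).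
Proof.
move=> a0; have a2 : 0 < a / 2 by rewrite divr_gt0.
have [i1 _] := gaussian_integral a2.
apply: (le_integrable measurableT _ _ (integrable_scale (1 + 2 / a) i1)).
  apply/measurable_EFinP; apply: measurable_funM; first exact: normr_measurable.
  exact: measurable_gaussian.
move=> s _ /=; have c1 : 0 <= 1 + 2 / a by rewrite addr_ge0// divr_ge0// (ltW a0).
rewrite lee_fin [leLHS]ger0_norm; last by rewrite mulr_ge0 ?gaussian_ge0.
rewrite [leRHS]ger0_norm; last by rewrite mulr_ge0 ?gaussian_ge0.
have E : gaussian a s = gaussian (a / 2) s * gaussian (a / 2) s.
  by rewrite /gaussian -expRD; congr expR; field.
have h : `|s| * gaussian (a / 2) s <= 1 + 2 / a.
  rewrite /gaussian mulNr expRN ler_pdivrMr ?expR_gt0//.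
  have e := expR_ge1Dx (a / 2 * s ^+ 2).
  have s2 : s ^+ 2 = `|s| ^+ 2 by rewrite real_normK ?num_real.
  have c0 : 0 < 2 / a by rewrite divr_gt0.
  apply: (@le_trans _ _ ((1 + 2 / a) * (1 + a / 2 * s ^+ 2))); last first.
    by rewrite ler_wpM2l// addr_ge0// (ltW c0).
  have -> : (1 + 2 / a) * (1 + a / 2 * s ^+ 2) =
     1 + 2 / a + a / 2 * s ^+ 2 + s ^+ 2 by field; rewrite gt_eqF.
  have : 0 <= a / 2 * s ^+ 2 by rewrite mulr_ge0 ?sqr_ge0// (ltW a2).
  rewrite s2; have := normr_ge0 s; nra.
by rewrite E mulrA ler_wpM2r ?gaussian_ge0.
Qed.

Section gaussian_fourier.
Variable (R : realType) (a : R).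
Hypothesis a0 : 0 < a.
Local Notation leb := (@lebesgue_measure R).
Local Notation g := (gaussian a).

Lemma is_derive_gaussian (s : R) : is_derive s 1 g (- (2 * a * s) * g s).
Proof.
have -> : g = expR \o ((- a) *: (id : R -> R) ^+ 2).
  by apply/funext => x.
apply: is_derive_eq.
by rewrite /GRing.scale/= !expr1; ring.
Qed.

Lemma is_derive_sinM (b s : R) : is_derive s 1 (fun s => sin (b * s)) (b * cos (b * s)).
Proof.
rewrite (_ : (fun s => sin (b * s)) = sin \o (b *: (id : R -> R)))//.
by apply: is_derive_eq; rewrite /GRing.scale/= mulr1 mulrC.
Qed.

Lemma is_derive_cosM (s b : R) : is_derive b 1 (fun b => cos (b * s)) (- s * sin (b * s)).
Proof.
rewrite (_ : (fun b => cos (b * s)) = cos \o (s *: (id : R -> R))); last first.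
  by apply/funext => x /=; rewrite mulrC.
apply: is_derive_eq; rewrite /GRing.scale/= mulr1 (mulrC b); ring.
Qed.

Lemma measurable_cosM (b : R) : measurable_fun setT (fun s : R => cos (b * s)).
Proof.
apply: measurableT_comp; first by (apply: continuous_measurable_fun; exact: continuous_cos).
exact: measurable_funM.
Qed.

Lemma measurable_sinM (b : R) : measurable_fun setT (fun s : R => sin (b * s)).
Proof.
apply: measurableT_comp; first by (apply: continuous_measurable_fun; exact: continuous_sin).
exact: measurable_funM.
Qed.

Lemma integrable_le (h k : R -> R) : measurable_fun setT h ->
  leb.-integrable setT (EFin \o k) -> (forall s, `|h s| <= k s) ->
  leb.-integrable setT (EFin \o h).
Proof.
move=> mh ik hk; apply: (le_integrable measurableT _ _ ik).
  exact/measurable_EFinP.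
move=> s _ /=; rewrite lee_fin (le_trans (hk s))//; exact: ler_norm.
Qed.

Let ig : leb.-integrable setT (EFin \o g). Proof. exact: (gaussian_integral a0).1. Qed.
Let isg := abs_gaussian_integrable a0.

Let icos b : leb.-integrable setT (EFin \o (fun s => cos (b * s) * g s)).
Proof.
apply: integrable_le ig _ => [|s].
  by apply: measurable_funM; [exact: measurable_cosM|exact: measurable_gaussian].
by rewrite normrM (ger0_norm (gaussian_ge0 _ _)) ler_piMl ?gaussian_ge0// cos_max.
Qed.

Let issin b : leb.-integrable setT (EFin \o (fun s => s * (sin (b * s) * g s))).
Proof.
apply: integrable_le isg _ => [|s].
  apply: measurable_funM => //.
  by apply: measurable_funM; [exact: measurable_sinM|exact: measurable_gaussian].
rewrite !normrM (ger0_norm (gaussian_ge0 _ _)) ler_wpM2l// ler_piMl ?gaussian_ge0//.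
exact: sin_max.
Qed.

Let F b (s : R) := sin (b * s) * g s.
Let f b (s : R) := (b * cos (b * s) - 2 * a * (s * sin (b * s))) * g s.

Let is_derive_F (b s : R) : is_derive s 1 (F b) (f b s).
Proof.
have h1 := is_derive_sinM b s; have h2 := is_derive_gaussian s.
rewrite (_ : F b = (fun s => sin (b * s)) * g)//.
apply: is_derive_eq; rewrite /GRing.scale/= /f; ring.
Qed.

Let continuous_f (b : R) : continuous (f b).
Proof.
move=> x; apply: cvgM; last exact: continuous_gaussian.
have cM : (b * y @[y --> x] --> b * x) by apply: cvgM; [exact: cvg_cst|exact: cvg_id].
apply: cvgB; apply: cvgM; try exact: cvg_cst.
  by apply: (continuous_comp cM); exact: continuous_cos.
apply: cvgM; first exact: cvg_id.
by apply: (continuous_comp cM); exact: continuous_sin.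
Qed.

Let if_ b : leb.-integrable setT (EFin \o f b).
Proof.
apply: integrable_ext (integrable_sub (integrable_scale b (icos b))
  (integrable_scale (2 * a) (issin b))) => s.
by rewrite /f; ring.
Qed.

Let measurable_f b : measurable_fun setT (f b).
Proof. by have /measurable_int/measurable_EFinP := if_ b. Qed.

(** [f b] is the derivative of [F b], which vanishes at both infinities. *)
Let integral_f b : \int[leb]_s f b s = 0.
Proof.
pose fn (k : nat) s := f b s * \1_(`[- (k.+1%:R : R), k.+1%:R]%classic) s.
have fnE k : \int[leb]_s fn k s = 2 * F b k.+1%:R.
  have kk : - (k.+1%:R : R) < k.+1%:R by rewrite gtrN.
  have -> : \int[leb]_s fn k s = \int[leb]_(s in `[- (k.+1%:R : R), k.+1%:R]) f b s.
    rewrite [RHS]Rintegral_mkcond; apply: eq_Rintegral => s _.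
    by rewrite patchE /fn indicE; case: ifP => _; rewrite ?mulr1 ?mulr0.
  rewrite /Rintegral (@continuous_FTC2 _ (f b) (F b))//=.
  - by rewrite /F mulrN sinN /gaussian sqrrN; ring.
  - by apply: continuous_subspaceT; exact: continuous_f.
  - have dF x : derivable (F b) x 1 by have [] := is_derive_F b x.
    have cF : continuous (F b).
      by move=> x; apply/differentiable_continuous/derivable1_diffP.
    split; first by move=> x _; exact: dF.
      exact: cvg_at_right_filter (cF _).
    exact: cvg_at_left_filter (cF _).
  - by move=> x _; rewrite derive1E; have [_] := is_derive_F b x.
have cvg0 : \int[leb]_s fn k s @[k --> \oo] --> 0.
  under eq_fun do rewrite fnE.
  rewrite -(mulr0 2); apply: cvgM; first exact: cvg_cst.
  apply/norm_cvg0P; apply: (@squeeze_cvgr _ _ _ _ (fun=> 0) (fun k => (a * k.+1%:R)^-1)).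
  - near=> k; rewrite normr_ge0/= /F normrM (ger0_norm (gaussian_ge0 _ _)).
    have k1 : 1 <= k.+1%:R :> R by rewrite ler1n.
    have ak : 0 < a * k.+1%:R by rewrite mulr_gt0.
    apply: (@le_trans _ _ (g k.+1%:R)).
      by rewrite ler_piMl ?gaussian_ge0// sin_max.
    rewrite /gaussian mulNr expRN lef_pV2 ?posrE ?expR_gt0//.
    apply: le_trans (expR_ge1Dx _); rewrite -[leLHS]add0r lerD// expr2 mulrA.
    by rewrite ler_peMr// ltW.
  - exact: cvg_cst.
  - under eq_fun do rewrite invfM.
    rewrite -(mulr0 a^-1); apply: cvgM; first exact: cvg_cst.
    exact: cvg_harmonic.
have cvgf : \int[leb]_s fn k s @[k --> \oo] --> \int[leb]_s f b s.
  have mfn k : measurable_fun setT (EFin \o fn k).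
    apply/measurable_EFinP; apply: measurable_funM.
      exact: measurable_f.
    by apply: measurable_indic.
  have fnf k s : `|fn k s| <= `|f b s|.
    by rewrite normrM ler_piMr// indicE; case: (_ \in _); rewrite ?normr1 ?normr0.
  have ptw : {ae leb, forall s, setT s -> (EFin \o fn k) s @[k --> \oo] --> (EFin \o f b) s}.
    apply: aeW => s _; apply: cvg_near_cst; near=> k => /=.
    rewrite /fn indicE mem_set ?mulr1//=.
    rewrite in_itv/= -ler_norml (@le_trans _ _ k%:R)// ?ler_nat//.
    by near: k; exact: nbhs_infty_ger.
  have dom : {ae leb, forall s k, setT s -> (`|(EFin \o fn k) s| <= `|f b s|%:E)%E}.
    by apply: aeW => s k _; rewrite /= lee_fin.
  have mf : measurable_fun setT (EFin \o f b) by exact/measurable_EFinP.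
  have [_ _ h] := @dominated_convergence _ (measurableTypeR R) R leb setT measurableT
    (fun k => EFin \o fn k) (EFin \o f b) (fun s => `|f b s|%:E) mfn mf ptw
    (integrable_norm (if_ b)) dom.
  rewrite /Rintegral; apply: fine_cvg; rewrite fineK//.
  exact: (integrable_fin_num measurableT (if_ b)).
exact: cvg_unique cvgf cvg0.
Unshelve. all: by end_near. Qed.

Let J (b : R) := \int[leb]_s (cos (b * s) * g s).

Let h (b s : R) := cos (b * s) * g s.

Let is_derive_h (b s : R) : is_derive b 1 (h ^~ s) (- (s * (sin (b * s) * g s))).
Proof.
have h1 := is_derive_cosM s b.
rewrite (_ : h ^~ s = (fun b => cos (b * s)) * (cst (g s)))//.
by apply: is_derive_eq; rewrite /GRing.scale/=; ring.
Qed.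

(** Differentiating under the integral and integrating by parts, which is
   [integral_f], gives the differential equation that determines the Gaussian. *)
Let is_derive_J (b : R) : is_derive b 1 J (- (b / (2 * a)) * J b).
Proof.
have Ib : `]b - 1, b + 1[%classic b by rewrite /= in_itv/=; apply/andP; split; lra.
have int_h x : `]b - 1, b + 1[%classic x -> leb.-integrable setT (EFin \o h x).
  by move=> _; exact: icos.
have der_h x y : `]b - 1, b + 1[%classic x -> setT y -> derivable (h ^~ y) x 1.
  by move=> _ _; have [] := is_derive_h x y.
have d1h x y : partial1of2 h x y = - (y * (sin (x * y) * g y)).
  by rewrite partial1of2E; have [_ ->] := is_derive_h x y.
have G0 (y : R) : 0 <= `|y| * g y by rewrite mulr_ge0 ?gaussian_ge0.
have Gub x y : `]b - 1, b + 1[%classic x -> setT y -> `|partial1of2 h x y| <= `|y| * g y.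
  move=> _ _; rewrite d1h normrN !normrM (ger0_norm (gaussian_ge0 _ _)).
  by rewrite ler_wpM2l// ler_piMl ?gaussian_ge0// sin_max.
have dJ : derivable J b 1.
  exact: (@derivable_under_integral R _ (measurableTypeR R) leb h setT measurableT b _ _ Ib int_h der_h (fun y => `|y| * g y) G0 isg Gub).
have vJ : 'D_1 J b = - (b / (2 * a)) * J b.
  rewrite -derive1E (@differentiation_under_integral R _ (measurableTypeR R) leb h setT measurableT b _ _ Ib int_h der_h (fun y => `|y| * g y) G0 isg Gub).
  have e0 := integral_f b.
  have e1 : \int[leb]_s f b s = b * J b - 2 * a * \int[leb]_s (s * (sin (b * s) * g s)).
    rewrite -!RintegralZl// -RintegralB//; try exact: integrable_scale.
    by apply: eq_Rintegral => s _; rewrite /f; ring.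
  have -> : \int[leb]_y partial1of2 h b y = - \int[leb]_s (s * (sin (b * s) * g s)).
    rewrite -mulN1r -RintegralZl//; apply: eq_Rintegral => s _.
    by rewrite d1h mulN1r.
  set S := \int[leb]_s (s * (sin (b * s) * g s)) in e1 *.
  have e2 : b * J b = 2 * a * S by apply/eqP; rewrite -subr_eq0 -e1 e0.
  have -> : - (b / (2 * a)) * J b = - (b * J b / (2 * a)) by ring.
  by rewrite e2; field; rewrite gt_eqF.
by split.
Qed.

Lemma gaussian_cos_integral b :
  \int[leb]_s (cos (b * s) * g s) = Num.sqrt (pi / a) * expR (- (4 * a)^-1 * b ^+ 2).
Proof.
pose E x := expR ((4 * a)^-1 * x ^+ 2) * J x.
have dE (x : R) : is_derive x 1 E 0.
  have h1 := is_derive_J x.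
  have -> : E = (expR \o ((4 * a)^-1 *: (id : R -> R) ^+ 2)) * J by [].
  apply: is_derive_eq; rewrite /GRing.scale/= expr1; field.
  by rewrite gt_eqF.
have := is_derive_0_is_cst b 0 dE.
rewrite /E expr0n/= mulr0 expR0 mul1r.
have -> : J 0 = Num.sqrt (pi / a).
  rewrite -(gaussian_integral a0).2; apply: eq_Rintegral => s _.
  by rewrite mul0r cos0 mul1r.
by move=> <-; rewrite mulNr expRN mulrAC divff ?mul1r// gt_eqF// expR_gt0.
Qed.

(** Reflection s |-> - s changes the sign of the integrand. *)
Lemma gaussian_sin_integral b : \int[leb]_s (sin (b * s) * g s) = 0.
Proof.
have isin : leb.-integrable setT (EFin \o (fun s => sin (b * s) * g s)).
  apply: integrable_le ig _ => [|s].
    by apply: measurable_funM; [exact: measurable_sinM|exact: measurable_gaussian].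
  by rewrite normrM (ger0_norm (gaussian_ge0 _ _)) ler_piMl ?gaussian_ge0// sin_max.
have mN : measurable_fun setT (-%R : measurableTypeR R -> measurableTypeR R) by [].
have odd : \int[leb]_s (sin (b * s) * g s) = \int[leb]_s - (sin (b * s) * g s).
  rewrite {1}/Rintegral.
  rewrite (_ : (\int[leb]_s _)%E = (\int[pushforward leb (-%R : _ -> measurableTypeR R)]_s
      (sin (b * s) * g s)%:E))%E; last first.
    apply: eq_measure_integral => //= A mA _; exact/esym/lebesgue_measureN.
  have mf : measurable_fun setT (EFin \o (fun s => sin (b * s) * g s)).
    exact: measurable_int isin.
  have ef s : (EFin \o (fun s => sin (b * s) * g s)) (- s) = (- (sin (b * s) * g s))%:E.
    by rewrite /= mulrN sinN /gaussian sqrrN mulNr.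
  rewrite (@integral_pushforward _ _ _ _ _ (-%R : measurableTypeR R -> measurableTypeR R) _ leb setT
    (EFin \o (fun s => sin (b * s) * g s)))//.
  by congr fine; apply: eq_integral => s _; rewrite /= -ef.
  rewrite preimage_setT; have := integrable_opp isin.
  by apply: eq_integrable => // s _; exact: (esym (ef s)).
move: odd; rewrite (_ : \int[leb]_s - (sin (b * s) * g s) = - \int[leb]_s (sin (b * s) * g s)).
  by move=> /eqP; rewrite -subr_eq0 opprK -mulr2n mulrn_eq0 /= => /eqP.
rewrite -mulN1r -RintegralZl//.
by apply: eq_Rintegral => s _; rewrite mulN1r.
Qed.

Lemma gaussian_fourier b :
  Cintegrable leb (fun s => expi (b * s) * (g s)%:C) /\
  Cintegral leb (fun s => expi (b * s) * (g s)%:C) =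
    (Num.sqrt (pi / a) * gaussian (4 * a)^-1 b)%:C.
Proof.
split.
  apply: (le_Cintegrable _ ig (gaussian_ge0 a)).
    apply: CmeasurableM; first by apply: Cmeasurable_expi; exact: measurable_funM.
    by apply: Cmeasurable_real; exact: measurable_gaussian.
  by move=> s; rewrite sqnM sqn_real /sqn/= cos2Dsin2 mul1r.
apply: complex_eq => /=.
  rewrite /gaussian -gaussian_cos_integral; apply: eq_Rintegral => s _.
  by rewrite mulr0 subr0.
rewrite -[RHS](gaussian_sin_integral b); apply: eq_Rintegral => s _.
by rewrite mulr0 add0r.
Qed.

End gaussian_fourier.

(** * The Hilbert space of square-integrable functions *)

Section sqintegrable.
Context d (T : measurableType d) (R : realType).
Variable mu : {measure set T -> \bar R}.
Implicit Types (f g : T -> R[i]) (h : T -> R).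

Lemma Lfun2P h : h \in Lfun mu 2%:E <->
  measurable_fun setT h /\ mu.-integrable setT (EFin \o (fun x => h x ^+ 2)).
Proof.
split=> [h2|[mh ih]].
  split; last exact: Lfun2_integrable_sqr.
  by move: h2; rewrite inE => /andP[]; rewrite inE.
rewrite inE; apply/andP; split; rewrite inE//= /finite_norm unlock poweR_lty//=.
have /integrableP[_] := ih; apply: le_lt_trans.
apply: ge0_le_integral => //=.
- apply/measurable_EFinP; apply: (measurableT_comp (measurable_powR _)) => //.
  exact: measurableT_comp.
- by apply/measurable_EFinP; apply: measurableT_comp => //; exact: measurable_funX.
- by move=> x _; rewrite lee_fin powR_mulrn// real_normK ?num_real// ger0_norm// sqr_ge0.
Qed.

Definition sqintegrable f : Prop :=
  Cmeasurable f /\ mu.-integrable setT (EFin \o (fun x => sqn (f x))).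

Lemma sqintegrableP f :
  (fun x => complex.Re (f x)) \in Lfun mu 2%:E /\
  (fun x => complex.Im (f x)) \in Lfun mu 2%:E <-> sqintegrable f.
Proof.
split=> [[/Lfun2P[m1 i1] /Lfun2P[m2 i2]]|[[m1 m2] i]].
  by split => //; exact: (integrable_add i1 i2).
have le_part (p : T -> R) : measurable_fun setT p ->
    (forall x, p x ^+ 2 <= sqn (f x)) -> p \in Lfun mu 2%:E.
  move=> mp pf; apply/Lfun2P; split => //.
  apply: (le_integrable measurableT _ _ i).
    by apply/measurable_EFinP; exact: measurable_funX.
  by move=> x _; rewrite /= lee_fin !ger0_norm ?sqr_ge0 ?sqn_ge0.
by split; apply: le_part => // x; [exact: sqr_Re_le|rewrite lerDr sqr_ge0].
Qed.

Lemma sqintegrableM f g : sqintegrable f -> sqintegrable g ->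
  Cintegrable mu (fun x => f x * (g x)^*).
Proof.
move=> [mf i] [mg j].
apply: (le_Cintegrable _ (integrable_add i j)).
- by apply: CmeasurableM => //; exact: CmeasurableJ.
- by move=> x; rewrite addr_ge0 ?sqn_ge0.
- move=> x; rewrite sqnM sqnJ; have := sqn_ge0 (f x); have := sqn_ge0 (g x).
  nra.
Qed.

Lemma le_sqintegrable f h : Cmeasurable f -> mu.-integrable setT (EFin \o h) ->
  (forall x, sqn (f x) <= h x) -> sqintegrable f.
Proof.
move=> mf ih fh; split => //; apply: (le_integrable measurableT _ _ ih).
  by apply/measurable_EFinP; exact: measurable_sqn.
move=> x _; rewrite /= lee_fin ger0_norm ?sqn_ge0//.
exact: le_trans (fh x) (ler_norm _).
Qed.

Lemma sqintegrable_lin (a : R[i]) f g : sqintegrable f -> sqintegrable g ->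
  sqintegrable (fun x => a * f x + g x).
Proof.
move=> [mf i] [mg j].
apply: (@le_sqintegrable _ (fun x => 2 * (sqn a * sqn (f x) + sqn (g x)))).
- by apply: CmeasurableD => //; apply: CmeasurableM => //; exact: Cmeasurable_cst.
- by apply: integrable_scale; apply: integrable_add => //; exact: integrable_scale.
- by move=> x; rewrite -sqnM; exact: sqnD.
Qed.

End sqintegrable.

Section fast_cauchy.
Variable R : realType.

Lemma geometric_cauchy (v : nat -> R) (K c : R) : 0 <= c < 1 ->
  (forall N m, (N <= m)%N -> `|v m - v N| <= K * c ^+ N) ->
  cvgn v /\ forall N, `|limn v - v N| <= K * c ^+ N.
Proof.
move=> /andP[c0 c1] hv.
have small e : 0 < e -> \forall N \near \oo, `|K * c ^+ N| < e.
  move=> e0; have : (fun N => K * c ^+ N) @ \oo --> (0 : R).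
    rewrite -(mulr0 K); apply: cvgM; first exact: cvg_cst.
    by apply: cvg_expr; rewrite ger0_norm.
  by move=> /cvgr0_norm_lt /(_ _ e0).
have cv : cvgn v.
  apply: cauchy_cvg; apply: cauchy_exP => e e0.
  have [N _ hN] := small _ e0; exists (v N).
  exists N => // m /= Nm; rewrite -ball_normE /= distrC.
  apply: le_lt_trans (hv _ _ Nm) _.
  by apply: le_lt_trans (hN N _) => //=; exact: ler_norm.
split=> // N; apply/ler_addgt0Pr => e e0.
have [m [m1 m2]] : exists m, (N <= m)%N /\ `|limn v - v m| <= e.
  suff /filter_ex[m hm] : \forall m \near \oo, (N <= m)%N /\ `|limn v - v m| <= e by exists m.
  near=> m; split; first by near: m; exact: nbhs_infty_ge.
  by near: m; move/cvgrPdist_le : cv => /(_ _ e0).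
rewrite (_ : limn v - v N = (limn v - v m) + (v m - v N)); last by ring.
by rewrite (le_trans (ler_normD _ _))// addrC lerD// hv.
Unshelve. all: by end_near. Qed.

Lemma geometric_telescope (v : nat -> R) (K c : R) : 0 <= c < 1 -> 0 <= K ->
  (forall k, `|v k.+1 - v k| <= K * c ^+ k) ->
  forall N m, (N <= m)%N -> `|v m - v N| <= K / (1 - c) * c ^+ N.
Proof.
move=> /andP[c0 c1] K0 hv N m Nm.
have c10 : 0 < 1 - c by rewrite subr_gt0.
suff : `|v m - v N| <= K / (1 - c) * (c ^+ N - c ^+ m).
  move=> h; apply: le_trans h _; apply: ler_wpM2l; first by rewrite divr_ge0// ltW.
  by rewrite gerBl exprn_ge0.
rewrite -(subnKC Nm); elim: (m - N)%N => [|k IH].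
  by rewrite addn0 !subrr normr0 mulr0.
rewrite addnS (_ : v _ - v N = (v (N + k).+1 - v (N + k)%N) + (v (N + k)%N - v N)); last by ring.
rewrite (le_trans (ler_normD _ _))// (le_trans (lerD (hv _) IH))//.
by rewrite le_eqVlt; apply/orP; left; apply/eqP; rewrite exprS; field; rewrite gt_eqF.
Qed.

End fast_cauchy.

Section riesz_fischer.
Context d (T : measurableType d) (R : realType).
Variable mu : {measure set T -> \bar R}.
Variable u : nat -> T -> R[i].
Hypothesis mu_ : forall k, sqintegrable mu (u k).
Hypothesis uE : forall k, \int[mu]_x sqn (u k.+1 x - u k x) <= 4^-1 ^+ k.

(** The weight 2^k is small enough for the sum to be integrable and large enough
   to make the increments summable where the sum is finite. *)
Let w2 (k : nat) x : R := 2 ^+ k * sqn (u k.+1 x - u k x).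
Let w2_ge0 k x : 0 <= w2 k x.
Proof. by rewrite mulr_ge0 ?exprn_ge0 ?sqn_ge0. Qed.

Let sqdiff k : sqintegrable mu (fun x => u k.+1 x - u k x).
Proof.
have := sqintegrable_lin (-1) (mu_ k) (mu_ k.+1).
by under eq_fun do rewrite mulN1r addrC.
Qed.

Let mw2 k : measurable_fun setT (w2 k).
Proof.
by apply: measurable_funM => //; apply: measurable_sqn; have [] := sqdiff k.
Qed.

Let S x : \bar R := (\sum_(k <oo) (w2 k x)%:E)%E.

Let S_ge0 x : (0 <= S x)%E.
Proof. by apply: nneseries_ge0 => k _ _; rewrite lee_fin. Qed.

Let mS : measurable_fun setT S.
Proof.
apply: ge0_emeasurable_sum => // [k x _ _|k _]; first by rewrite lee_fin.
exact/measurable_EFinP.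
Qed.

Let intS : (\int[mu]_x S x <= 2%:E)%E.
Proof.
rewrite integral_nneseries//; last 2 first.
- by move=> k; exact/measurable_EFinP.
- by move=> k x _; rewrite lee_fin.
apply: lime_le.
  by apply: is_cvg_nneseries => k _ _; apply: integral_ge0 => x _; rewrite lee_fin.
apply: nearW => m.
apply: (@le_trans _ _ (\sum_(0 <= k < m) (2^-1 ^+ k)%:E)%E).
  apply: lee_sum => k _.
  rewrite -[leLHS]fineK; last first.
    apply: (integrable_fin_num measurableT); exact: integrable_scale (sqdiff k).2.
  rewrite lee_fin -/(Rintegral mu setT _) RintegralZl//; last by have [] := sqdiff k.
  apply: (@le_trans _ _ (2 ^+ k * 4^-1 ^+ k)); first by rewrite ler_wpM2l// exprn_ge0.
  by rewrite -exprMn (_ : 2 * 4^-1 = 2^-1 :> R)//; field.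
rewrite sumEFin lee_fin.
suff : \sum_(0 <= k < m) 2^-1 ^+ k = 2 - 2 * 2^-1 ^+ m :> R.
  by move=> ->; rewrite lerBlDr lerDl mulr_ge0// exprn_ge0.
elim: m => [|m IH]; first by rewrite big_nil expr0 mulr1 subrr.
by rewrite big_nat_recr//= IH exprS; field.
Qed.

Let integrableS : mu.-integrable setT S.
Proof.
apply/integrableP; split => //.
under eq_integral => x _ do rewrite gee0_abs//.
by apply: le_lt_trans intS _; rewrite ltry.
Qed.

Let c : R := Num.sqrt 2^-1.
Let c2 : c ^+ 2 = 2^-1. Proof. by rewrite sqr_sqrtr. Qed.
Let c01 : 0 <= c < 1.
Proof.
rewrite sqrtr_ge0/= -(ltr_sqr (x := c))// ?nnegrE ?sqrtr_ge0//.
by rewrite c2 expr1n invf_lt1// ltr1n.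
Qed.

Let w2_le k x : S x \is a fin_num -> w2 k x <= fine (S x).
Proof.
move=> fS; rewrite -lee_fin fineK//.
apply: le_trans (nneseries_lim_ge k.+1 _); last by move=> i _ _; rewrite lee_fin.
by rewrite big_nat_recr//= leeDr// sume_ge0// => i _; rewrite lee_fin.
Qed.

Let part_bound (p : R[i] -> R) : (forall z y, p (z - y) = p z - p y) ->
  (forall z, p z ^+ 2 <= sqn z) -> forall x, S x \is a fin_num ->
  let v k := p (u k x) in
  cvgn v /\ forall N, (limn v - v N) ^+ 2 <= fine (S x) / (1 - c) ^+ 2 * 2^-1 ^+ N.
Proof.
move=> pB psq x fS v; have [c0 c1] := andP c01.
have S0 : 0 <= fine (S x) by rewrite fine_ge0.
set K := Num.sqrt (fine (S x)).
have K2 : K ^+ 2 = fine (S x) by rewrite sqr_sqrtr.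
have K0 : 0 <= K by exact: sqrtr_ge0.
have hv k : `|v k.+1 - v k| <= K * c ^+ k.
  rewrite -ler_sqr ?nnegrE ?mulr_ge0 ?exprn_ge0// real_normK ?num_real// -pB.
  apply: (le_trans (psq _)); rewrite exprMn K2 -exprM mulnC exprM c2.
  rewrite -(ler_pM2l (x := 2 ^+ k)) ?exprn_gt0// mulrCA -exprMn divff ?expr1n ?mulr1//.
  exact: w2_le.
have [cv hl] := geometric_cauchy c01 (geometric_telescope c01 K0 hv).
split => // N; rewrite -real_normK ?num_real//.
have -> : fine (S x) / (1 - c) ^+ 2 * 2^-1 ^+ N = (K / (1 - c) * c ^+ N) ^+ 2.
  by rewrite exprMn expr_div_n K2 -exprM mulnC exprM c2.
rewrite ler_sqr ?nnegrE//; last exact: le_trans (hl N).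
Qed.

(** The weighted series S of squared increments has integral at most 2; where it
   is finite, the sequence converges geometrically, and its distance to the limit
   is controlled by S. *)
Lemma riesz_fischer : exists w, sqintegrable mu w /\
  forall e : R, 0 < e -> \forall k \near \oo, \int[mu]_x sqn (u k x - w x) <= e.
Proof.
have [c0 c1] := andP c01; have c10 : 0 < 1 - c by rewrite subr_gt0.
pose D := [set x | S x \is a fin_num].
have mD : measurable D.
  rewrite (_ : D = setT `&` S @^-1` (~` [set +oo%E])).
    by apply: mS => //; exact/measurableC/emeasurable_set1.
  rewrite setTI; apply/seteqP; split=> x /=; rewrite /D/= ge0_fin_numE//.
    by move=> /[swap] ->; rewrite ltxx.
  by move=> /eqP; rewrite ltey.
pose cut (p : R[i] -> R) k x := p (u k x) * \1_D x.
pose w x : R[i] := (limn (cut (@complex.Re R) ^~ x)) +i* (limn (cut (@complex.Im R) ^~ x)).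
have cutD (p : R[i] -> R) x : D x -> cut p ^~ x = fun k => p (u k x).
  by move=> Dx; apply/funext => k; rewrite /cut indicE mem_set// mulr1.
have cutND (p : R[i] -> R) x : ~ D x -> cut p ^~ x = cst 0.
  by move=> Dx; apply/funext => k; rewrite /cut indicE memNset// mulr0.
have ReB (z y : R[i]) : @complex.Re R (z - y) = complex.Re z - complex.Re y by rewrite ReD ReN.
have ImB (z y : R[i]) : @complex.Im R (z - y) = complex.Im z - complex.Im y by rewrite ImD ImN.
have Imsq (z : R[i]) : complex.Im z ^+ 2 <= sqn z by rewrite lerDr sqr_ge0.
have mcut (p : R[i] -> R) : (forall z y, p (z - y) = p z - p y) ->
    (forall z, p z ^+ 2 <= sqn z) -> (forall k, measurable_fun setT (fun x => p (u k x))) ->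
    measurable_fun setT (fun x => limn (cut p ^~ x)).
  move=> pB psq mp; apply: (measurable_fun_cvg (h := cut p)).
    by move=> k; apply: measurable_funM => //; exact: measurable_indic.
  move=> x _; have [Dx|Dx] := pselect (D x); last first.
    by rewrite (cutND p _ Dx) lim_cst//; exact: cvg_cst.
  by rewrite (cutD p _ Dx); have [] := part_bound pB psq Dx.
have mw : Cmeasurable w.
  split; apply: mcut => //; first exact: sqr_Re_le.
    by move=> k; have [[]] := mu_ k.
  by move=> k; have [[]] := mu_ k.
pose C := 2 / (1 - c) ^+ 2.
have C0 : 0 < C by rewrite divr_gt0// exprn_gt0.
have wD x N : D x -> sqn (u N x - w x) <= C * 2^-1 ^+ N * fine (S x).
  move=> Dx; have [_ h1] := part_bound ReB (@sqr_Re_le R) Dx.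
  have [_ h2] := part_bound ImB Imsq Dx.
  rewrite /sqn ReB ImB /w /= (cutD _ _ Dx) (cutD _ _ Dx).
  rewrite -sqrrN opprB -[X in _ + X]sqrrN opprB (le_trans (lerD (h1 N) (h2 N)))//.
  by rewrite le_eqVlt; apply/orP; left; apply/eqP; rewrite /C; field; rewrite gt_eqF.
have wE x N : ((sqn (u N x - w x))%:E <= (C * 2^-1 ^+ N)%:E * S x)%E.
  have [Dx|Dx] := pselect (D x).
    by rewrite -(fineK Dx) -EFinM lee_fin; exact: wD.
  have -> : S x = +oo%E.
    by move/negP : Dx; rewrite ge0_fin_numE// -leNgt leye_eq => /eqP.
  by rewrite gt0_muley ?leey// lte_fin mulr_gt0// exprn_gt0.
have ifS : mu.-integrable setT (EFin \o (fun x => fine (S x))).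
  apply: (le_integrable measurableT _ _ integrableS).
    by apply/measurable_EFinP; apply: measurableT_comp mS.
  move=> x _ /=; case: (S x) (S_ge0 x) => [r|//|//] _ //=; rewrite normr0 leey//.
have sw : sqintegrable mu w.
  apply: (@le_sqintegrable _ _ _ _ _ (fun x => 2 * (C * fine (S x) + sqn (u 0%N x)))) => //.
    apply: integrable_scale; apply: integrable_add; first exact: integrable_scale.
    by have [] := mu_ 0%N.
  move=> x; have [Dx|Dx] := pselect (D x); last first.
    rewrite /w (cutND _ _ Dx) (cutND _ _ Dx) lim_cst// sqn0.
    by rewrite mulr_ge0// addr_ge0 ?sqn_ge0// mulr_ge0 ?(ltW C0)// fine_ge0.
  rewrite -(subrK (u 0%N x) (w x)) (le_trans (sqnD _ _))// ler_wpM2l// lerD2r.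
  have -> : sqn (w x - u 0%N x) = sqn (u 0%N x - w x).
    by rewrite -opprB -mulN1r sqnM sqnN1 mul1r.
  by have := wD x 0%N Dx; rewrite expr0 mulr1.
exists w; split => // e e0; have : (fun N => C * 2 * 2^-1 ^+ N) @ \oo --> (0 : R).
  rewrite -(mulr0 (C * 2)); apply: cvgM; first exact: cvg_cst.
  by apply: cvg_expr; rewrite ger0_norm// invf_lt1// ltr1n.
move=> /cvgr0_norm_le /(_ _ e0); apply: filterS => N hN.
apply: le_trans (le_trans (ler_norm _) hN); rewrite /Rintegral -lee_fin.
have dsq : sqintegrable mu (fun x => u N x - w x).
  have := sqintegrable_lin (-1) sw (mu_ N).
  by under eq_fun do rewrite mulN1r addrC.
rewrite fineK; last exact: (integrable_fin_num measurableT dsq.2).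
apply: (@le_trans _ _ (\int[mu]_x ((C * 2^-1 ^+ N)%:E * S x))%E).
  apply: ge0_le_integral => //.
  - by move=> x _; rewrite lee_fin sqn_ge0.
  - by apply/measurable_EFinP; exact: (measurable_sqn dsq.1).
  - exact: measurable_funeM.
rewrite ge0_integralZl//; last first.
  by rewrite lee_fin mulr_ge0 ?exprn_ge0// ltW.
rewrite (_ : C * 2 * _ = C * 2^-1 ^+ N * 2)%R; last by ring.
by rewrite [leRHS]EFinM lee_wpmul2l// lee_fin mulr_ge0 ?exprn_ge0// ltW.
Qed.

End riesz_fischer.

Section L2_spaces.
Variables (R : realType) (n : nat).
Local Notation mV := (lebesgueV R n).
Local Notation L2 := (L2 R n).

Lemma hmem_L2 (phi : L2) : hmem phi <-> sqintegrable mV phi.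
Proof. exact: sqintegrableP. Qed.

Lemma hsq_L2 (phi : L2) : hsq phi = \int[mV]_x sqn (phi x).
Proof.
by rewrite /hsq /= ; apply: eq_Rintegral => x _; rewrite mulcJ.
Qed.

Lemma L2_inner_space : inner_space L2.
Proof.
split.
- apply/hmem_L2; apply: (@le_sqintegrable _ _ _ _ _ (fun=> 0)).
  + exact: Cmeasurable_cst.
  + exact: integrable0.
  + by move=> x; rewrite sqn0.
- move=> a u v /hmem_L2 mu /hmem_L2 mv; apply/hmem_L2.
  exact: sqintegrable_lin.
- move=> u v /hmem_L2 mu /hmem_L2 mv /=.
  rewrite -CintegralJ; last exact: sqintegrableM.
  by apply: eq_Cintegral => x; rewrite conjcM conjc_conjc mulrC.
- move=> a u v w /hmem_L2 mu /hmem_L2 mv /hmem_L2 mw /=.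
  have i1 := sqintegrableM mu mw; have i2 := sqintegrableM mv mw.
  rewrite -CintegralZ// -CintegralD//; last exact: CintegrableZ.
  by apply: eq_Cintegral => x; rewrite -[(a *: u + v) x]/(a * u x + v x) mulrDl mulrA.
- move=> u mu; rewrite -/(hsq u) hsq_L2; apply: Rintegral_ge0 => x _.
  exact: sqn_ge0.
Qed.

Variable d : nat.
Local Notation L2t := (L2tensor R n d).

Lemma component_lin j (a : R[i]) (u v : L2t) :
  component j (a *: u + v) = a *: component j u + component j v.
Proof. by apply/funext => x; rewrite /component !mxE. Qed.

Lemma component_sub j (u v : L2t) :
  component j (u - v) = component j u - component j v.
Proof. by apply/funext => x; rewrite /component !mxE. Qed.

Lemma hsq_L2tensor (u : L2t) : hsq u = \sum_(j < d) hsq (component j u).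
Proof. by rewrite /hsq /= Re_sum. Qed.

Lemma L2tensor_inner_space : inner_space L2t.
Proof.
have H2 := L2_inner_space; split.
- move=> j; rewrite (_ : component j _ = 0); first exact: (inner_mem0 H2).
  by apply/funext => x; rewrite /component mxE.
- move=> a u v mu mv j; rewrite component_lin.
  by apply: (inner_memL H2); [exact: mu|exact: mv].
- move=> u v mu mv /=; rewrite rmorph_sum; apply: eq_bigr => j _.
  by apply: (inner_conj H2); [exact: mu|exact: mv].
- move=> a u v w mu mv mw /=; rewrite mulr_sumr -big_split /=.
  apply: eq_bigr => j _; rewrite component_lin.
  by apply: (inner_linear H2); [exact: mu|exact: mv|exact: mw].
- move=> u mu; rewrite -/(hsq u) hsq_L2tensor; apply: sumr_ge0 => j _.
  by apply: (hsq_ge0 H2); exact: mu.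
Qed.

Lemma L2tensor_fast_complete : fast_complete L2t.
Proof.
have H2 := L2_inner_space; move=> u mu uE.
have uj j k : sqintegrable mV (component j (u k)) by apply/hmem_L2; exact: mu.
have ujE j k : \int[mV]_x sqn (component j (u k.+1) x - component j (u k) x) <= 4^-1 ^+ k.
  apply: le_trans (uE k); rewrite hsq_L2tensor (bigD1 j)//=.
  rewrite component_sub hsq_L2 lerDl; apply: sumr_ge0 => i _.
  apply: (hsq_ge0 H2); rewrite component_sub.
  by apply: (hmem_sub H2); exact: mu.
have [w hw] := choice (fun j => riesz_fischer (uj j) (ujE j)).
pose W : L2t := fun x => \col_j w j x.
have WE j : component j W = w j by apply/funext => x; rewrite /component mxE.
exists W; first by move=> j; rewrite WE; apply/hmem_L2; have [] := hw j.
move=> e e0; have e1 : 0 < e / d.+1%:R by rewrite divr_gt0.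
have : \forall k \near \oo, forall j, \int[mV]_x sqn (component j (u k) x - w j x) <= e / d.+1%:R.
  apply: filter_forall => j; have [_ h] := hw j; exact: h.
apply: filterS => k hk; rewrite hsq_L2tensor.
apply: (@le_trans _ _ (\sum_(j < d) e / d.+1%:R)).
  by apply: ler_sum => j _; rewrite component_sub WE hsq_L2; exact: hk.
rewrite sumr_const card_ord -[leLHS]mulr_natr -mulrA ler_piMr ?(ltW e0)//.
by rewrite mulrC ler_pdivrMr// mul1r ler_nat.
Qed.

End L2_spaces.

(** * The Schroedinger representation and its ground state *)

Section expi.
Variable R : realType.
Implicit Types s t : R.

Lemma expiD s t : expi (s + t) = expi s * expi t.
Proof. by apply: complex_eq; rewrite /= ?cosD ?sinD; ring. Qed.

Lemma expi0 : expi (0 : R) = 1.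
Proof. by rewrite /expi cos0 sin0. Qed.

Lemma sqn_expi t : sqn (expi t) = 1.
Proof. by rewrite /sqn/= cos2Dsin2. Qed.

Lemma expi_sum I (r : seq I) (F : I -> R) :
  expi (\sum_(i <- r) F i) = \prod_(i <- r) expi (F i).
Proof. by apply: big_morph; [exact: expiD|exact: expi0]. Qed.

End expi.

Section dotV.
Variables (R : realType) (n : nat).
Implicit Types x y z : 'cV[R]_n.

Lemma dotVC x y : dotV x y = dotV y x.
Proof. by apply: eq_bigr => j _; rewrite mulrC. Qed.

Lemma dotVDl x y z : dotV (x + y) z = dotV x z + dotV y z.
Proof. by rewrite -big_split; apply: eq_bigr => j _; rewrite mxE mulrDl. Qed.

Lemma dotVDr x y z : dotV z (x + y) = dotV z x + dotV z y.
Proof. by rewrite dotVC dotVDl !(dotVC _ z). Qed.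

Lemma dotVZl a x y : dotV (a *: x) y = a * dotV x y.
Proof. by rewrite mulr_sumr; apply: eq_bigr => j _; rewrite mxE mulrA. Qed.

Lemma dotVZr a x y : dotV x (a *: y) = a * dotV x y.
Proof. by rewrite dotVC dotVZl dotVC. Qed.

Lemma dotV_ge0 x : 0 <= dotV x x.
Proof. by apply: sumr_ge0 => j _; rewrite -expr2 sqr_ge0. Qed.

Definition gaussV (a : R) x : R := expR (- a * dotV x x).

Lemma gaussV_ge0 a x : 0 <= gaussV a x. Proof. exact: expR_ge0. Qed.

Lemma gaussV_prod a x : gaussV a x = \prod_j gaussian a (x j ord0).
Proof.
rewrite /gaussV /dotV mulr_sumr expR_sum; apply: eq_bigr => j _.
by rewrite /gaussian expr2.
Qed.

Context d (T : measurableType d).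

Lemma measurable_dotV (f g : T -> 'cV[R]_n) :
  measurable_fun setT f -> measurable_fun setT g ->
  measurable_fun setT (fun t => dotV (f t) (g t)).
Proof.
move=> mf mg; apply: measurable_sum => j; apply: measurable_funM.
  exact: measurableT_comp (measurable_coord j) mf.
exact: measurableT_comp (measurable_coord j) mg.
Qed.

Lemma measurable_addfV (f g : T -> 'cV[R]_n) :
  measurable_fun setT f -> measurable_fun setT g ->
  measurable_fun setT (fun t => f t + g t).
Proof.
move=> mf mg; apply: measurable_fun_coord => i.
under eq_fun do rewrite mxE.
apply: measurable_funD; first exact: measurableT_comp (measurable_coord i) mf.
exact: measurableT_comp (measurable_coord i) mg.
Qed.

Lemma measurable_gaussV a (f : T -> 'cV[R]_n) :
  measurable_fun setT f -> measurable_fun setT (fun t => gaussV a (f t)).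
Proof.
move=> mf; apply: (measurableT_comp (@measurable_expR R)); apply: measurable_funM => //.
exact: measurable_dotV.
Qed.

End dotV.

Lemma Cmeasurable_comp d1 d2 (T1 : measurableType d1) (T2 : measurableType d2)
    (R : realType) (f : T1 -> R[i]) (g : T2 -> T1) :
  Cmeasurable f -> measurable_fun setT g -> Cmeasurable (f \o g).
Proof.
by move=> [m1 m2] mg; split; [exact: (measurableT_comp m1 mg)|exact: (measurableT_comp m2 mg)].
Qed.

Section gaussV_fourier.
Variables (R : realType) (n : nat).
Local Notation mV := (lebesgueV R n).

Lemma gaussV_fourier (a : R) (s : 'cV[R]_n) : 0 < a ->
  Cintegrable mV (fun x => expi (dotV s x) * (gaussV a x)%:C) /\
  Cintegral mV (fun x => expi (dotV s x) * (gaussV a x)%:C) =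
    (Num.sqrt (pi / a) ^+ n * gaussV (4 * a)^-1 s)%:C.
Proof.
move=> a0.
pose F (j : 'I_n) (t : R) : R[i] := expi (s j ord0 * t) * (gaussian a t)%:C.
have FE : (fun x => expi (dotV s x) * (gaussV a x)%:C) =
    fun x => \prod_j F j (x j ord0).
  apply/funext => x; rewrite /dotV expi_sum gaussV_prod rmorph_prod -big_split.
  by [].
have iF j : Cintegrable lebesgue_measure (F j) by have [] := gaussian_fourier a0 (s j ord0).
have [i1 e1] := Cintegral_bigprod iF.
rewrite FE; split => //; rewrite e1 gaussV_prod.
have -> : Num.sqrt (pi / a) ^+ n = \prod_(j < n) Num.sqrt (pi / a).
  by rewrite prodr_const card_ord.
rewrite -big_split rmorph_prod; apply: eq_bigr => j _.
by have [_ ->] := gaussian_fourier a0 (s j ord0).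
Qed.

Lemma gaussV_integrable (a : R) : 0 < a ->
  mV.-integrable setT (EFin \o (@gaussV R n a)) /\
  \int[mV]_x gaussV a x = Num.sqrt (pi / a) ^+ n.
Proof.
move=> a0; have [[i1 _] e1] := gaussV_fourier 0 a0.
have E : (fun x : 'cV[R]_n => complex.Re (expi (dotV 0 x) * (gaussV a x)%:C)) = gaussV a.
  apply/funext => x; rewrite (_ : dotV 0 x = 0) ?expi0 ?mul1r//.
  by rewrite -(scale0r 0) dotVZl mul0r.
move: i1; rewrite E => i1; split => //.
have := congr1 (@complex.Re R) e1; rewrite /= E => ->.
rewrite (_ : gaussV _ 0 = 1) ?mulr1// /gaussV.
by rewrite (_ : dotV 0 0 = 0) ?mulr0 ?expR0// -(scale0r 0) dotVZl mul0r.
Qed.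

End gaussV_fourier.

Section schrodinger.
Variables (R : realType) (n : nat).
Local Notation mV := (lebesgueV R n).
Local Notation L2 := (L2 R n).
Implicit Types (phi psi : L2) (z : heisenberg R n) (lambda : R).

Lemma schrodinger_lin lambda z a phi psi :
  schrodinger lambda z (a *: phi + psi) =
  a *: schrodinger lambda z phi + schrodinger lambda z psi.
Proof.
apply/funext => xi; case: z => [[x y] t] /=.
rewrite -[(a *: phi + psi) _]/(a * phi (xi + y) + psi (xi + y)).
rewrite -[RHS]/(a * (expi (lambda * t) *
  expi (lambda * (dotV x xi + dotV x y / 2)) * phi (xi + y)) + (expi (lambda * t) *
  expi (lambda * (dotV x xi + dotV x y / 2)) * psi (xi + y))).
by ring.
Qed.

Lemma schrodinger_sub lambda z phi psi :
  schrodinger lambda z (phi - psi) =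
  schrodinger lambda z phi - schrodinger lambda z psi.
Proof.
rewrite addrC -scaleN1r schrodinger_lin scaleN1r addrC.
by [].
Qed.

Lemma Cmeasurable_schrodinger_phase lambda (x y : 'cV[R]_n) t :
  Cmeasurable (fun xi : 'cV[R]_n =>
    expi (lambda * t) * expi (lambda * (dotV x xi + dotV x y / 2))).
Proof.
apply: CmeasurableM; first exact: Cmeasurable_cst.
apply: Cmeasurable_expi; apply: measurable_funM => //.
by apply: measurable_funD => //; exact: measurable_dotV.
Qed.

Lemma hmem_schrodinger lambda z phi : hmem phi ->
  hmem (schrodinger lambda z phi) /\ hsq (schrodinger lambda z phi) = hsq phi.
Proof.
case: z => [[x y] t] /hmem_L2[mphi iphi].
have sE : (fun xi => sqn (schrodinger lambda (x, y, t) phi xi)) =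
    fun xi => sqn (phi (xi + y)).
  by apply/funext => xi; rewrite /= !sqnM !sqn_expi !mul1r.
have [i1 e1] := integralV_translation y iphi.
split; last by rewrite !hsq_L2 sE; congr fine.
apply/hmem_L2; split; last by rewrite sE.
apply: CmeasurableM; first exact: Cmeasurable_schrodinger_phase.
by apply: (Cmeasurable_comp mphi); exact: measurable_addV.
Qed.

Lemma heq_schrodinger lambda z phi psi : hmem phi -> hmem psi -> heq phi psi ->
  heq (schrodinger lambda z phi) (schrodinger lambda z psi).
Proof.
have H2 := L2_inner_space R n.
move=> mphi mpsi h.
have [m1 _] := hmem_schrodinger lambda z mphi.
have [m2 _] := hmem_schrodinger lambda z mpsi.
apply/(heq_hsq H2 m1 m2); rewrite -schrodinger_sub.
by rewrite (hmem_schrodinger _ _ (hmem_sub H2 mphi mpsi)).2; exact/(heq_hsq H2).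
Qed.

End schrodinger.

Section hdot_L2.
Variables (R : realType) (n : nat).
Implicit Types phi psi : L2 R n.

Lemma hdot_L2 phi psi :
  hdot phi psi = Cintegral (lebesgueV R n) (fun x => phi x * (psi x)^*).
Proof. by []. Qed.

Lemma schrodingerE (lambda : R) x y t phi (xi : 'cV[R]_n) :
  schrodinger lambda (x, y, t) phi xi = expi (lambda * t) *
    expi (lambda * (dotV x xi + dotV x y / 2)) * phi (xi + y).
Proof. by []. Qed.

Lemma dot0V (x : 'cV[R]_n) : dotV 0 x = 0.
Proof. by rewrite -(scale0r 0) dotVZl mul0r. Qed.

End hdot_L2.

Lemma Cintegrable_unimodular d (T : measurableType d) (R : realType)
    (mu : {measure set T -> \bar R}) (e f : T -> R[i]) :
  Cmeasurable e -> (forall x, sqn (e x) = 1) -> Cintegrable mu f ->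
  Cintegrable mu (fun x => e x * f x).
Proof.
move=> me e1 fi; have [f1 f2] := fi.
apply: (le_Cintegrable _ (integrable_add (integrable_norm f1) (integrable_norm f2))).
- by apply: CmeasurableM => //; exact: Cintegrable_measurable fi.
- by move=> x; apply: addr_ge0; exact: normr_ge0.
- move=> x; rewrite sqnM e1 mul1r /sqn /=.
  rewrite -[X in X + _ <= _]real_normK ?num_real// -[X in _ + X <= _]real_normK ?num_real//.
  have := normr_ge0 (complex.Re (f x)); have := normr_ge0 (complex.Im (f x)); nra.
Qed.

(** Convolution of integrable functions: |w1 (x + y) w2 x| is integrated first
   in y, where translation invariance removes x. *)
Lemma Cintegral_shear (R : realType) n (w1 w2 : 'cV[R]_n -> R[i]) :
  let mV := lebesgueV R n in
  Cintegrable mV w1 -> Cintegrable mV w2 ->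
  Cintegrable (prod_measure mV mV) (fun z => w1 (z.2 + z.1) * w2 z.2) /\
  Cintegral mV (fun y => Cintegral mV (fun x => w1 (x + y) * w2 x)) =
    Cintegral mV w1 * Cintegral mV w2.
Proof.
move=> mV i1 i2.
have mshear : measurable_fun setT (fun z : 'cV[R]_n * 'cV[R]_n => z.2 + z.1).
  by apply: measurable_addfV; [exact: measurable_snd|exact: measurable_fst].
pose a (w : 'cV[R]_n -> R[i]) x := `|complex.Re (w x)| + `|complex.Im (w x)|.
have a_ge0 w x : 0 <= a w x by rewrite addr_ge0 ?normr_ge0.
have ia w : Cintegrable mV w -> mV.-integrable setT (EFin \o a w).
  by move=> [j1 j2]; exact: (integrable_add (integrable_norm j1) (integrable_norm j2)).
have wa w x : sqn (w x) <= a w x ^+ 2.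
  rewrite /sqn /a.
  rewrite -[X in X + _ <= _]real_normK ?num_real// -[X in _ + X <= _]real_normK ?num_real//.
  have := normr_ge0 (complex.Re (w x)); have := normr_ge0 (complex.Im (w x)); nra.
have m1 : measurable_fun setT (a w1) by apply/measurable_EFinP; exact: (measurable_int mV (ia _ i1)).
have m2 : measurable_fun setT (a w2) by apply/measurable_EFinP; exact: (measurable_int mV (ia _ i2)).
pose h (z : 'cV[R]_n * 'cV[R]_n) := a w1 (z.2 + z.1) * a w2 z.2.
have mh : measurable_fun setT (EFin \o h).
  apply/measurable_EFinP; apply: measurable_funM; first exact: (measurableT_comp m1 mshear).
  exact: (measurableT_comp m2 (@measurable_snd _ _ _ _)).
have ih : (prod_measure mV mV).-integrable setT (EFin \o h).
  apply: (@integrable21ltyP _ _ _ _ _ mV mV _ mh).2.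
  have e1 (y : 'cV[R]_n) : (\int[mV]_x `|(h (x, y))%:E| =
      (a w2 y)%:E * \int[mV]_x (a w1 x)%:E)%E.
    have -> : (\int[mV]_x `|(h (x, y))%:E| = \int[mV]_x ((a w2 y)%:E * (a w1 (x + y))%:E))%E.
      apply: eq_integral => x _; rewrite /h /= ger0_norm ?mulr_ge0//.
      by rewrite -EFinM mulrC [x + y]addrC.
    rewrite ge0_integralZl//=; first last.
    - by rewrite lee_fin.
    - by move=> x _; rewrite lee_fin.
    - by apply/measurable_EFinP; exact: (measurableT_comp m1 (@measurable_addV R n y)).
    rewrite (ge0_integralV_translation y (f := fun x => (a w1 x)%:E))//; first by apply/measurable_EFinP.
    by move=> x; rewrite lee_fin.
  rewrite (_ : integral _ _ _ = \int[mV]_y ((a w2 y)%:E * \int[mV]_x (a w1 x)%:E))%E; last first.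
    by apply: eq_integral => y _; exact: e1.
  have /integrableP[_ o1] := ia _ i1; have /integrableP[_ o2] := ia _ i2.
  have fin w : (\int[mV]_x `|(EFin \o a w) x| = \int[mV]_x (a w x)%:E)%E.
    by apply: eq_integral => x _ /=; rewrite ger0_norm.
  rewrite fin in o1; rewrite fin in o2.
  have pos w : (0 <= \int[mV]_x (a w x)%:E)%E.
    by apply: integral_ge0 => x _; rewrite lee_fin.
  rewrite ge0_integralZr//=.
  - by rewrite lte_mul_pinfty// ge0_fin_numE.
  - exact/measurable_EFinP.
  - by move=> x _; rewrite lee_fin.
have iw : Cintegrable (prod_measure mV mV) (fun z => w1 (z.2 + z.1) * w2 z.2).
  apply: (le_Cintegrable _ ih).
  - apply: CmeasurableM.
      exact: (Cmeasurable_comp (Cintegrable_measurable i1) mshear).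
    exact: (Cmeasurable_comp (Cintegrable_measurable i2) (@measurable_snd _ _ _ _)).
  - by move=> z; rewrite mulr_ge0.
  - by move=> z; rewrite sqnM exprMn ler_pM ?sqn_ge0.
split => //.
have [_ e12] := Cintegral12 iw; have [_ e21] := Cintegral21 iw.
rewrite -[LHS]e12 e21 -CintegralZ//; apply: eq_Cintegral => x /=.
have [it et] := Cintegral_translation x i1.
rewrite mulrC -et -CintegralZ//; apply: eq_Cintegral => y.
by rewrite mulrC [x + y]addrC.
Qed.

Section ground_state.
Variables (R : realType) (n : nat) (lambda : R).
Hypothesis lambda0 : lambda != 0.
Local Notation mV := (lebesgueV R n).
Local Notation L2 := (L2 R n).
Local Notation b := (`|lambda|).
Implicit Types (x y xi : 'cV[R]_n) (psi : L2).

Let b0 : 0 < b. Proof. by rewrite normr_gt0. Qed.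
Let b20 : 0 < b / 2. Proof. by rewrite divr_gt0. Qed.
Let b40 : 0 < b / 4. Proof. by rewrite divr_gt0. Qed.
Let lambda2 : lambda ^+ 2 = b ^+ 2. Proof. by rewrite real_normK ?num_real. Qed.

(** The vacuum vector of pi_lambda: the Gaussian of width |lambda|^(-1/2),
   normalized in L^2. *)
Definition gstate_norm : R := Num.sqrt (Num.sqrt (pi / b) ^+ n)^-1.

Definition gstate : L2 := fun x => (gstate_norm * gaussV (b / 2) x)%:C.

Let root_gt0 (a : R) : 0 < a -> 0 < Num.sqrt (pi / a) ^+ n.
Proof. by move=> a0; rewrite exprn_gt0// sqrtr_gt0 divr_gt0 ?pi_gt0. Qed.

Let gstate_norm2 : gstate_norm ^+ 2 = (Num.sqrt (pi / b) ^+ n)^-1.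
Proof. by rewrite sqr_sqrtr// invr_ge0 ltW// root_gt0. Qed.

(** The two Gaussian factors of a matrix coefficient are completed to a square
   around the midpoint of the two arguments. *)
Let gaussV_mid x y : gaussV (b / 2) (x + y) * gaussV (b / 2) x =
  gaussV (b / 4) y * gaussV b (x + 2^-1 *: y).
Proof.
rewrite /gaussV -!expRD; congr expR.
by rewrite !dotVDl !dotVDr !dotVZl !dotVZr (dotVC y x); field.
Qed.

Lemma gstate_unit : hmem gstate /\ hsq gstate = 1.
Proof.
have E : (fun x => sqn (gstate x)) = fun x => gstate_norm ^+ 2 * gaussV b x.
  apply/funext => x; rewrite sqn_real exprMn; congr (_ * _).
  by rewrite /gaussV expr2 -expRD; congr expR; field.
have [i1 e1] := gaussV_integrable n b0.
split.
  apply/hmem_L2; split; last by rewrite E; exact: integrable_scale.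
  apply: Cmeasurable_real; apply: measurable_funM => //; exact: measurable_gaussV.
rewrite hsq_L2 E RintegralZl// e1 gstate_norm2 mulVf// gt_eqF// root_gt0//.
Qed.

Let phase_mid x y xi : dotV (lambda *: x) (xi + 2^-1 *: y) =
  lambda * (dotV x xi + dotV x y / 2).
Proof. by rewrite dotVZl dotVDr dotVZr mulrC; ring. Qed.

Lemma schrodinger_gstate x y t :
  hdot (schrodinger lambda (x, y, t) gstate) gstate =
  expi (lambda * t) * (gaussV (b / 4) x * gaussV (b / 4) y)%:C.
Proof.
rewrite hdot_L2.
pose F (s : 'cV[R]_n) : R[i] := expi (dotV (lambda *: x) s) * (gaussV b s)%:C.
have [iF eF] := gaussV_fourier (lambda *: x) b0.
have [iT eT] := Cintegral_translation (2^-1 *: y) iF.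
pose c : R[i] := expi (lambda * t) * (gstate_norm ^+ 2 * gaussV (b / 4) y)%:C.
transitivity (Cintegral mV (fun xi => c * F (xi + 2^-1 *: y))).
  apply: eq_Cintegral => xi.
  rewrite /c /F phase_mid -mulrA schrodingerE -!mulrA; congr (_ * _).
  rewrite [RHS]mulrCA; congr (_ * _).
  rewrite /gstate conjcR -!rmorphM /=; congr (_%:C).
  transitivity (gstate_norm ^+ 2 * (gaussV (b / 2) (xi + y) * gaussV (b / 2) xi)); first by ring.
  by rewrite gaussV_mid; ring.
rewrite CintegralZ// eT eF /c -mulrA; congr (_ * _).
rewrite -rmorphM /= gstate_norm2; congr (_%:C).
have -> : gaussV (4 * b)^-1 (lambda *: x) = gaussV (b / 4) x.
  rewrite /gaussV dotVZl dotVZr (mulrA lambda) -expr2 lambda2; congr expR.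
  by field; rewrite gt_eqF.
by field; rewrite gt_eqF// root_gt0.
Qed.

Let damp psi x : R[i] := psi x * (gaussV (b / 2) x)%:C.

Let gauss_sqintegrable : sqintegrable mV (fun x => (gaussV (b / 2) x)%:C).
Proof.
split; first by apply: Cmeasurable_real; exact: measurable_gaussV.
have E : (fun x => sqn (gaussV (b / 2) x)%:C) = gaussV b.
  by apply/funext => x; rewrite sqn_real expr2 /gaussV -expRD; congr expR; field.
by rewrite E; exact: (gaussV_integrable n b0).1.
Qed.

Let damp_integrable psi : hmem psi -> Cintegrable mV (damp psi).
Proof.
move=> /hmem_L2 spsi; have := sqintegrableM spsi gauss_sqintegrable.
by congr Cintegrable; apply/funext => x; rewrite conjcR.
Qed.

Let damp_sqintegrable psi : hmem psi -> sqintegrable mV (damp psi).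
Proof.
move=> /hmem_L2[mpsi ipsi]; apply: (le_sqintegrable _ ipsi).
  by apply: CmeasurableM => //; apply: Cmeasurable_real; exact: measurable_gaussV.
move=> x; rewrite sqnM sqn_real ler_piMr ?sqn_ge0// expr_le1 ?gaussV_ge0//.
rewrite -expR0 ler_expR mulNr oppr_le0 mulr_ge0 ?dotV_ge0//; exact: ltW.
Qed.

Let damp_dot psi : hmem psi ->
  hdot psi gstate = gstate_norm%:C * Cintegral mV (damp psi).
Proof.
move=> mpsi; rewrite hdot_L2 -CintegralZ; last exact: damp_integrable.
by apply: eq_Cintegral => x; rewrite /gstate /damp conjcR rmorphM /=; ring.
Qed.

Let damp_shift_integrable psi y : hmem psi ->
  Cintegrable mV (fun xi => damp psi (xi + y) * (damp psi xi)^*).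
Proof.
move=> mpsi; have sd := damp_sqintegrable mpsi.
apply: sqintegrableM => //; case: (sd) => md id; split.
  exact: (Cmeasurable_comp md (@measurable_addV R n y)).
by have [] := integralV_translation y id.
Qed.

Let coeff_x psi y : hmem psi ->
  (gaussV (b / 4) y)%:C * Cintegral mV (fun x => (gaussV (b / 4) x)%:C *
    hdot (schrodinger lambda (x, y, 0) psi) psi) =
  (Num.sqrt (pi / (b / 4)) ^+ n)%:C * Cintegral mV (fun xi => damp psi (xi + y) * (damp psi xi)^*).
Proof.
move=> mpsi; have spsi := (hmem_L2 psi).1 mpsi.
have [mT _] := hmem_schrodinger lambda (0, y, 0) mpsi.
have sT := (hmem_L2 _).1 mT.
have iP := sqintegrableM sT spsi.
have iG : Cintegrable mV (fun x => (gaussV (b / 4) x)%:C).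
  by apply: Cintegrable_real; exact: (gaussV_integrable n b40).1.
pose G (z : 'cV[R]_n * 'cV[R]_n) : R[i] :=
  expi (lambda * (dotV z.1 z.2 + dotV z.1 y / 2)) *
  ((gaussV (b / 4) z.1)%:C * (psi (z.2 + y) * (psi z.2)^*)).
have phase0 (xi : 'cV[R]_n) : schrodinger lambda (0, y, 0) psi xi = psi (xi + y).
  by rewrite schrodingerE !dot0V mul0r addr0 !mulr0 expi0 !mul1r.
have iG2 : Cintegrable (prod_measure mV mV) G.
  have i0 := Cintegrable_prod iG iP.
  have m1 := Cintegrable_measurable i0.
  have mphase : Cmeasurable (fun z : 'cV[R]_n * 'cV[R]_n =>
      expi (lambda * (dotV z.1 z.2 + dotV z.1 y / 2))).
    apply: Cmeasurable_expi; apply: measurable_funM => //; apply: measurable_funD.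
      by apply: measurable_dotV; [exact: measurable_fst|exact: measurable_snd].
    by apply: measurable_funM => //; apply: measurable_dotV; [exact: measurable_fst|].
  have E : G = fun z => expi (lambda * (dotV z.1 z.2 + dotV z.1 y / 2)) *
      ((gaussV (b / 4) z.1)%:C * (schrodinger lambda (0, y, 0) psi z.2 * (psi z.2)^*)).
    by apply/funext => z; rewrite phase0.
  by rewrite E; apply: (Cintegrable_unimodular mphase _ i0) => z; exact: sqn_expi.
have [_ e12] := Cintegral12 iG2; have [_ e21] := Cintegral21 iG2.
transitivity ((gaussV (b / 4) y)%:C * Cintegral (prod_measure mV mV) G).
  rewrite e12; congr (_ * _); apply: eq_Cintegral => x.
  rewrite hdot_L2 -CintegralZ; last first.
    have [mx _] := hmem_schrodinger lambda (x, y, 0) mpsi.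
    exact: sqintegrableM ((hmem_L2 _).1 mx) spsi.
  apply: eq_Cintegral => xi; rewrite /G schrodingerE /= mulr0 expi0 mul1r; ring.
rewrite e21 -!CintegralZ; last first.
- by have [] := Cintegral21 iG2.
- exact: damp_shift_integrable.
apply: eq_Cintegral => xi.
have [i1 e1] := gaussV_fourier (lambda *: (xi + 2^-1 *: y)) b40.
transitivity ((gaussV (b / 4) y)%:C * (Cintegral mV (fun x => psi (xi + y) * (psi xi)^* *
    (expi (dotV (lambda *: (xi + 2^-1 *: y)) x) * (gaussV (b / 4) x)%:C)))).
  congr (_ * _); apply: eq_Cintegral => x; rewrite /G /=.
  have -> : dotV (lambda *: (xi + 2^-1 *: y)) x = lambda * (dotV x xi + dotV x y / 2).
    by rewrite dotVZl dotVC dotVDr dotVZr; ring.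
  by ring.
rewrite CintegralZ// e1.
have -> : gaussV (4 * (b / 4))^-1 (lambda *: (xi + 2^-1 *: y)) = gaussV b (xi + 2^-1 *: y).
  rewrite /gaussV dotVZl dotVZr (mulrA lambda) -expr2 lambda2; congr expR.
  by field; rewrite gt_eqF.
rewrite /damp conjcM conjcR rmorphM /=.
transitivity ((Num.sqrt (pi / (b / 4)) ^+ n)%:C *
   (gaussV (b / 4) y * gaussV b (xi + 2^-1 *: y))%:C * (psi (xi + y) * (psi xi)^*)).
  by rewrite rmorphM /=; ring.
by rewrite -gaussV_mid rmorphM /=; ring.
Qed.

Let C : R := Num.sqrt (pi / (b / 4)) ^+ n / gstate_norm ^+ 2.

Let C_gt0 : 0 < C.
Proof. by rewrite divr_gt0 ?root_gt0// gstate_norm2 invr_gt0 root_gt0. Qed.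

(** Integrating the matrix coefficients of pi against those of the ground state
   yields, up to a constant, the orthogonal projection onto the ground state:
   the x-integral is a Gaussian Fourier transform, and what remains is the
   kernel of the projection. *)
Lemma schrodinger_projection psi : hmem psi ->
  Cintegral mV (fun y => (gaussV (b / 4) y)%:C * Cintegral mV (fun x =>
    (gaussV (b / 4) x)%:C * hdot (schrodinger lambda (x, y, 0) psi) psi)) =
  (C * sqn (hdot psi gstate))%:C.
Proof.
move=> mpsi; under eq_Cintegral do rewrite coeff_x//.
have iw := damp_integrable mpsi.
have [iwJ eJ] := Cintegral_shear iw (CintegrableJ iw).
have [i12 _] := Cintegral12 iwJ.
rewrite CintegralZ// eJ CintegralJ// mulcJ damp_dot// sqnM sqn_real -rmorphM /=.
congr (_%:C); rewrite /C; field.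
by rewrite -sqrf_eq0 gstate_norm2 invr_eq0 gt_eqF// root_gt0.
Qed.

(** A unit vector is determined up to a phase by the diagonal matrix
   coefficients it has: here psi has those of the ground state, so its
   projection to the ground state is as long as that of the ground state. *)
Lemma schrodinger_coeff_gstate psi : hmem psi ->
  (forall x y, hdot (schrodinger lambda (x, y, 0) psi) psi =
    hdot (schrodinger lambda (x, y, 0) gstate) gstate) ->
  sqn (hdot psi gstate) = 1.
Proof.
move=> mpsi E; have [mg g1] := gstate_unit.
have := schrodinger_projection mpsi.
under eq_Cintegral do under eq_Cintegral do rewrite E.
rewrite (schrodinger_projection mg) => /complexI /(mulfI (lt0r_neq0 C_gt0)) <-.
by rewrite (hdot_hsq (L2_inner_space R n) mg) g1 sqn_real expr1n.
Qed.

End ground_state.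

(** * The ground state spans a one-dimensional representation of U(n) *)

Section unitary_sums.
Variable R : realType.

Lemma conjc_sum I (r : seq I) (P : pred I) (F : I -> R[i]) :
  (\sum_(i <- r | P i) F i)^* = \sum_(i <- r | P i) (F i)^*.
Proof. by apply: big_morph; [exact: conjcD|exact: conjcR]. Qed.

Lemma unitary_cols m p (M : 'M[R[i]]_(m, p)) :
  (M ^t*)%sesqui \is unitarymx ->
  forall j l, \sum_i M i j * (M i l)^* = (j == l)%:R.
Proof.
move=> /unitarymxP/matrixP h j l; have := h l j; rewrite !mxE eq_sym => <-.
apply: eq_bigr => i _; rewrite !mxE mulrC; congr (_ * _).
by rewrite -[RHS]/((M i j)^*^*) conjc_conjc.
Qed.

Lemma unitary_dot m p (M : 'M[R[i]]_(m, p)) (v : 'cV[R[i]]_p) :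
  (M ^t*)%sesqui \is unitarymx ->
  \sum_i sqn ((M *m v) i ord0) = \sum_j sqn (v j ord0).
Proof.
move=> hM; apply: complexI; rewrite !rmorph_sum /=.
transitivity (\sum_i \sum_j \sum_l (v j ord0 * (v l ord0)^*) * (M i j * (M i l)^*)).
  apply: eq_bigr => i _; rewrite -mulcJ !mxE conjc_sum mulr_suml.
  apply: eq_bigr => j _; rewrite mulr_sumr; apply: eq_bigr => l _.
  by rewrite conjcM; ring.
rewrite exchange_big /=; apply: eq_bigr => j _.
rewrite exchange_big /= (bigD1 j)//= [X in _ + X]big1 => [|l lj].
  by rewrite addr0 -mulr_sumr (unitary_cols hM) eqxx mulr1 mulcJ.
by rewrite -mulr_sumr (unitary_cols hM) eq_sym (negbTE lj) mulr0.
Qed.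

End unitary_sums.

Lemma continuous_dist (R : realType) (T : topologicalType) (f : T -> R) :
  (forall t e, 0 < e -> \forall s \near t, `|f t - f s| <= e) -> continuous f.
Proof. by move=> h t; apply/cvgrPdist_le => e; exact: h. Qed.

Lemma continuous_opp (R : realType) (T : topologicalType) (f : T -> R) :
  continuous f -> continuous (fun t => - f t).
Proof. by move=> cf t; apply: cvgN; exact: cf. Qed.

Section unitary_operators.
Variables (R : realType) (H : hspace R) (HH : inner_space H).
Variables (T : H -> H) (uT : unitary_op T).

Ltac hm := hmem_tac HH.

Lemma unitary_op_mem u : hmem u -> hmem (T u).
Proof. by case: uT => -[mT _ _] _ _; exact: mT. Qed.

Lemma unitary_op_hsq u : hmem u -> hsq (T u) = hsq u.
Proof. by move=> mu; case: uT => _ iT _; rewrite /hsq iT. Qed.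

Lemma unitary_op_sub u v : hmem u -> hmem v -> hsq (T u - T v) = hsq (u - v).
Proof.
move=> mu mv; have mTu := unitary_op_mem mu; have mTv := unitary_op_mem mv.
rewrite !(hsqB HH)// !unitary_op_hsq//.
by case: uT => _ iT _; rewrite iT.
Qed.

Lemma unitary_op_heq u v : hmem u -> hmem v -> heq u v <-> heq (T u) (T v).
Proof.
move=> mu mv; have mTu := unitary_op_mem mu; have mTv := unitary_op_mem mv.
by split=> /(heq_hsq HH) h; apply/(heq_hsq HH) => //;
  [rewrite unitary_op_sub// h|rewrite -unitary_op_sub// h].
Qed.

(** Surjectivity yields preimages of all vectors; their choice is the adjoint. *)
Lemma unitary_op_adjoint : exists2 S, is_adjoint T S &
  forall v, hmem v -> heq (T (S v)) v.
Proof.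
case: (uT) => -[mT lT _] iT sT.
have /choice[S hS] : forall v : H, exists s : H, hmem v -> hmem s /\ heq (T s) v.
  move=> v; have [mv|nmv] := pselect (hmem v); last by exists 0.
  by have [s ms hs] := sT v mv; exists s.
have mS v : hmem v -> hmem (S v) by move=> /hS[].
have TS v : hmem v -> heq (T (S v)) v by move=> /hS[].
exists S => //; split; last first.
  move=> u v mu mv; rewrite -(iT _ _ mu (mS _ mv)).
  exact/esym/(heq_dotr HH (mT _ (mS _ mv)) mv (mT _ mu))/TS.
split=> //.
- move=> a u v mu mv; have mSu := mS _ mu; have mSv := mS _ mv.
  have m1 : hmem (a *: u + v) by hm.
  have mTu := mT _ mSu; have mTv := mT _ mSv.
  apply/unitary_op_heq; [exact: mS|by hm|].
  apply: (heq_trans HH (mT _ (mS _ m1)) m1 _ (TS _ m1)); first by apply: mT; hm.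
  apply: (heq_sym HH); hm; first by apply: mT; hm.
  apply: (heq_trans HH _ _ _ (lT a _ _ mSu mSv)); hm; first by apply: mT; hm.
  by apply: (heqD HH); hm; [apply: (heqZ HH) => //; exact: TS|exact: TS].
- exists 1 => v mv; rewrite mul1r !hnorm_sqrt -unitary_op_hsq; last exact: mS.
  have mTv := mT _ (mS _ mv).
  rewrite /hsq (heq_dotl HH mTv mv mTv (TS _ mv)) (heq_dotr HH mTv mv mv (TS _ mv)).
  by [].
Qed.

End unitary_operators.

Section character.
Variables (R : realType) (n : nat) (lambda : R).
Hypothesis lambda0 : lambda != 0.
Variable m : unitary_group R n -> L2 R n -> L2 R n.
Hypothesis m_metaplectic : is_metaplectic lambda m.
Local Notation g := (@gstate R n lambda).
Local Notation H2 := (L2_inner_space R n).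

Let mg : hmem g. Proof. exact: (gstate_unit n lambda0).1. Qed.
Let g1 : hsq g = 1. Proof. exact: (gstate_unit n lambda0).2. Qed.
Let um k : unitary_op (m k). Proof. by case: m_metaplectic. Qed.
Let mm k phi : hmem phi -> hmem (m k phi).
Proof. by move=> mphi; apply: unitary_op_mem. Qed.

Lemma unitary_act_dotV (k : unitary_group R n) z :
  let z' := unitary_act k z in
  dotV z'.1.1 z'.1.1 + dotV z'.1.2 z'.1.2 = dotV z.1.1 z.1.1 + dotV z.1.2 z.1.2.
Proof.
have E (v : 'cV[R[i]]_n) : dotV (map_mx (@complex.Re R) v) (map_mx (@complex.Re R) v) +
    dotV (map_mx (@complex.Im R) v) (map_mx (@complex.Im R) v) = \sum_j sqn (v j ord0).
  by rewrite -big_split; apply: eq_bigr => j _; rewrite !mxE /sqn !expr2.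
rewrite /= E unitary_dot; last by rewrite trmxC_unitary; exact: valP.
by rewrite -big_split; apply: eq_bigr => j _; rewrite !mxE /sqn /= !expr2.
Qed.

(** The diagonal matrix coefficient of the ground state depends on the length of
   z only, which U(n) preserves. *)
Lemma schrodinger_gstate_act (k : unitary_group R n) x y :
  hdot (schrodinger lambda (unitary_act k (x, y, 0)) g) g =
  hdot (schrodinger lambda (x, y, 0) g) g.
Proof.
have radial (z w : heisenberg R n) : z.2 = w.2 ->
    dotV z.1.1 z.1.1 + dotV z.1.2 z.1.2 = dotV w.1.1 w.1.1 + dotV w.1.2 w.1.2 ->
    hdot (schrodinger lambda z g) g = hdot (schrodinger lambda w g) g.
  case: z => [[x1 y1] t1]; case: w => [[x2 y2] t2] /= <- h.
  have := schrodinger_gstate lambda0 x1 y1 t1; rewrite /= => ->.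
  have := schrodinger_gstate lambda0 x2 y2 t1; rewrite /= => ->.
  by congr (_ * _%:C); rewrite /gaussV -!expRD -!mulrDr h.
by apply: radial; [|exact: unitary_act_dotV].
Qed.

(** The scalar by which mu(k) acts on the ground state. *)
Definition ground_char k : R[i] := hdot (m k g) g.

(** The vector mu(k)^* g has the same diagonal matrix coefficients as g, by the
   intertwining property of mu; hence it is g up to a phase. *)
Lemma sqn_ground_char k : sqn (ground_char k) = 1.
Proof.
have [S aS TS] := unitary_op_adjoint H2 (um k).
have [[mS _ _] dS] := aS; have mSg := mS _ mg.
have coef x y : hdot (schrodinger lambda (x, y, 0) (S g)) (S g) =
    hdot (schrodinger lambda (x, y, 0) g) g.
  rewrite -(schrodinger_gstate_act k).
  have [_ _ _ tw] := m_metaplectic.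
  have [m1 _] := hmem_schrodinger lambda (unitary_act k (x, y, 0)) mg.
  have [m2 _] := hmem_schrodinger lambda (x, y, 0) mSg.
  have [_ iT _] := um k.
  rewrite (heq_dotl H2 m1 (mm k m2) mg (tw k S (x, y, 0) g aS mg)).
  rewrite -(heq_dotr H2 (mm k mSg) mg (mm k m2) (TS _ mg)).
  by rewrite iT.
have := schrodinger_coeff_gstate lambda0 mSg coef.
by rewrite (inner_conj H2 mg mSg) sqnJ -dS.
Qed.

Lemma ground_charE k : heq (m k g) (ground_char k *: g).
Proof.
have mcg := hmem_scale H2 (ground_char k) mg.
apply/(heq_hsq H2 (mm k mg) mcg).
rewrite (hsqB H2 (mm k mg) mcg) (hsqZ H2)// (unitary_op_hsq (um k))// g1.
rewrite (hdotZr H2 _ mg (mm k mg)) -/(ground_char k) [_^* * _]mulrC mulcJ /= sqn_ground_char.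
by ring.
Qed.

Lemma ground_charM k l : ground_char (k * l)%g = ground_char k * ground_char l.
Proof.
have [_ mul _ _] := m_metaplectic; have mcg := hmem_scale H2 (ground_char l) mg.
rewrite /ground_char (heq_dotl H2 (mm _ mg) (mm k (mm l mg)) mg (mul k l g mg)).
rewrite (heq_dotl H2 (mm k (mm l mg)) (mm k mcg) mg); last first.
  exact: (unitary_op_heq H2 (um k) (mm l mg) mcg).1 (ground_charE l).
have [bT _ _] := um k.
rewrite (heq_dotl H2 (mm k mcg) (hmem_scale H2 _ (mm k mg)) mg (bounded_opZ H2 _ bT mg)).
by rewrite (hdotZl H2)// 1?mulrC//; exact: mm.
Qed.

Lemma ground_char_continuous :
  continuous (fun k => complex.Re (ground_char k)) /\
  continuous (fun k => complex.Im (ground_char k)).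
Proof.
have [_ _ cm _] := m_metaplectic.
have bound k k0 : sqn (ground_char k - ground_char k0) <= hsq (m k g - m k0 g).
  rewrite /ground_char -(hdotBl H2 (mm _ mg) (mm _ mg) mg).
  rewrite (le_trans (cauchy_schwarz H2 (hmem_sub H2 (mm k mg) (mm k0 mg)) mg))//.
  by rewrite g1 mulr1.
have near_ k0 e : 0 < e -> \forall k \near k0, sqn (ground_char k - ground_char k0) <= e ^+ 2.
  move=> e0; apply: (@filterS _ (nbhs k0) (@nbhs_pfilter _ k0) _ _ _ (cm g mg k0 e e0)) => k hk.
  apply: le_trans (bound _ _) _.
  have md := hmem_sub H2 (mm k mg) (mm k0 mg).
  by rewrite -(sqr_hnorm H2 md) ler_sqr ?nnegrE ?hnorm_ge0// ltW.
split; apply: continuous_dist => k0 e e0; apply: (@filterS _ (nbhs k0) (@nbhs_pfilter _ k0) _ _ _ (near_ k0 e e0)) => k hk.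
  rewrite distrC -ler_sqr ?nnegrE// ?(ltW e0)// real_normK ?num_real//.
  by rewrite -ReN -ReD (le_trans (sqr_Re_le _)).
rewrite distrC -ler_sqr ?nnegrE// ?(ltW e0)// real_normK ?num_real//.
by rewrite -ImN -ImD; apply: le_trans hk; rewrite lerDr sqr_ge0.
Qed.

(** The conjugate of the character, so that it cancels the character in the
   tensor product. *)
Definition ground_rep : matrix_rep R n :=
  @MatrixRep R n 1 (fun k => ((ground_char k)^*)%:M).

Lemma ground_rep_unitary : is_unitary_rep ground_rep.
Proof.
split.
- move=> k; apply/unitarymxP; apply/matrixP => i j; rewrite !mxE big_ord1 !mxE !ord1 !eqxx !mulr1n.
  rewrite -[X in _ * X]/((ground_char k)^*^*) conjc_conjc mulrC mulcJ sqn_ground_char.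
  by [].
- by move=> k l; rewrite /= ground_charM conjcM scalar_mxM.
- move=> i j; have [c1 c2] := ground_char_continuous; split.
    rewrite (_ : (fun _ => _) = fun k => complex.Re (ground_char k))//.
    by apply/funext => k; rewrite /= mxE !ord1 eqxx mulr1n ReJ.
  rewrite (_ : (fun _ => _) = fun k => - complex.Im (ground_char k)); last first.
    by apply/funext => k; rewrite /= mxE !ord1 eqxx mulr1n ImJ.
  exact: continuous_opp c2.
Qed.

Lemma ground_rep_irreducible : is_irreducible ground_rep.
Proof.
split=> // W _ /=; have := rank_leq_row W; rewrite /=.
by case: (\rank W) => [|[|//]] _; [left|right].
Qed.

(** The dual contains a representation in which some unit vector transforms by
   the inverse of the character of the ground state; tensoring with the ground
   state gives a vector fixed by mu (x) sigma. *)
Lemma dual_ground_vector (Khat : set (matrix_rep R n)) : is_unitary_dual Khat ->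
  exists sigma, Khat sigma /\ exists Q : 'cV[R[i]]_(rep_dim sigma),
    \sum_j sqn (Q j ord0) = 1 /\
    forall k, sigma k *m Q = (ground_char k)^* *: Q.
Proof.
move=> [_ dual]; have [sigma [[Ks [Q [_ uQ eQ]]] _]] :=
  dual _ ground_rep_unitary ground_rep_irreducible.
exists sigma; split=> //; exists Q; split.
  apply: complexI; rewrite rmorph_sum.
  apply: eq_trans (eq_trans (unitary_cols uQ ord0 ord0) _); last by rewrite eqxx.
  by apply: eq_bigr => j _; rewrite mulcJ.
by move=> k; rewrite -eQ /= mul_mx_scalar.
Qed.

End character.

(** * Compactness of U(n) and of the support *)

Section matrix_compact.
Variable R : realType.

Lemma continuous_mx (T : topologicalType) m p (f : T -> 'M[R]_(m, p)) :
  (forall i j, continuous (fun t => f t i j)) -> continuous f.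
Proof.
move=> cf t A [P hP sPA]; apply: filterS sPA _.
rewrite /= !near_simpl.
have : \forall s \near t, forall i, forall j, P i j (f s i j).
  by apply: filter_forall => i; apply: filter_forall => j; exact: cf (hP i j).
exact: filterS.
Qed.

Lemma continuous_entry m p (i : 'I_m) (j : 'I_p) :
  continuous (fun M : 'M[R]_(m, p) => M i j).
Proof.
move=> M A nA; exists (fun k l => if (k == i) && (l == j) then A else setT).
  by move=> k l; case: ifPn => [/andP[/eqP -> /eqP ->]//|_]; exact: filterT.
by move=> N /(_ i j); rewrite !eqxx.
Qed.

Definition mx_box m p : set 'M[R]_(m, p) := [set M | forall i j, `|M i j| <= 1].

Lemma mx_box_compact m p : compact (@mx_box m p).
Proof.
have -> : @mx_box m p = vec_mx @` [set v : 'rV[R]_(m * p) | forall k, `[(-1 : R), 1]%classic (v ord0 k)].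
  apply/seteqP; split=> [M hM|_ [v hv <-] i j].
    exists (mxvec M); last exact: mxvecK.
    move=> k; case: (mxvec_indexP k) => i j; rewrite mxvecE.
    by rewrite /= in_itv/= -ler_norml; exact: hM.
  by have := hv (mxvec_index i j); rewrite /= in_itv/= -ler_norml mxE.
apply: continuous_compact; last by apply: (@rV_compact R _ (fun=> `[(-1 : R), 1]%classic)) => k; apply: segment_compact.
apply: continuous_subspaceT; apply: continuous_mx => i j.
rewrite (_ : (fun _ => _) = fun v : 'rV[R]_(m * p) => v ord0 (mxvec_index i j)).
  exact: continuous_entry.
by apply/funext => v; rewrite mxE.
Qed.

End matrix_compact.

Section unitary_compact.
Variables (R : realType) (n : nat).
Local Notation U := (unitary_group R n).
Local Notation M2 := ('M[R]_n * 'M[R]_n)%type.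

Let gram_re (i j : 'I_n) (N : M2) : R :=
  \sum_l (N.1 i l * N.1 j l + N.2 i l * N.2 j l).
Let gram_im (i j : 'I_n) (N : M2) : R :=
  \sum_l (N.2 i l * N.1 j l - N.1 i l * N.2 j l).

Let complex_mx (N : M2) : 'M[R[i]]_n := \matrix_(i, j) (N.1 i j +i* N.2 i j).

Let complex_mx_unitary (N : M2) : complex_mx N \is unitarymx <->
  forall i j, gram_re i j N = (i == j)%:R /\ gram_im i j N = 0.
Proof.
have E i j : (complex_mx N *m (complex_mx N ^t*)%sesqui) i j =
    gram_re i j N +i* gram_im i j N.
  rewrite !mxE /gram_re /gram_im.
  apply: complex_eq; rewrite ?Re_sum ?Im_sum; apply: eq_bigr => l _; rewrite !mxE;
    rewrite -[X in _ * X]/((N.1 j l +i* N.2 j l)^*) /=; ring.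
split=> [/unitarymxP/matrixP h i j|h].
  by have := h i j; rewrite E mxE; case: (i == j) => -[-> ->].
apply/unitarymxP/matrixP => i j; rewrite E mxE; have [-> ->] := h i j.
by case: (i == j).
Qed.

Let range_unitary : range (@unitary_ReIm R n) =
  [set N : M2 | forall i j, gram_re i j N = (i == j)%:R /\ gram_im i j N = 0].
Proof.
apply/seteqP; split=> [_ [k _ <-]|N /complex_mx_unitary uN].
  apply/complex_mx_unitary; rewrite (_ : complex_mx _ = val k); first exact: valP.
  by apply/matrixP => i j; rewrite !mxE; case: (val k i j).
exists (Sub (complex_mx N) uN) => //.
rewrite /unitary_ReIm /=; case: N uN => A B uN.
by congr pair; apply/matrixP => i j; rewrite !mxE.
Qed.

Let continuous_fst_entry (i j : 'I_n) : continuous (fun N : M2 => N.1 i j).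
Proof.
move=> N; apply: (@continuous_comp _ _ _ fst (fun M : 'M[R]_n => M i j)).
  exact: cvg_fst.
exact: continuous_entry.
Qed.

Let continuous_snd_entry (i j : 'I_n) : continuous (fun N : M2 => N.2 i j).
Proof.
move=> N; apply: (@continuous_comp _ _ _ snd (fun M : 'M[R]_n => M i j)).
  exact: cvg_snd.
exact: continuous_entry.
Qed.

Let continuous_sum (F : 'I_n -> M2 -> R) : (forall l, continuous (F l)) ->
  continuous (fun N => \sum_l F l N).
Proof.
move=> cF; have H (r : seq 'I_n) : continuous (fun N => \sum_(l <- r) F l N).
  elim: r => [|l r IH] N.
    rewrite (_ : (fun _ => _) = fun=> 0); first exact: cvg_cst.
    by apply/funext => M; rewrite big_nil.
  rewrite (_ : (fun _ => _) = fun M => F l M + \sum_(j <- r) F j M).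
    by apply: cvgD; [exact: cF | exact: IH].
  by apply/funext => M; rewrite big_cons.
exact: H.
Qed.

Let range_closed : closed (range (@unitary_ReIm R n)).
Proof.
rewrite range_unitary.
have closed_eqc (F : M2 -> R) c : continuous F -> closed [set N | F N = c].
  by move=> cF; apply: (closed_comp (f := F) (D := [set c])) => //; move=> x _; exact: cF.
rewrite (_ : [set N | _] = \bigcap_(ij in [set: 'I_n * 'I_n])
    ([set N | gram_re ij.1 ij.2 N = (ij.1 == ij.2)%:R] `&`
     [set N | gram_im ij.1 ij.2 N = 0])); last first.
  apply/seteqP; split=> [N h [i j] _|N h i j]; first by have [] := h i j.
  by have [] := h (i, j) I.
apply: closed_bigI => -[i j] _; apply: closedI; apply: closed_eqc; apply: continuous_sum => l N.
  by apply: cvgD; apply: cvgM; (exact: continuous_fst_entry || exact: continuous_snd_entry).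
by apply: cvgB; apply: cvgM; (exact: continuous_fst_entry || exact: continuous_snd_entry).
Qed.

Let range_compact : compact (range (@unitary_ReIm R n)).
Proof.
have box : compact (@mx_box R n n `*` @mx_box R n n).
  by apply: compact_setX; exact: mx_box_compact.
apply: (subclosed_compact range_closed box); rewrite range_unitary => N h.
have le1 i l : N.1 i l ^+ 2 + N.2 i l ^+ 2 <= 1.
  have [h1 _] := h i i; rewrite eqxx in h1; rewrite -[leRHS]h1 /gram_re (bigD1 l)//=.
  rewrite -!expr2 lerDl; apply: sumr_ge0 => j _.
  by rewrite -!expr2 addr_ge0 ?sqr_ge0.
split=> i l /=; rewrite -ler_sqr ?nnegrE// expr1n real_normK ?num_real//;
  apply: le_trans (le1 i l).
  by rewrite lerDl sqr_ge0.
by rewrite lerDr sqr_ge0.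
Qed.

(** The topology is induced from the space of pairs of real matrices, where U(n)
   is closed, being cut out by polynomial equations, and bounded. *)
Lemma unitary_compact : compact [set: U].
Proof.
move=> F PF FT.
have [_ [[k _ <-] clk]] : range (@unitary_ReIm R n) `&` cluster ((@unitary_ReIm R n) @ F) !=set0.
  apply: range_compact; have sub : setT `<=` (@unitary_ReIm R n) @^-1` range (@unitary_ReIm R n).
    by move=> l _; exists l.
  exact: filterS sub FT.
exists k; split => // A B FA [V [[W oW <-] Vk VB]].
have sub : A `<=` (@unitary_ReIm R n) @^-1` ((@unitary_ReIm R n) @` A).
  by move=> l Al; exists l.
have [_ [[l Al <-] Wl]] := clk _ _ (filterS sub FA) (open_nbhs_nbhs (conj oW Vk)).
by exists l; split => //; apply: VB.
Qed.

End unitary_compact.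

(** * The test function *)

Section cutpow.
Variable R : realType.
Local Notation leb := (@lebesgue_measure R).
Implicit Types (s t : R).

Definition cutpow s t : R := `|t| `^ s * \1_[set u : R | `|u| <= 1] t.

Lemma cutpow_ge0 s t : 0 <= cutpow s t.
Proof. by rewrite mulr_ge0 ?powR_ge0 ?indicE. Qed.

Lemma cutpow_in s t : `|t| <= 1 -> cutpow s t = `|t| `^ s.
Proof. by move=> t1; rewrite /cutpow indicE mem_set ?mulr1. Qed.

Lemma cutpow_out s t : ~ `|t| <= 1 -> cutpow s t = 0.
Proof. by move=> t1; rewrite /cutpow indicE memNset ?mulr0. Qed.

Lemma sqr_cutpow s t : cutpow s t ^+ 2 = cutpow (2 * s) t.
Proof.
have [t1|t1] := pselect (`|t| <= 1).
  by rewrite !cutpow_in// [2 * s]mulrC powRrM powR_mulrn// powR_ge0.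
by rewrite !cutpow_out// expr0n.
Qed.

Let ball_itv (e : R) : [set u : R | `|u| <= e] = `[- e, e]%classic.
Proof. by apply/seteqP; split=> u /=; rewrite in_itv/= ler_norml. Qed.

Lemma measurable_cutpow s : measurable_fun setT (cutpow s).
Proof.
apply: measurable_funM.
  apply: (measurableT_comp (measurable_powR s)).
  exact: normr_measurable.
by apply: measurable_indic; rewrite ball_itv; exact: measurable_itv.
Qed.

Let dyadic t : 0 < `|t| <= 1 ->
  exists k, (2 ^- k.+1 < `|t|) && (`|t| <= 2 ^- k).
Proof.
move=> /andP[t0 t1].
have ex : exists k, (2 : R) ^- k.+1 < `|t|.
  exists (Num.bound `|t|^-1); rewrite -[ltRHS]invrK ltf_pV2 ?posrE ?invr_gt0 ?exprn_gt0//.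
  apply: lt_le_trans (archi_boundP _) _; first by rewrite invr_ge0.
  by rewrite -natrX ler_nat (leq_trans (ltnW (ltn_expl _ (ltnSn 1))))// leq_pexp2l.
exists (ex_minn ex); case: ex_minnP => k kt min; rewrite kt /=.
case: k kt min => [|k] kt min; first by rewrite expr0 invr1.
by rewrite leNgt; apply/negP => /min; rewrite ltnn.
Qed.

(** On the shell 2^-(k+1) < |t| <= 2^-k the power is at most 2^(r(k+1)), which
   is summable against the length 2^(1-k) of the shell as soon as r < 1. *)
Lemma cutpow_integrable s : -1 < s -> leb.-integrable setT (EFin \o cutpow s).
Proof.
move=> s1; pose r := Num.max 0 (- s).
have r0 : 0 <= r by rewrite le_max lexx.
have rs : - r <= s by rewrite lerNl le_max lexx orbT.
have r1 : r < 1 by rewrite gt_max ltr01 ltrNl.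
pose c := (2 : R) `^ r.
have c1 : 1 <= c by rewrite -[leLHS](powRr0 2) ler_powR// ler1n.
have c2 : c < 2.
  rewrite -[ltRHS]powRr1// /c /powR pnatr_eq0/= ltr_expR mul1r gtr_pMl//.
  by rewrite ln_gt0 ?ltr1n.
have c0 : 0 <= c by rewrite powR_ge0.
pose F k t : \bar R := (c ^+ k.+1 * \1_[set u : R | `|u| <= 2 ^- k] t)%:E.
have F0 k t : (0 <= F k t)%E by rewrite lee_fin mulr_ge0 ?exprn_ge0 ?indicE.
have mF k : measurable_fun setT (F k).
  apply/measurable_EFinP; apply: measurable_funM => //.
  by apply: measurable_indic; rewrite ball_itv; exact: measurable_itv.
have FE k : (\int[leb]_t F k t = (2 * c * (c / 2) ^+ k)%:E)%E.
  under eq_integral do rewrite /F EFinM.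
  rewrite ge0_integralZl_EFin ?exprn_ge0//; last first.
    apply/measurable_EFinP.
    by apply: measurable_indic; rewrite ball_itv; exact: measurable_itv.
  rewrite integral_indic//; last by rewrite ball_itv; exact: measurable_itv.
  rewrite setIT ball_itv.
  have lebE : leb `[- 2 ^- k, 2 ^- k]%classic = (2 * 2 ^- k)%:E.
    apply: etrans (lebesgue_measure_itv _) _; rewrite /= lte_fin gtrN ?invr_gt0 ?exprn_gt0//.
    by rewrite -EFinD; congr EFin; ring.
  apply: etrans (congr1 (fun z => _ * z)%E lebE) _; rewrite -EFinM exprS expr_div_n; congr EFin.
  by field; rewrite expf_neq0.
have bound t : ((cutpow s t)%:E <= \sum_(0 <= k <oo) F k t)%E.
  suff [k hk] : exists k, ((cutpow s t)%:E <= F k t)%E.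
    apply: le_trans hk _; rewrite (nneseriesD1 (n := k) (f := F ^~ t) (P := xpredT))//= leeDl//.
    by apply: nneseries_ge0.
  have [t1|t1] := pselect (`|t| <= 1); last by exists 0%N; rewrite cutpow_out.
  rewrite cutpow_in//; have [->|t0] := eqVneq t 0.
    exists 0%N; rewrite lee_fin indicE mem_set ?mulr1 /= ?normr0 ?invr_ge0//.
    by rewrite expr1; case: (eqVneq s 0) => [->|s0]; rewrite ?powRr0 ?powR0.
  have [|k /andP[k1 k2]] := dyadic (t := t); first by rewrite normr_gt0 t0.
  exists k; rewrite lee_fin indicE mem_set//= mulr1.
  have tp : 0 < `|t| by rewrite normr_gt0.
  apply: (@le_trans _ _ (`|t| `^ (- r))).
    by rewrite ger_powR// tp.
  have cE : (c ^+ k.+1)^-1 = (2 ^- k.+1) `^ r.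
    rewrite -(powR_invn _ (ler0n R 2)) -powRrM -powR_mulrn// /c -powRrM -powRN.
    by congr (_ `^ _); rewrite mulNr mulrC.
  rewrite powRN -[leRHS]invrK lef_pV2 ?posrE ?powR_gt0 ?invr_gt0 ?exprn_gt0 ?powR_gt0//.
  by rewrite cE ge0_ler_powR ?nnegrE ?invr_ge0// ?exprn_ge0// ltW.
apply/integrableP; split; first by apply/measurable_EFinP; exact: measurable_cutpow.
under eq_integral do rewrite /= ger0_norm ?cutpow_ge0//.
apply: (@le_lt_trans _ _ (\int[leb]_t (\sum_(0 <= k <oo) F k t)%E)%E).
  apply: ge0_le_integral => //.
  - by move=> t _; rewrite lee_fin cutpow_ge0.
  - by apply/measurable_EFinP; exact: measurable_cutpow.
  - by apply: ge0_emeasurable_sum => k; [move=> t _ _; exact: F0 | move=> _; exact: mF].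
rewrite integral_nneseries//.
apply: (@le_lt_trans _ _ (2 * c / (1 - c / 2))%:E); last exact: ltry.
have c12 : 0 < 1 - c / 2 by rewrite subr_gt0 ltr_pdivrMr// mul1r.
apply: lime_le; first by apply: is_cvg_nneseries => k _ _; apply: integral_ge0.
apply: nearW => N; under eq_bigr do rewrite FE.
rewrite sumEFin lee_fin -mulr_sumr ler_wpM2l ?mulr_ge0//.
rewrite -[leRHS]mul1r ler_pdivlMr// mulrC big_mkord -[leLHS]opprK -mulNr opprB -subrX1 opprB.
by rewrite gerBl exprn_ge0// divr_ge0.
Qed.

End cutpow.

Section test_function.
Variables (R : realType) (n : nat).
Local Notation V := 'cV[R]_n.
Local Notation leb := (@lebesgue_measure R).
Local Notation mV := (lebesgueV R n).
Implicit Types s : R.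

Definition cutpowV s (x : V) : R := \prod_j cutpow s (x j ord0).

Lemma cutpowV_ge0 s x : 0 <= cutpowV s x.
Proof. by apply: prodr_ge0 => j _; exact: cutpow_ge0. Qed.

Lemma cutpowV_integrable s : -1 < s -> mV.-integrable setT (EFin \o cutpowV s).
Proof.
move=> s1.
have [|[iF _] _] := @Cintegral_bigprod R n (fun _ t => (cutpow s t)%:C).
  by move=> i; apply: Cintegrable_real; exact: cutpow_integrable.
by apply: integrable_ext iF => x; rewrite -rmorph_prod.
Qed.

Lemma g_xiE s x y t :
  g_xi s (x, y, t) = cutpowV s x * cutpowV s y * cutpow s t.
Proof.
have out (w : V) j : ~ `|w j ord0| <= 1 -> cutpowV s w = 0.
  by move=> h; rewrite /cutpowV (bigD1 j)//= cutpow_out// mul0r.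
have [[h t1]|h] := pselect (boxA (x, y, t)); rewrite /g_xi indicE.
  rewrite mem_set// mulr1 /= cutpow_in// -mulrA mulrC; congr (_ * _ * _); apply: eq_bigr => j _; rewrite cutpow_in//.
    by have [] := h j.
  by have [] := h j.
rewrite memNset// mulr0; apply/esym.
have [t1|t1] := pselect (`|t| <= 1); last by rewrite cutpow_out// mulr0.
have [hx|/existsNP[j hx]] := pselect (forall j, `|x j ord0| <= 1); last first.
  by rewrite (out x j)// !mul0r.
have [hy|/existsNP[j hy]] := pselect (forall j, `|y j ord0| <= 1); last first.
  by rewrite (out y j)// mulr0 mul0r.
by exfalso; apply: h; split.
Qed.

Local Notation mV2 := (prod_measure mV mV).

Lemma cutpowV2_integrable s : -1 < s ->
  mV2.-integrable setT (EFin \o (fun z : V * V => cutpowV s z.1 * cutpowV s z.2)).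
Proof. by move=> s1; apply: integrable_prod; exact: cutpowV_integrable. Qed.

Lemma f_xi_integrable s (P : probability (unitary_group R n) R) : -1 < s ->
  (haarG P).-integrable setT (EFin \o f_xi s).
Proof.
move=> s1.
have i1 := integrable_prod (cutpowV2_integrable s1) (cutpow_integrable s1).
have i2 : P.-integrable setT (EFin \o (fun=> 1 : R)).
  by apply: finite_measure_integrable_cst.
apply: integrable_ext (integrable_prod i1 i2) => -[[[x y] t] k].
by rewrite /f_xi g_xiE mulr1.
Qed.

Lemma sqr_f_xi s (g : heisenberg_motion R n) : f_xi s g ^+ 2 = f_xi (2 * s) g.
Proof.
case: g => -[[x y] t] k; rewrite /f_xi !g_xiE 2!exprMn sqr_cutpow /cutpowV -!prodrXl.
by congr (_ * _ * _); apply: eq_bigr => j _; rewrite sqr_cutpow.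
Qed.

Lemma f_xi_Lfun2 s (P : probability (unitary_group R n) R) : - 2^-1 < s ->
  f_xi s \in Lfun (haarG P) 2%:E.
Proof.
move=> s2; apply/Lfun2P; split.
  have s1 : -1 < s by lra.
  by have /measurable_int/measurable_EFinP := f_xi_integrable P s1.
have s1 : -1 < 2 * s by lra.
apply: integrable_ext (f_xi_integrable P s1).
by move=> g; rewrite -sqr_f_xi.
Qed.

Lemma boxA_compact : compact (@boxA R n).
Proof.
have -> : @boxA R n = (@mx_box R n 1 `*` @mx_box R n 1) `*` `[(-1 : R), 1]%classic.
  apply/seteqP; split=> [[[x y] t] [/= h t1]|[[x y] t] [/= [hx hy] t1]].
    split; last by rewrite /= in_itv/= -ler_norml.
    by split=> i j; rewrite ord1; have [] := h i.
  split; last by move: t1; rewrite /= in_itv/= -ler_norml.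
  by move=> l; split; [exact: hx | exact: hy].
apply: compact_setX; last exact: segment_compact.
by apply: compact_setX; exact: mx_box_compact.
Qed.

Lemma boxA_closed : closed (@boxA R n).
Proof.
have ball_closed (F : V * V * R -> R) : continuous F -> closed [set z | `|F z| <= 1].
  move=> cF; apply: (closed_comp (f := fun z => `|F z|) (D := [set r | r <= 1])) => //.
  by move=> z _; apply: (@continuous_comp _ _ _ F Num.norm); [exact: cF|exact: norm_continuous].
have cx l : continuous (fun z : V * V * R => z.1.1 l ord0).
  move=> z; apply: (@continuous_comp _ _ _ (fun z : V * V * R => z.1.1) (fun x : V => x l ord0)).
    by apply: (@continuous_comp _ _ _ fst fst); exact: cvg_fst.
  exact: continuous_entry.
have cy l : continuous (fun z : V * V * R => z.1.2 l ord0).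
  move=> z; apply: (@continuous_comp _ _ _ (fun z : V * V * R => z.1.2) (fun x : V => x l ord0)).
    by apply: (@continuous_comp _ _ _ fst snd); [exact: cvg_fst|exact: cvg_snd].
  exact: continuous_entry.
have ct : continuous (fun z : V * V * R => z.2) by move=> z; exact: cvg_snd.
rewrite (_ : @boxA R n = (\bigcap_(l in [set: 'I_n])
    ([set z : V * V * R | `|z.1.1 l ord0| <= 1] `&` [set z : V * V * R | `|z.1.2 l ord0| <= 1])) `&`
    [set z : V * V * R | `|z.2| <= 1]); last first.
  apply/seteqP; split=> [z [h t1]|z [h t1]]; split => // l; last exact: h.
  by move=> _; exact: h.
apply: closedI; last exact: ball_closed ct.
apply: closed_bigI => l _; apply: closedI; first exact: ball_closed (cx l).
exact: ball_closed (cy l).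
Qed.

Lemma f_xi_support_compact s :
  compact (closure [set g : heisenberg_motion R n | f_xi s g != 0]).
Proof.
have aux (T : topologicalType) (D : set (V * V * R * T)) : compact [set: T] ->
    D `<=` @boxA R n `*` setT -> compact (closure D).
  move=> cT sub; have cS := compact_setX boxA_compact cT.
  have clS : closed (@boxA R n `*` [set: T]).
    rewrite (_ : _ `*` _ = fst @^-1` @boxA R n).
      by apply: closed_comp boxA_closed => z _; exact: cvg_fst.
    by apply/seteqP; split=> [z []|z].
  apply: (subclosed_compact _ cS); first exact: closed_closure.
  by rewrite closureE => z; apply.
apply: aux; first exact: unitary_compact.
case=> -[[x y] t] k /= f0; split=> //.
have [//|h] := pselect (boxA (x, y, t)).
by move: f0; rewrite /f_xi /g_xi indicE memNset// mulr0 eqxx.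
Qed.

End test_function.

(** * Measurability of matrix coefficients *)

Section measurable_parameter.
Context d1 d2 (T1 : measurableType d1) (T2 : measurableType d2) (R : realType).
Variable m2 : {sigma_finite_measure set T2 -> \bar R}.

Lemma measurable_Rintegral (f : T1 * T2 -> R) : measurable_fun setT f ->
  measurable_fun setT (fun x => \int[m2]_y f (x, y)).
Proof.
move=> /measurable_EFinP mf.
have mp := measurable_fun_fubini_tonelli_F (m2 := m2) _ (measurable_funepos mf) (fun z => funepos_ge0 _ z).
have mn := measurable_fun_fubini_tonelli_F (m2 := m2) _ (measurable_funeneg mf) (fun z => funeneg_ge0 _ z).
apply: (measurableT_comp (@fine_measurable R _ measurableT)).
rewrite (_ : (fun x => _) = (fun x => fubini_F m2 (EFin \o f)^\+ x - fubini_F m2 (EFin \o f)^\- x)%E).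
  exact: emeasurable_funB.
by apply/funext => x; rewrite integralE /fubini_F; congr (_ - _)%E;
  apply: eq_integral => y _; rewrite ?funeposE ?funenegE.
Qed.

Lemma measurable_Cintegral (f : T1 * T2 -> R[i]) : Cmeasurable f ->
  Cmeasurable (fun x => Cintegral m2 (fun y => f (x, y))).
Proof. by move=> [f1 f2]; split; [exact: (measurable_Rintegral f1)|exact: (measurable_Rintegral f2)]. Qed.

End measurable_parameter.

Section measurable_uniform.
Context d (X : measurableType d) (R : realType) (n : nat).
Local Notation U := (unitary_group R n).

Lemma open_measurable_U (A : set U) : open A -> measurable A.
Proof. by move=> oA; apply: sub_sigma_algebra. Qed.

Lemma continuous_measurable_U (f : U -> R) : continuous f -> measurable_fun setT f.
Proof.
move=> /continuousP cf; apply: (measurability _ (RGenOpens.measurableE R)) => //.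
by move=> _ [_ [a [b ->] <-]]; rewrite setTI; apply: open_measurable_U; apply: cf; exact: interval_open.
Qed.

(** By compactness, G is a uniform limit of functions which in the variable k
   take finitely many values, selected by open sets. *)
Lemma measurable_equicontinuous (G : X * U -> R) :
  (forall k, measurable_fun setT (fun x => G (x, k))) ->
  (forall k0 e, 0 < e -> \forall k \near k0, forall x, `|G (x, k) - G (x, k0)| <= e) ->
  measurable_fun setT G.
Proof.
move=> mG cG.
have step (e : R) : 0 < e -> exists H : X * U -> R,
    measurable_fun setT H /\ forall z, `|G z - H z| <= e.
  move=> e0; pose W (k0 : U) : set U := interior [set k : U | forall x, `|G (x, k) - G (x, k0)| <= e].
  have [D _ cD] : finite_subset_cover [set: U] W [set: U].
    have := @unitary_compact R n; rewrite compact_cover; apply.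
      by move=> k0 _; exact: open_interior.
    by move=> k0 _; exists k0 => //; exact: cG k0 e e0.
  pose pick (s : seq U) (k : U) := foldr (fun k0 k1 => if k \in W k0 then k0 else k1) point s.
  have pickP s k : (exists2 k0, k0 \in s & W k0 k) -> W (pick s k) k.
    elim: s => [[//]|a s IH [k0]] /=.
    case: ifPn => [/set_mem//|/negP aW].
    rewrite in_cons => /orP[/eqP -> h|h1 h2]; first by case: aW; exact: mem_set.
    by apply: IH; exists k0.
  have mpick s : measurable_fun setT (fun z : X * U => G (z.1, pick s z.2)).
    elim: s => [|a s IH] /=.
      exact: (measurableT_comp (mG point) measurable_fst).
    rewrite (_ : (fun _ => _) = fun z => if z.2 \in W a then G (z.1, a) else G (z.1, pick s z.2)).
      apply: measurable_fun_ifT => //.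
        apply: (measurableT_comp (f := fun k => k \in W a)); last exact: measurable_snd.
        apply: (measurable_fun_bool true); rewrite setTI.
        rewrite (_ : _ @^-1` _ = W a); first by apply: open_measurable_U; exact: open_interior.
        by apply/seteqP; split=> [j /set_mem|j /mem_set].
      exact: (measurableT_comp (mG a) measurable_fst).
    by apply/funext => z; case: ifP.
  exists (fun z => G (z.1, pick (enum_fset D) z.2)); split; first exact: mpick.
  case=> x k /=; have [k0 /= k0D Wk] := cD k I.
  suff /interior_subset : W (pick (enum_fset D) k) k by apply.
  by apply: pickP; exists k0.
have /choice[H hH] : forall N : nat, exists H : X * U -> R,
    measurable_fun setT H /\ forall z, `|G z - H z| <= N.+1%:R^-1.
  by move=> N; apply: step; rewrite invr_gt0.
apply: (measurable_fun_cvg (h := H)); first by move=> N; have [] := hH N.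
move=> z _; apply/cvgrPdist_le => e e0; near=> N.
apply: le_trans ((hH N).2 z) _; apply: ltW; near: N.
exact: near_infty_natSinv_lt (PosNum e0).
Unshelve. all: by end_near. Qed.

End measurable_uniform.

(** * Matrix coefficients of rho *)

Section rho.
Variables (R : realType) (n : nat) (lambda : R).
Variable m : unitary_group R n -> L2 R n -> L2 R n.
Hypothesis m_metaplectic : is_metaplectic lambda m.
Variable sigma : matrix_rep R n.
Hypothesis sigma_unitary : is_unitary_rep sigma.
Local Notation V := 'cV[R]_n.
Local Notation U := (unitary_group R n).
Local Notation mV := (lebesgueV R n).
Local Notation d := (rep_dim sigma).
Local Notation L2t := (L2tensor R n d).
Let H2 := L2_inner_space R n.
Let Ht := L2tensor_inner_space R n d.

Let um k : unitary_op (m k). Proof. by case: m_metaplectic. Qed.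
Let mm k u : hmem u -> hmem (m k u).
Proof. exact: unitary_op_mem. Qed.

Lemma schrodinger_time (z : V * V) t (phi : L2 R n) :
  schrodinger lambda (z, t) phi = expi (lambda * t) *: schrodinger lambda (z, 0) phi.
Proof.
case: z => x y; apply/funext => xi.
rewrite -[RHS]/(expi (lambda * t) * schrodinger lambda (x, y, 0) phi xi).
by rewrite !schrodingerE mulr0 expi0 mul1r mulrA.
Qed.

Lemma rho_component (g : heisenberg_motion R n) (u : L2t) i :
  component i (rho lambda m g u) =
  \sum_j sigma g.2 i j *: schrodinger lambda g.1 (m g.2 (component j u)).
Proof.
apply/funext => x; rewrite /component /rho /tensor_op mxE fct_sumE.
by apply: eq_bigr => j _; rewrite mxE.
Qed.

Let hmem_term (g : heisenberg_motion R n) (u : L2t) j : hmem u ->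
  hmem (schrodinger lambda g.1 (m g.2 (component j u))).
Proof. by move=> mu; apply: (hmem_schrodinger lambda _ _).1; apply: mm; exact: mu. Qed.

Lemma rho_dotE (g : heisenberg_motion R n) (u v : L2t) : hmem u -> hmem v ->
  hdot (rho lambda m g u) v = \sum_i \sum_j sigma g.2 i j *
    hdot (schrodinger lambda g.1 (m g.2 (component j u))) (component i v).
Proof.
move=> mu mv.
rewrite -[LHS]/(\sum_i hdot (component i (rho lambda m g u)) (component i v)); apply: eq_bigr => i _.
have mt j : hmem (sigma g.2 i j *: schrodinger lambda g.1 (m g.2 (component j u))).
  by apply: (hmem_scale H2); exact: hmem_term.
rewrite rho_component (hdot_suml H2 _ _ mt (mv i)).
by apply: eq_bigr => j _; rewrite (hdotZl H2 _ (hmem_term g j mu) (mv i)).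
Qed.

Lemma hmem_rho g u : hmem u -> hmem (rho lambda m g u : L2t).
Proof.
move=> mu i; rewrite rho_component; apply: (hmem_sum H2) => j.
by apply: (hmem_scale H2); exact: hmem_term.
Qed.

(** The orthonormality of the columns of sigma(k) is what makes S (x) sigma(k)
   isometric for an isometry S. *)
Lemma hsq_rho g u : hmem u -> hsq (rho lambda m g u : L2t) = hsq u.
Proof.
move=> mu; pose S j := schrodinger lambda g.1 (m g.2 (component j u)).
have mS j : hmem (S j) by exact: hmem_term.
have mZ i j : hmem (sigma g.2 i j *: S j) by apply: (hmem_scale H2).
have us : (sigma g.2 ^t*)%sesqui \is unitarymx.
  by rewrite trmxC_unitary; case: sigma_unitary.
rewrite !hsq_L2tensor.
transitivity (\sum_j hsq (S j)); last first.
  apply: eq_bigr => j _; rewrite (hmem_schrodinger lambda g.1 (mm g.2 (mu j))).2.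
  by rewrite (unitary_op_hsq (um g.2) (mu j)).
have E : \sum_i hdot (component i (rho lambda m g u)) (component i (rho lambda m g u)) =
    \sum_j hdot (S j) (S j).
  transitivity (\sum_i \sum_j \sum_l
      (sigma g.2 i j * (sigma g.2 i l)^*) * hdot (S j) (S l)).
    apply: eq_bigr => i _; rewrite !rho_component (hdot_suml H2)//; last exact: (hmem_sum H2).
    apply: eq_bigr => j _; rewrite (hdot_sumr H2)//.
    apply: eq_bigr => l _; rewrite (hdotZl H2 _ (mS j) (mZ i l)) (hdotZr H2 _ (mS l) (mS j)).
    by rewrite mulrA.
  rewrite exchange_big; apply: eq_bigr => j _; rewrite exchange_big /=.
  rewrite (bigD1 j)//= -mulr_suml unitary_cols// eqxx mul1r big1 ?addr0// => l lj.
  by rewrite -mulr_suml unitary_cols// eq_sym (negbTE lj) mul0r.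
by move/(congr1 (@complex.Re R)): E; rewrite !Re_sum.
Qed.

Lemma sqn_rho_dot_le g (u v : L2t) : hmem u -> hmem v ->
  sqn (hdot (rho lambda m g u) v) <= hsq u * hsq v.
Proof.
move=> mu mv; rewrite -(hsq_rho g mu); apply: (cauchy_schwarz Ht) => //.
exact: hmem_rho.
Qed.

Lemma rho_dot_time z t k (u v : L2t) : hmem u -> hmem v ->
  hdot (rho lambda m (z, t, k) u) v =
  expi (lambda * t) * hdot (rho lambda m (z, 0, k) u) v.
Proof.
move=> mu mv; rewrite !rho_dotE// mulr_sumr; apply: eq_bigr => i _.
rewrite mulr_sumr; apply: eq_bigr => j _.
have mz : hmem (schrodinger lambda (z, 0) (m k (component j u))).
  exact: (@hmem_term (z, 0, k)).
have E : hdot (schrodinger lambda (z, t) (m k (component j u))) (component i v) =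
    expi (lambda * t) * hdot (schrodinger lambda (z, 0) (m k (component j u))) (component i v).
  by rewrite schrodinger_time (hdotZl H2 _ mz (mv i)).
exact: etrans (congr1 (fun c => sigma k i j * c) E) (mulrCA _ _ _).
Qed.

Lemma Cmeasurable_schrodinger_dot (phi w : L2 R n) : hmem phi -> hmem w ->
  Cmeasurable (fun z : V * V => hdot (schrodinger lambda (z, 0) phi) w).
Proof.
move=> /hmem_L2[mphi _] /hmem_L2[mw _].
have mz : measurable_fun setT (fun s : (V * V) * V => s.1.1).
  exact: (measurableT_comp measurable_fst measurable_fst).
have my : measurable_fun setT (fun s : (V * V) * V => s.1.2).
  exact: (measurableT_comp measurable_snd measurable_fst).
have mx : measurable_fun setT (fun s : (V * V) * V => s.2) by exact: measurable_snd.
pose K (s : (V * V) * V) : R[i] := expi (lambda * (dotV s.1.1 s.2 + dotV s.1.1 s.1.2 / 2)) *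
  phi (s.2 + s.1.2) * (w s.2)^*.
rewrite (_ : (fun _ => _) = fun z => Cintegral mV (fun xi => K (z, xi))); last first.
  apply/funext => -[x y]; rewrite hdot_L2; apply: eq_Cintegral => xi.
  by rewrite schrodingerE mulr0 expi0 mul1r.
apply: (@measurable_Cintegral _ _ _ _ _ mV K).
apply: CmeasurableM; first apply: CmeasurableM.
- apply: Cmeasurable_expi; apply: measurable_funM => //.
  apply: measurable_funD; first exact: measurable_dotV.
  by apply: measurable_funM => //; exact: measurable_dotV.
- by apply: (Cmeasurable_comp mphi); exact: measurable_addfV.
- by apply: CmeasurableJ; exact: (Cmeasurable_comp mw).
Qed.

(** The strong continuity of mu gives a modulus of continuity in k which does
   not depend on z, since pi is isometric. *)
Lemma Cmeasurable_metaplectic_dot (phi w : L2 R n) : hmem phi -> hmem w ->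
  Cmeasurable (fun s : (V * V) * U => hdot (schrodinger lambda (s.1, 0) (m s.2 phi)) w).
Proof.
move=> mphi mw; have [_ _ cm _] := m_metaplectic.
pose G (s : (V * V) * U) := hdot (schrodinger lambda (s.1, 0) (m s.2 phi)) w.
have bound z k k0 : sqn (G (z, k) - G (z, k0)) <= hsq (m k phi - m k0 phi) * hsq w.
  have [m1 _] := hmem_schrodinger lambda (z, 0) (mm k mphi).
  have [m2 _] := hmem_schrodinger lambda (z, 0) (mm k0 mphi).
  have m3 := hmem_sub H2 (mm k mphi) (mm k0 mphi).
  have [m4 e4] := hmem_schrodinger lambda (z, 0) m3.
  by rewrite /G -(hdotBl H2 m1 m2 mw) -schrodinger_sub -e4; apply: (cauchy_schwarz H2).
have near_ k0 e : 0 < e -> \forall k \near k0, forall z, sqn (G (z, k) - G (z, k0)) <= e ^+ 2.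
  move=> e0; pose e' := e / (hnorm w + 1).
  have w0 : 0 < hnorm w + 1 by rewrite ltr_wpDl ?hnorm_ge0.
  have e'0 : 0 < e' by rewrite divr_gt0.
  apply: (@filterS _ (nbhs k0) (@nbhs_pfilter _ k0) _ _ _ (cm phi mphi k0 e' e'0)) => k hk z.
  apply: le_trans (bound _ _ _) _.
  have md := hmem_sub H2 (mm k mphi) (mm k0 mphi).
  rewrite -(sqr_hnorm H2 md) -(sqr_hnorm H2 mw) -exprMn ler_sqr ?nnegrE ?mulr_ge0 ?hnorm_ge0 ?(ltW e0)//.
  have -> : e = e' * (hnorm w + 1) by rewrite /e' divfK// gt_eqF.
  by apply: ler_pM; rewrite ?hnorm_ge0// ?(ltW hk)// lerDl.
have mG k := Cmeasurable_schrodinger_dot (mm k mphi) mw.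
split; apply: measurable_equicontinuous.
- by move=> k; exact: (mG k).1.
- move=> k0 e e0; apply: (@filterS _ (nbhs k0) (@nbhs_pfilter _ k0) _ _ _ (near_ k0 e e0)) => k hk z.
  rewrite -ler_sqr ?nnegrE// ?(ltW e0)// real_normK ?num_real//.
  by rewrite -ReN -ReD (le_trans (sqr_Re_le _))//; exact: hk.
- by move=> k; exact: (mG k).2.
- move=> k0 e e0; apply: (@filterS _ (nbhs k0) (@nbhs_pfilter _ k0) _ _ _ (near_ k0 e e0)) => k hk z.
  rewrite -ler_sqr ?nnegrE// ?(ltW e0)// real_normK ?num_real//.
  by rewrite -ImN -ImD; apply: le_trans (hk z); rewrite lerDr sqr_ge0.
Qed.

Lemma Cmeasurable_rho_dot (u v : L2t) : hmem u -> hmem v ->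
  Cmeasurable (fun s : (V * V) * U => hdot (rho lambda m (s.1, 0, s.2) u) v).
Proof.
move=> mu mv; have [_ _ cs] := sigma_unitary.
rewrite (_ : (fun _ => _) = fun s => \sum_i \sum_j sigma s.2 i j *
  hdot (schrodinger lambda (s.1, 0) (m s.2 (component j u))) (component i v)).
  apply: Cmeasurable_sum => i; apply: Cmeasurable_sum => j; apply: CmeasurableM.
    apply: (@Cmeasurable_comp _ _ _ _ _ (fun k => sigma k i j) snd); last exact: measurable_snd.
    by have [c1 c2] := cs i j; split; exact: continuous_measurable_U.
  by apply: Cmeasurable_metaplectic_dot; [exact: mu|exact: mv].
by apply/funext => s; rewrite rho_dotE.
Qed.

End rho.

(** * The Fourier transform of the test function *)

Section phase.
Variables (R : realType) (s : R).
Hypothesis s1 : -1 < s.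
Local Notation leb := (@lebesgue_measure R).

Definition cutpow_fourier (lambda : R) : R[i] :=
  Cintegral leb (fun t => (cutpow s t)%:C * expi (lambda * t)).

Lemma cutpow_fourier_integrable lambda :
  Cintegrable leb (fun t => (cutpow s t)%:C * expi (lambda * t)).
Proof.
apply: le_Cintegrable (cutpow_integrable s1) _ _.
- apply: CmeasurableM; first by apply: Cmeasurable_real; exact: measurable_cutpow.
  by apply: Cmeasurable_expi; exact: measurable_funM.
- exact: cutpow_ge0.
- by move=> t; rewrite sqnM sqn_real sqn_expi mulr1.
Qed.

End phase.

Section fourier.
Variables (R : realType) (n : nat) (P : probability (unitary_group R n) R).
Variables (s : R).
Hypothesis s1 : -1 < s.
Variable lambda : R.
Variable m : unitary_group R n -> L2 R n -> L2 R n.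
Hypothesis m_metaplectic : is_metaplectic lambda m.
Variable sigma : matrix_rep R n.
Hypothesis sigma_unitary : is_unitary_rep sigma.
Local Notation V := 'cV[R]_n.
Local Notation U := (unitary_group R n).
Local Notation mV := (lebesgueV R n).
Local Notation mV2 := (prod_measure mV mV).
Local Notation leb := (@lebesgue_measure R).
Local Notation d := (rep_dim sigma).
Local Notation L2t := (L2tensor R n d).
Variable T : L2t -> L2t.
Hypothesis T_fourier : is_fourier_transform P lambda m (fun g => (f_xi s g)%:C) T.
Let Ht := L2tensor_inner_space R n d.

Definition cutpowV2 (z : V * V) : R := cutpowV s z.1 * cutpowV s z.2.

Definition cutpowV2_mass : R := \int[mV2]_z cutpowV2 z.

Lemma cutpowV2_ge0 z : 0 <= cutpowV2 z.
Proof. by rewrite mulr_ge0 ?cutpowV_ge0. Qed.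

Definition averaged_dot (u v : L2t) (z : V * V) : R[i] :=
  Cintegral P (fun k => hdot (rho lambda m (z, 0, k) u) v).

Section vectors.
Variables (u v : L2t).
Hypotheses (mu : hmem u) (mv : hmem v).
Let B := Num.sqrt (hsq u * hsq v).
Let B0 : 0 <= B. Proof. exact: sqrtr_ge0. Qed.
Let B2 : B ^+ 2 = hsq u * hsq v.
Proof. by rewrite sqr_sqrtr// mulr_ge0// (hsq_ge0 Ht). Qed.
Let F (w : (V * V) * U) := hdot (rho lambda m (w.1, 0, w.2) u) v.
Let mF : Cmeasurable F. Proof. exact: Cmeasurable_rho_dot. Qed.
Let F_le w : sqn (F w) <= B ^+ 2.
Proof. by rewrite B2; exact: sqn_rho_dot_le. Qed.

Let intB : P.-integrable setT (EFin \o (fun=> B)).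
Proof. exact: finite_measure_integrable_cst. Qed.

Let F_integrable z : Cintegrable P (fun k => F (z, k)).
Proof.
have mz : measurable_fun setT (fun k : U => (z, k)) by exact: measurable_fun_pair.
exact: (le_Cintegrable (Cmeasurable_comp mF mz) intB (fun=> B0) (fun k => F_le (z, k))).
Qed.

Lemma Cmeasurable_averaged_dot : Cmeasurable (averaged_dot u v).
Proof. exact: (measurable_Cintegral P mF). Qed.

Lemma averaged_dot_le z : sqn (averaged_dot u v z) <= 2 * (hsq u * hsq v).
Proof.
apply: le_trans (sqn_Cintegral_le (F_integrable z) intB (fun=> B0) (fun k => F_le (z, k))) _.
have E : \int[P]_k B = B.
  apply: etrans (Rintegral_cst P measurableT B) _.
  by apply: etrans (congr1 (fun x => B * fine x) (probability_setT P)) _; rewrite /= mulr1.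
by rewrite E B2.
Qed.

Lemma cutpow_averaged_integrable :
  Cintegrable mV2 (fun z => (cutpowV2 z)%:C * averaged_dot u v z) /\
  sqn (Cintegral mV2 (fun z => (cutpowV2 z)%:C * averaged_dot u v z)) <=
    4 * cutpowV2_mass ^+ 2 * (hsq u * hsq v).
Proof.
pose C := Num.sqrt 2 * B.
have C2 : C ^+ 2 = 2 * (hsq u * hsq v) by rewrite exprMn B2 sqr_sqrtr.
have C0 : 0 <= C by rewrite mulr_ge0// sqrtr_ge0.
have iC := integrable_scale C (cutpowV2_integrable n s1).
have ge0 z : 0 <= C * cutpowV2 z by rewrite mulr_ge0// cutpowV2_ge0.
have le z : sqn ((cutpowV2 z)%:C * averaged_dot u v z) <= (C * cutpowV2 z) ^+ 2.
  by rewrite sqnM sqn_real [leRHS]exprMn C2 mulrC ler_wpM2r ?sqr_ge0// averaged_dot_le.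
have mc : measurable_fun setT cutpowV2.
  by have /measurable_int/measurable_EFinP := cutpowV2_integrable n s1.
have iI : Cintegrable mV2 (fun z => (cutpowV2 z)%:C * averaged_dot u v z).
  apply: (le_Cintegrable _ iC ge0 le).
  by apply: CmeasurableM; [exact: Cmeasurable_real|exact: Cmeasurable_averaged_dot].
split=> //; apply: le_trans (sqn_Cintegral_le iI iC ge0 le) _.
rewrite RintegralZl//; last exact: cutpowV2_integrable.
by rewrite -/cutpowV2_mass [(C * _) ^+ 2]exprMn C2 le_eqVlt; apply/orP; left; apply/eqP; ring.
Qed.

(** The central variable t enters the representation through a scalar, so the
   integral over it splits off. *)
Lemma fourier_dot : hdot (T u) v = cutpow_fourier s lambda *
  Cintegral mV2 (fun z => (cutpowV2 z)%:C * averaged_dot u v z).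
Proof.
have [_ ->//] := T_fourier.
pose I (g : ((V * V) * R) * U) := (f_xi s g)%:C * hdot (rho lambda m g u) v.
have IE z t k : I (z, t, k) = (cutpowV2 z)%:C * ((cutpow s t)%:C * expi (lambda * t)) * F (z, k).
  rewrite /I rho_dot_time// /f_xi; case: z => x y; rewrite g_xiE rmorphM.
  by rewrite -!mulrA.
have mfst : measurable_fun setT (fun g : ((V * V) * R) * U => g.1.1).
  exact: (measurableT_comp measurable_fst measurable_fst).
have mI : Cmeasurable I.
  rewrite (_ : I = fun g => (f_xi s g)%:C * expi (lambda * g.1.2) * F (g.1.1, g.2)).
    apply: CmeasurableM; first apply: CmeasurableM.
    - by apply: Cmeasurable_real; have /measurable_int/measurable_EFinP := f_xi_integrable P s1.
    - apply: Cmeasurable_expi; apply: measurable_funM => //.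
      exact: (measurableT_comp measurable_snd measurable_fst).
    - by apply: (Cmeasurable_comp mF); apply: measurable_fun_pair => //; exact: measurable_snd.
  by apply/funext => -[[z t] k]; rewrite /I rho_dot_time// mulrA.
have f0 g : 0 <= f_xi s g.
  by case: g => [[[x y] t] k]; rewrite /f_xi g_xiE !mulr_ge0 ?cutpowV_ge0 ?cutpow_ge0.
have iI : Cintegrable (haarG P) I.
  apply: (@le_Cintegrable _ _ R (haarG P) I _ mI (integrable_scale B (f_xi_integrable P s1))).
    by move=> g; rewrite mulr_ge0.
  move=> g.
  by rewrite sqnM sqn_real [leRHS]exprMn B2 mulrC ler_wpM2r ?sqr_ge0// sqn_rho_dot_le.
have [_ E] := Cintegral12 iI; apply: etrans E _.
transitivity (Cintegral (prod_measure mV2 leb) (fun w : (V * V) * R =>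
    ((cutpowV2 w.1)%:C * averaged_dot u v w.1) * ((cutpow s w.2)%:C * expi (lambda * w.2)))).
  apply: eq_Cintegral => -[z t]; under eq_Cintegral do rewrite IE.
  rewrite CintegralZ; last exact: F_integrable.
  exact: mulrAC.
have [ia _] := cutpow_averaged_integrable.
exact: etrans (Cintegral_prod ia (cutpow_fourier_integrable s1 lambda)) (mulrC _ _).
Qed.

Lemma sqn_fourier_dot_le : sqn (hdot (T u) v) <=
  4 * cutpowV2_mass ^+ 2 * sqn (cutpow_fourier s lambda) * hsq u * hsq v.
Proof.
rewrite fourier_dot sqnM; have [_ h] := cutpow_averaged_integrable.
apply: le_trans (ler_wpM2l (sqn_ge0 _) h) _.
by rewrite le_eqVlt; apply/orP; left; apply/eqP; ring.
Qed.

End vectors.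
End fourier.

Section ground_tensor.
Variables (R : realType) (n : nat) (lambda : R).
Hypothesis lambda0 : lambda != 0.
Variable m : unitary_group R n -> L2 R n -> L2 R n.
Hypothesis m_metaplectic : is_metaplectic lambda m.
Variable sigma : matrix_rep R n.
Local Notation d := (rep_dim sigma).
Variable Q : 'cV[R[i]]_d.
Hypothesis Q1 : \sum_j sqn (Q j ord0) = 1.
Hypothesis sigmaQ : forall k, sigma k *m Q = (ground_char lambda m k)^* *: Q.
Local Notation L2t := (L2tensor R n d).
Local Notation g := (@gstate R n lambda).
Let H2 := L2_inner_space R n.
Let mg : hmem g. Proof. exact: (gstate_unit n lambda0).1. Qed.

Definition ground_tensor : L2t := fun x => g x *: Q.

Let ground_component j : component j ground_tensor = Q j ord0 *: g.
Proof. by apply/funext => x; rewrite /component mxE mulrC. Qed.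

Lemma ground_tensor_unit : hmem ground_tensor /\ hsq ground_tensor = 1.
Proof.
split=> [j|]; first by rewrite ground_component; exact: (hmem_scale H2).
rewrite hsq_L2tensor -Q1; apply: eq_bigr => j _.
by rewrite ground_component (hsqZ H2)// (gstate_unit n lambda0).2 mulr1.
Qed.

(** The factors by which mu(k) and sigma(k) move the two tensor legs are
   conjugate to each other. *)
Lemma rho_ground_tensor x y k :
  hdot (rho lambda m (x, y, 0, k) ground_tensor) ground_tensor =
  (gaussV (`|lambda| / 4) x * gaussV (`|lambda| / 4) y)%:C.
Proof.
have [mt _] := ground_tensor_unit.
pose chi := ground_char lambda m k; pose D := hdot (schrodinger lambda (x, y, 0) g) g.
have um : unitary_op (m k) by case: m_metaplectic.
have mm := unitary_op_mem um.
have key i j : hdot (schrodinger lambda (x, y, 0) (m k (Q j ord0 *: g))) (Q i ord0 *: g) =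
    Q j ord0 * chi * (Q i ord0)^* * D.
  have mQ a : hmem (a *: g) by exact: (hmem_scale H2).
  have ms phi : hmem phi -> hmem (schrodinger lambda (x, y, 0) phi).
    by move=> mphi; exact: (hmem_schrodinger lambda (x, y, 0) mphi).1.
  have [bT _ _] := um.
  have h : heq (m k (Q j ord0 *: g)) ((Q j ord0 * chi) *: g).
    apply: (heq_trans H2 (mm _ (mQ _)) (hmem_scale H2 (Q j ord0) (mm _ mg)) (mQ _)).
      exact: bounded_opZ.
    rewrite -scalerA; apply: (heqZ H2) => //; first exact: mm.
    exact: ground_charE.
  have h' := heq_schrodinger lambda (x, y, 0) (mm _ (mQ _)) (mQ _) h.
  rewrite (heq_dotl H2 (ms _ (mm _ (mQ _))) (ms _ (mQ _)) (mQ _) h').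
  have lin a : schrodinger lambda (x, y, 0) (a *: g) = a *: schrodinger lambda (x, y, 0) g.
    apply/funext => xi; rewrite -[RHS]/(a * schrodinger lambda (x, y, 0) g xi).
    by rewrite !schrodingerE mulrCA.
  rewrite lin (hdotZl H2 _ (ms _ mg) (mQ _)) (hdotZr H2 _ mg (ms _ mg)).
  by rewrite mulrA.
have DE : D = (gaussV (`|lambda| / 4) x * gaussV (`|lambda| / 4) y)%:C.
  by rewrite /D schrodinger_gstate// mulr0 expi0 mul1r.
rewrite rho_dotE// -DE.
transitivity (\sum_i (chi * D) * ((sigma k *m Q) i ord0 * (Q i ord0)^*)).
  apply: eq_bigr => i _; rewrite mxE mulr_suml mulr_sumr; apply: eq_bigr => j _.
  have := key i j; rewrite -!ground_component => kE.
  apply: etrans (congr1 (fun c => sigma k i j * c) kE) _.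
  by ring.
rewrite -mulr_sumr sigmaQ.
transitivity (chi * D * (chi^* * \sum_i (sqn (Q i ord0))%:C)).
  congr (_ * _); rewrite mulr_sumr; apply: eq_bigr => i _.
  by rewrite mxE -mulrA mulcJ.
rewrite -rmorph_sum Q1 mulr1 mulrAC mulcJ sqn_ground_char//.
by rewrite mul1r.
Qed.

Variables (P : probability (unitary_group R n) R) (s : R).
Hypothesis s1 : -1 < s.
Hypothesis sigma_unitary : is_unitary_rep sigma.
Variable T : L2t -> L2t.
Hypothesis T_fourier : is_fourier_transform P lambda m (fun g => (f_xi s g)%:C) T.
Local Notation mV2 := (prod_measure (lebesgueV R n) (lebesgueV R n)).

Definition gaussian_mass (b : R) : R := \int[mV2]_z (cutpowV2 s z *
  (gaussV b z.1 * gaussV b z.2)).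

Lemma fourier_ground_tensor : hdot (T ground_tensor) ground_tensor =
  cutpow_fourier s lambda * (gaussian_mass (`|lambda| / 4))%:C.
Proof.
have [mt _] := ground_tensor_unit.
rewrite (fourier_dot s1 m_metaplectic sigma_unitary T_fourier mt mt); congr (_ * _).
rewrite -Cintegral_real; apply: eq_Cintegral => -[x y]; rewrite [RHS]rmorphM; congr (_ * _).
pose c := gaussV (`|lambda| / 4) x * gaussV (`|lambda| / 4) y.
transitivity (Cintegral P (fun=> c%:C)).
  by apply: eq_Cintegral => k; exact: rho_ground_tensor.
rewrite Cintegral_real; congr (_%:C).
apply: etrans (Rintegral_cst P measurableT c) _.
by apply: etrans (congr1 (fun x => c * fine x) (probability_setT P)) _; rewrite /= mulr1.
Qed.

End ground_tensor.

(** * Decay of the Gaussian averages *)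

Section gaussian_average.
Variables (R : realType) (s : R).
Hypotheses (s1 : -1 < s) (s0 : s < 0).
Local Notation leb := (@lebesgue_measure R).

Definition gaussian_average (b : R) : R := \int[leb]_t (cutpow s t * gaussian b t).

Lemma gaussian_average_integrable b : 0 < b ->
  leb.-integrable setT (EFin \o (fun t => cutpow s t * gaussian b t)).
Proof.
move=> b0; apply: integrable_le (cutpow_integrable s1) _ => [|t].
  by apply: measurable_funM; [exact: measurable_cutpow|exact: measurable_gaussian].
rewrite ger0_norm ?mulr_ge0 ?cutpow_ge0 ?gaussian_ge0//.
by rewrite ler_piMr ?cutpow_ge0 ?gaussian_le1.
Qed.

(** On 0 < t <= 1/r the power is at least r^-s and the Gaussian at least
   e^(-1/4). *)
Lemma gaussian_average_ge r : 1 <= r ->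
  expR (- 4^-1) * r `^ (- 1 - s) <= gaussian_average (r ^+ 2 / 4).
Proof.
move=> r1; have r0 : 0 < r by rewrite (lt_le_trans _ r1).
pose c := r `^ (- s) * expR (- 4^-1).
have c0 : 0 <= c by rewrite mulr_ge0 ?powR_ge0 ?expR_ge0.
have b0 : 0 < r ^+ 2 / 4 by rewrite divr_gt0 ?exprn_gt0.
have mI : measurable (`]0, r^-1]%classic : set R) by exact: measurable_itv.
have lI : leb `]0, r^-1]%classic = (r^-1)%:E.
  apply: etrans (lebesgue_measure_itv _) _.
  by rewrite /= lte_fin invr_gt0 r0 sube0.
have iI : leb.-integrable setT (EFin \o (\1_(`]0, r^-1]%classic : set R) : R -> R)).
  exact: integrable_indic_itv.
have E : \int[leb]_t (c * \1_(`]0, r^-1]%classic) t) = expR (- 4^-1) * r `^ (- 1 - s).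
  rewrite RintegralZl//.
  have -> : \int[leb]_t (\1_(`]0, r^-1]%classic) t) = r^-1.
    rewrite /Rintegral integral_indic// setIT.
    exact: etrans (congr1 fine lI) _.
  rewrite /c mulrC mulrA -(powR_inv1 (ltW r0)) -powRD ?(gt_eqF r0) ?implybT//.
  by rewrite mulrC.
rewrite -E; apply: le_Rintegral => //.
- exact: integrable_scale.
- exact: gaussian_average_integrable.
move=> t _; have [/set_mem|tI] := boolP (t \in (`]0, r^-1]%classic : set R)); last first.
  by rewrite indicE (negbTE tI) mulr0 mulr_ge0 ?cutpow_ge0 ?gaussian_ge0//.
rewrite /= in_itv/= => /[dup] tI /andP[t0 tr].
rewrite indicE mem_set ?mulr1; last by rewrite /= in_itv.
have t1 : t <= 1 by rewrite (le_trans tr)// invf_le1.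
rewrite cutpow_in ger0_norm ?(ltW t0)//; apply: ler_pM; rewrite ?powR_ge0 ?expR_ge0//.
  have rt : r <= t^-1 by rewrite -[leLHS]invrK lef_pV2 ?posrE ?invr_gt0.
  have -> : t `^ s = (t^-1) `^ (- s).
    by rewrite -(powR_inv1 (ltW t0)) -powRrM mulN1r opprK.
  by rewrite ge0_ler_powR ?nnegrE ?invr_ge0 ?oppr_ge0 ?(ltW s0) ?(ltW r0) ?(ltW t0).
have rt : r * t <= 1.
  by rewrite -(mulfV (lt0r_neq0 r0)) ler_wpM2l// ltW.
rewrite /gaussian ler_expR.
have : (r * t) ^+ 2 <= 1 by rewrite expr_le1// mulr_ge0 ?(ltW r0) ?(ltW t0).
by rewrite exprMn; lra.
Qed.

Lemma gaussian_massE n b : 0 < b ->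
  gaussian_mass n s b = gaussian_average b ^+ (2 * n).
Proof.
move=> b0; pose f (x : 'cV[R]_n) : R[i] := (cutpowV s x * gaussV b x)%:C.
have fE : f = fun x => \prod_i (cutpow s (x i ord0) * gaussian b (x i ord0))%:C.
  by apply/funext => x; rewrite -rmorph_prod big_split /= -gaussV_prod.
have [fi fI] : Cintegrable (lebesgueV R n) f /\
    Cintegral (lebesgueV R n) f = ((gaussian_average b) ^+ n)%:C.
  have [|i1 e1] := @Cintegral_bigprod R n (fun _ t => (cutpow s t * gaussian b t)%:C).
    by move=> _; apply: Cintegrable_real; exact: gaussian_average_integrable.
  rewrite fE; split=> //; apply: etrans e1 _.
  by rewrite (eq_bigr _ (fun i _ => Cintegral_real _ _)) prodr_const card_ord rmorphXn.
apply: complexI; rewrite -Cintegral_real.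
transitivity (Cintegral (prod_measure (lebesgueV R n) (lebesgueV R n)) (fun z => f z.1 * f z.2)).
  apply: eq_Cintegral => z; rewrite -rmorphM; congr (_%:C).
  by rewrite /cutpowV2 mulrACA.
apply: etrans (Cintegral_prod fi fi) _.
by rewrite fI -rmorphM -exprD addnn mul2n.
Qed.

(** By Fubini's theorem the Gaussian passes from c to its Fourier transform,
   whose mass concentrates at |t| < 1/L, where the power is large. *)
Lemma cutpow_fourier_gaussian L : 0 < L ->
  leb.-integrable setT (EFin \o (fun lam =>
    gaussian (L ^- 2) lam * complex.Re (cutpow_fourier s lam))) /\
  \int[leb]_lam (gaussian (L ^- 2) lam * complex.Re (cutpow_fourier s lam)) =
    Num.sqrt pi * L * gaussian_average (L ^+ 2 / 4).
Proof.
move=> L0; set a := L ^- 2; have a0 : 0 < a by rewrite invr_gt0 exprn_gt0.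
have [ig _] := gaussian_integral a0; have ip := cutpow_integrable s1.
pose K (z : R * R) := gaussian a z.1 * (cutpow s z.2 * cos (z.1 * z.2)).
have mK : measurable_fun setT K.
  apply: measurable_funM; first exact: (measurableT_comp (measurable_gaussian a)).
  apply: measurable_funM; first exact: (measurableT_comp (measurable_cutpow s)).
  apply: measurableT_comp; first by (apply: continuous_measurable_fun; exact: continuous_cos).
  by apply: measurable_funM.
have KM z : `|K z| <= gaussian a z.1 * cutpow s z.2.
  rewrite normrM (ger0_norm (gaussian_ge0 _ _)) normrM (ger0_norm (cutpow_ge0 _ _)).
  by rewrite ler_wpM2l ?gaussian_ge0// ler_piMr ?cutpow_ge0// cos_max.
have iK : (prod_measure leb leb).-integrable setT (EFin \o K).
  apply: (le_integrable measurableT _ _ (integrable_prod ig ip)).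
    exact/measurable_EFinP.
  by move=> z _; rewrite /= lee_fin (le_trans (KM z))// ler_norm.
have inner lam : \int[leb]_t K (lam, t) = gaussian a lam * complex.Re (cutpow_fourier s lam).
  have [ic _] := cutpow_fourier_integrable s1 lam.
  rewrite [complex.Re _]/= -RintegralZl//.
  by apply: eq_Rintegral => t _; rewrite /K /= mul0r subr0.
have [i1 e1] := Rintegral12 iK; have [_ e2] := Rintegral21 iK.
split; first by apply: integrable_ext i1 => lam; exact: inner.
transitivity (\int[leb]_lam \int[leb]_t K (lam, t)).
  by apply: eq_Rintegral => lam _; rewrite inner.
rewrite -e1 e2.
rewrite -RintegralZl//; last first.
  by apply: gaussian_average_integrable; rewrite divr_gt0 ?exprn_gt0.
apply: eq_Rintegral => t _.
transitivity (cutpow s t * \int[leb]_lam (cos (t * lam) * gaussian a lam)).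
  have icos : leb.-integrable setT (EFin \o (fun lam => cos (t * lam) * gaussian a lam)).
    apply: integrable_le ig _ => [|lam].
      by apply: measurable_funM; [exact: measurable_cosM|exact: measurable_gaussian].
    by rewrite normrM (ger0_norm (gaussian_ge0 _ _)) ler_piMl ?gaussian_ge0// cos_max.
  rewrite -RintegralZl//.
  by apply: eq_Rintegral => lam _; rewrite /K /= [t * _]mulrC; ring.
rewrite gaussian_cos_integral//.
have -> : Num.sqrt (pi / a) = Num.sqrt pi * L.
  by rewrite /a invrK sqrtrM ?pi_ge0// sqrtr_sqr ger0_norm ?(ltW L0).
rewrite /gaussian (_ : - (4 * a)^-1 * t ^+ 2 = - (L ^+ 2 / 4) * t ^+ 2).
  by ring.
by rewrite invfM invrK; ring.
Qed.

End gaussian_average.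

(** * Divergence *)

Section divergence.
Variables (R : realType) (s q eps : R).
Hypotheses (s1 : -1 < s) (s0 : s < 0) (q1 : 1 < q) (eps0 : 0 <= eps) (eps2 : eps <= 2).
Hypothesis exponents : (1 + s) * (q - 1) + eps < - s.
Local Notation leb := (@lebesgue_measure R).
Local Notation c := (cutpow_fourier s).

(** Up to a constant factor, the lower bound for the integrand of the theorem on
   |lambda| >= 1; there eps is n (1 + 2 s). *)
Definition tail_density (lam : R) : R :=
  \1_[set x : R | 1 <= `|x|] lam * (sqn (c lam) `^ (q / 2) * `|lam| `^ (- eps)).

Lemma tail_density_ge0 lam : 0 <= tail_density lam.
Proof. by rewrite mulr_ge0 ?indicE// mulr_ge0 ?powR_ge0. Qed.

Let w lam := Num.sqrt (sqn (c lam)).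

Let w_pow lam : w lam `^ q = sqn (c lam) `^ (q / 2).
Proof. by rewrite /w -powR12_sqrt ?sqn_ge0// -powRrM mulrC. Qed.

Lemma Cmeasurable_cutpow_fourier : Cmeasurable c.
Proof.
pose K (z : R * R) : R[i] := (cutpow s z.2)%:C * expi (z.1 * z.2).
apply: (@measurable_Cintegral _ _ _ _ _ leb K); apply: CmeasurableM.
  by apply: Cmeasurable_real; exact: (measurableT_comp (measurable_cutpow s)).
by apply: Cmeasurable_expi; exact: measurable_funM.
Qed.

Lemma measurable_tail_density : measurable_fun setT tail_density.
Proof.
apply: measurable_funM.
  apply: measurable_indic; rewrite (_ : [set _ | _] = (@Num.norm R R) @^-1` `[1, +oo[%classic).
    by rewrite -[X in measurable X]setTI; apply: normr_measurable => //; exact: measurable_itv.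
  by apply/seteqP; split=> x /=; rewrite in_itv/= andbT.
apply: measurable_funM.
  apply: (measurableT_comp (measurable_powR _)).
  exact: (measurable_sqn Cmeasurable_cutpow_fourier).
by apply: (measurableT_comp (measurable_powR _)); exact: normr_measurable.
Qed.

Let mass := \int[leb]_t cutpow s t.
Let W := Num.sqrt (2 * mass ^+ 2).

Let w_le lam : w lam <= W.
Proof.
have le t : sqn ((cutpow s t)%:C * expi (lam * t)) <= cutpow s t ^+ 2.
  by rewrite sqnM sqn_real sqn_expi mulr1.
have W0 : 0 <= 2 * mass ^+ 2 by rewrite mulr_ge0 ?sqr_ge0.
rewrite ler_sqrt//.
exact: (sqn_Cintegral_le (cutpow_fourier_integrable s1 lam) (cutpow_integrable s1)
  (cutpow_ge0 s) le).
Qed.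

Let Re_le lam : complex.Re (c lam) <= w lam.
Proof.
apply: le_trans (ler_norm _) _; rewrite -ler_sqr ?nnegrE ?sqrtr_ge0//.
by rewrite real_normK ?num_real// sqr_sqrtr ?sqn_ge0// sqr_Re_le.
Qed.

(** Young's inequality with all constants equal to 1. *)
Let young x d : 0 <= x -> 0 < d -> x <= d `^ (1 - q) * x `^ q + d.
Proof.
move=> x0 d0; have [xd|dx] := lerP x d.
  by rewrite (le_trans xd)// lerDr mulr_ge0 ?powR_ge0.
have xp : 0 < x := lt_trans d0 dx.
apply: (@le_trans _ _ (x `^ (1 - q) * x `^ q)).
  by rewrite -powRD ?(gt_eqF xp) ?implybT// subrK powRr1 // ltW.
rewrite (le_trans _ (_ : d `^ (1 - q) * x `^ q <= _)) ?lerDl ?(ltW d0)//.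
rewrite ler_wpM2r ?powR_ge0// -opprB !powRN lef_pV2 ?posrE ?powR_gt0//.
by rewrite ge0_ler_powR ?nnegrE ?subr_ge0 ?(ltW q1) ?(ltW d0) ?(ltW xp) ?(ltW dx).
Qed.

(** This is x^eps <= e^(x^2) at x = |lam| / L. *)
Let gaussian_tail L lam : 1 <= L -> 1 <= `|lam| ->
  gaussian (L ^- 2) lam <= L `^ eps * `|lam| `^ (- eps).
Proof.
move=> L1 l1; have L0 : 0 < L by rewrite (lt_le_trans _ L1).
have l0 : 0 < `|lam| by rewrite (lt_le_trans _ l1).
pose x := `|lam| / L; have x0 : 0 < x by rewrite divr_gt0.
have -> : L `^ eps * `|lam| `^ (- eps) = (x `^ eps)^-1.
  rewrite /x powRM ?invr_ge0 ?(ltW l0) ?(ltW L0)// invfM powRN mulrC; congr (_ * _).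
  by rewrite -(powR_inv1 (ltW L0)) -powRrM mulN1r powRN invrK.
have -> : gaussian (L ^- 2) lam = (expR (x ^+ 2))^-1.
  rewrite -expRN /gaussian /x exprMn real_normK ?num_real//; congr expR.
  by rewrite exprVn mulNr mulrC.
rewrite lef_pV2 ?posrE ?expR_gt0 ?powR_gt0//.
have [x1|x1] := lerP x 1.
  apply: (@le_trans _ _ 1); last by rewrite -[leLHS]expR0 ler_expR sqr_ge0.
  have E1 : 1 `^ eps = 1 :> R by rewrite powR1.
  by rewrite -[leRHS]E1 ge0_ler_powR ?nnegrE ?(ltW x0).
apply: (@le_trans _ _ (x ^+ 2)); last first.
  by apply: le_trans (expR_ge1Dx _); rewrite lerDr.
by rewrite -powR_mulrn ?(ltW x0)// ler_powR ?(ltW x1).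
Qed.

Let pointwise L d lam : 1 <= L -> 0 < d ->
  gaussian (L ^- 2) lam * complex.Re (c lam) <=
  W * \1_(`[-1, 1]%classic : set R) lam +
  (d `^ (1 - q) * L `^ eps * tail_density lam + d * gaussian (L ^- 2) lam).
Proof.
move=> L1 d0; set G := gaussian (L ^- 2) lam.
have G0 : 0 <= G := gaussian_ge0 _ _.
have L0 : 0 < L by rewrite (lt_le_trans _ L1).
have G1 : G <= 1 by rewrite gaussian_le1// invr_gt0 exprn_gt0.
have w0 : 0 <= w lam := sqrtr_ge0 _.
have D0 : 0 <= d `^ (1 - q) * L `^ eps * tail_density lam.
  by rewrite !mulr_ge0 ?powR_ge0 ?tail_density_ge0.
apply: (@le_trans _ _ (G * w lam)); first by rewrite ler_wpM2l.
have [l1|l1] := lerP 1 `|lam|; last first.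
  rewrite indicE mem_set ?mulr1; last by rewrite /= in_itv/= -ler_norml ltW.
  apply: (@le_trans _ _ W); last by rewrite lerDl addr_ge0// mulr_ge0// ltW.
  by apply: le_trans (w_le lam); rewrite ler_piMl.
apply: (@le_trans _ _ (d `^ (1 - q) * L `^ eps * tail_density lam + d * G)); last first.
  by rewrite lerDr mulr_ge0 ?sqrtr_ge0 ?indicE.
apply: (@le_trans _ _ (G * (d `^ (1 - q) * w lam `^ q + d))).
  by rewrite ler_wpM2l// young.
rewrite mulrDr [d * G]mulrC lerD2r /tail_density indicE mem_set// mul1r w_pow.
rewrite [leLHS](_ : _ = d `^ (1 - q) * (sqn (c lam) `^ (q / 2)) * G); last by ring.
rewrite [leRHS](_ : _ = d `^ (1 - q) * (sqn (c lam) `^ (q / 2)) *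
  (L `^ eps * `|lam| `^ (- eps))); last by ring.
by rewrite ler_wpM2l ?mulr_ge0 ?powR_ge0// gaussian_tail.
Qed.

(** Tested against the Gaussian of width L, the function c has integral at least
   a constant times L^(-s).  If the density were integrable, Young's inequality
   would bound the same integral by a constant, half of that lower bound, and a
   term of order L^B with B < - s; this fails for large L. *)
Lemma tail_density_not_integrable : ~ leb.-integrable setT (EFin \o tail_density).
Proof.
move=> iD; pose J := \int[leb]_lam tail_density lam.
pose k := expR (- 4^-1) : R; have k0 : 0 < k := expR_gt0 _.
pose p := Num.sqrt pi : R; have p0 : 0 < p by rewrite sqrtr_gt0 pi_gt0.
have J0 : 0 <= J by apply: Rintegral_ge0 => lam _; exact: tail_density_ge0.
have integrated L d : 1 <= L -> 0 < d ->
    p * L * (k * L `^ (- 1 - s)) <=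
    W * 2 + (d `^ (1 - q) * L `^ eps * J + d * (p * L)).
  move=> L1 d0; have L0 : 0 < L by rewrite (lt_le_trans _ L1).
  have [il el] := cutpow_fourier_gaussian s1 L0.
  have a0 : 0 < L ^- 2 by rewrite invr_gt0 exprn_gt0.
  have [ig eg] := gaussian_integral a0.
  have iI := @integrable_indic_itv R (-1) 1 true false.
  apply: (@le_trans _ _ (p * L * gaussian_average s (L ^+ 2 / 4))).
    by rewrite ler_wpM2l ?gaussian_average_ge// mulr_ge0 ?(ltW p0) ?(ltW L0).
  rewrite -el; have iU := integrable_add (integrable_scale W iI)
    (integrable_add (integrable_scale (d `^ (1 - q) * L `^ eps) iD) (integrable_scale d ig)).
  apply: le_trans (le_Rintegral measurableT il iU (fun lam _ => pointwise lam L1 d0)) _.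
  have i2 := integrable_scale (d `^ (1 - q) * L `^ eps) iD.
  have i3 := integrable_scale d ig.
  rewrite (RintegralD measurableT (integrable_scale W iI) (integrable_add i2 i3)).
  rewrite (RintegralD measurableT i2 i3) !RintegralZl// eg.
  have -> : \int[leb]_lam (\1_(`[-1, 1]%classic : set R) lam) = 2.
    rewrite /Rintegral integral_indic// setIT.
    apply: etrans (congr1 fine (lebesgue_measure_itv _)) _.
    by rewrite /= lte_fin gtrN// opprK.
  rewrite (_ : Num.sqrt (pi / L ^- 2) = p * L)//.
  by rewrite invrK sqrtrM ?pi_ge0// sqrtr_sqr ger0_norm ?(ltW L0).
pose A := - s; pose B := (1 + s) * (q - 1) + eps; pose r := A - B.
have r0 : 0 < r by rewrite subr_gt0.
pose M := W * 2 + (k / 2) `^ (1 - q) * J.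
have key L : 1 <= L -> p * k / 2 * L `^ r <= M.
  move=> L1; have L0 : 0 < L by rewrite (lt_le_trans _ L1).
  have Lne : L != 0 by rewrite gt_eqF.
  (* With this d the last term of [integrated] is half of the left side. *)
  pose d := k / 2 * L `^ (- 1 - s).
  have d0 : 0 < d by rewrite mulr_gt0 ?powR_gt0// divr_gt0.
  have LA : L * L `^ (- 1 - s) = L `^ A.
    rewrite -[X in X * _]powRr1 ?(ltW L0)// -powRD ?Lne ?implybT//.
    by congr (_ `^ _); rewrite /A; ring.
  have LB : d `^ (1 - q) * L `^ eps = (k / 2) `^ (1 - q) * L `^ B.
    rewrite /d powRM ?powR_ge0 ?divr_ge0 ?(ltW k0)// -powRrM -mulrA.
    rewrite -powRD ?Lne ?implybT//.
    by congr (_ * _ `^ _); rewrite /B; ring.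
  have := integrated L d L1 d0; rewrite LB.
  rewrite [leLHS](_ : _ = p * k * L `^ A); last by rewrite -LA; ring.
  rewrite [d * _](_ : _ = p * k / 2 * L `^ A); last by rewrite -LA /d; ring.
  have B0 : 0 <= B.
    by rewrite addr_ge0// mulr_ge0 ?subr_ge0 ?(ltW q1)// -lerBlDl sub0r ltW.
  have LB1 : 1 <= L `^ B by rewrite -(powRr0 L) ler_powR.
  have rE : L `^ A = L `^ r * L `^ B by rewrite -powRD ?Lne ?implybT// subrK.
  rewrite rE => h; rewrite -(ler_pM2r (lt_le_trans ltr01 LB1)).
  have W0 : 0 <= W * 2 by rewrite mulr_ge0 ?sqrtr_ge0.
  have hW : W * 2 <= W * 2 * L `^ B by rewrite ler_peMr.
  have -> : M * L `^ B = W * 2 * L `^ B + (k / 2) `^ (1 - q) * L `^ B * J by rewrite /M; ring.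
  by lra.
have M0 : 0 <= M.
  by rewrite addr_ge0 ?mulr_ge0 ?sqrtr_ge0 ?powR_ge0.
have pk : 0 < p * k / 2 by rewrite divr_gt0 ?mulr_gt0.
pose N := 1 + M / (p * k / 2).
have N1 : 1 <= N by rewrite lerDl divr_ge0 ?(ltW pk).
have := key (N `^ r^-1); rewrite -powRrM mulVf ?gt_eqF// powRr1 ?(le_trans _ N1)//.
have -> : 1 <= N `^ r^-1.
  by rewrite -(powRr0 N) ler_powR ?invr_ge0 ?(ltW r0).
move=> /(_ isT); apply/negP; rewrite -ltNge /N mulrDr mulr1 mulrCA divff ?gt_eqF// mulr1.
by rewrite ltrDr.
Qed.

End divergence.

(** * The divergent integral *)

(** Measurability in lambda of the Schatten norms is not at hand, but the integral
   of a nonnegative function, a supremum over the simple functions below it, is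
   monotone for all functions. *)
Lemma ge0_integral_mono d (T : measurableType d) (R : realType)
    (mu : {measure set T -> \bar R}) (D : set T) (f g : T -> \bar R) :
  (forall x, D x -> (0 <= f x <= g x)%E) ->
  (\int[mu]_(x in D) f x <= \int[mu]_(x in D) g x)%E.
Proof.
move=> fg; have f0 x : D x -> (0 <= f x)%E by move=> /fg/andP[].
have g0 x : D x -> (0 <= g x)%E by move=> /fg/andP[]; exact: le_trans.
rewrite (ge0_integralE _ f0) (ge0_integralE _ g0).
apply: le_ereal_sup => _ [h hf <-]; exists h => // x.
apply: le_trans (hf x) _; apply: lee_restrict => y Dy.
by have /andP[] := fg y Dy.
Qed.

Section lower_bound.
Variables (R : realType) (n : nat) (P : probability (unitary_group R n) R).
Variables (s q : R).
Hypotheses (s1 : -1 < s) (s0 : s < 0) (q0 : 0 < q) (q2 : q <= 2).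
Variable lambda : R.
Hypothesis lambda1 : 1 <= `|lambda|.
Variable m : unitary_group R n -> L2 R n -> L2 R n.
Hypothesis m_metaplectic : is_metaplectic lambda m.
Variable Khat : set (matrix_rep R n).
Hypothesis Khat_dual : is_unitary_dual Khat.
Variable T : forall sigma : matrix_rep R n,
  L2tensor R n (rep_dim sigma) -> L2tensor R n (rep_dim sigma).
Hypothesis T_fourier : forall sigma, Khat sigma ->
  is_fourier_transform P lambda m (fun g => (f_xi s g)%:C) (@T sigma).

(** The first factor comes from the bound on all matrix coefficients, the second
   from the value e^(-1/4) of the Gaussian in each of the 2 n coordinates, squared;
   the summand 1 makes the base positive. *)
Definition schatten_bound : R :=
  (4 * (cutpowV2_mass n s ^+ 2 + 1)) `^ (q / 2 - 1) * expR (- 4^-1) ^+ (4 * n).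

Lemma schatten_bound_gt0 : 0 < schatten_bound.
Proof.
have k0 : 0 < 4 * (cutpowV2_mass n s ^+ 2 + 1).
  by rewrite mulr_gt0// ltr_wpDl ?sqr_ge0.
by rewrite mulr_gt0 ?powR_gt0 ?exprn_gt0 ?expR_gt0.
Qed.

Let lambda0 : lambda != 0.
Proof. by rewrite -normr_gt0 (lt_le_trans _ lambda1). Qed.

Let mass_ge : expR (- 4^-1) ^+ (4 * n) * `|lambda| `^ (- (n%:R * (1 + 2 * s))) <=
  gaussian_mass n s (`|lambda| / 4) ^+ 2 * `|lambda| ^+ n.
Proof.
set a := `|lambda|; have a0 : 0 < a by rewrite (lt_le_trans _ lambda1).
have an : a != 0 by rewrite gt_eqF.
pose r := Num.sqrt a; have r1 : 1 <= r by rewrite -[leLHS]sqrtr1 ler_sqrt// ltW.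
have r2 : r ^+ 2 = a by rewrite sqr_sqrtr// ltW.
have h := gaussian_average_ge s1 s0 r1; rewrite r2 in h.
rewrite gaussian_massE//; last by rewrite divr_gt0.
set X := gaussian_average s (a / 4) in h *; set Y := expR _ * _ in h.
have Y0 : 0 <= Y by rewrite mulr_ge0 ?expR_ge0 ?powR_ge0.
have -> : expR (- 4^-1) ^+ (4 * n) * a `^ (- (n%:R * (1 + 2 * s))) =
    Y ^+ (4 * n) * a ^+ n.
  rewrite /Y exprMn -mulrA; congr (_ * _).
  rewrite /r -powR12_sqrt ?(ltW a0)// -powRrM -!powR_mulrn ?powR_ge0 ?(ltW a0)//.
  rewrite -powRrM -powRD ?an ?implybT//; congr (_ `^ _).
  by rewrite natrM; field.
rewrite ler_wpM2r ?exprn_ge0 ?(ltW a0)// -exprM.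
rewrite (_ : (2 * n * 2)%N = (4 * n)%N); last by rewrite mulnC mulnA.
by rewrite lerXn2r ?nnegrE// (le_trans Y0).
Qed.

(** The Hilbert-Schmidt norm would only see the square of the phase; below the
   exponent 2 the bound of the matrix coefficients by M = O(|c|^2) gains the
   factor M^(q/2-1). *)
Lemma schatten_sum_ge :
  ((schatten_bound * (sqn (cutpow_fourier s lambda) `^ (q / 2) *
      `|lambda| `^ (- (n%:R * (1 + 2 * s)))))%:E <=
   (\esum_(sigma in Khat) ((rep_dim sigma)%:R%:E * schatten_pow q (@T sigma))) *
   (`|lambda| ^+ n)%:E)%E.
Proof.
have [sigma [Ks [Q [Q1 sQ]]]] := dual_ground_vector lambda0 m_metaplectic Khat_dual.
have [irr _] := Khat_dual; have [us [d0 _]] := irr sigma Ks.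
set z := sqn (cutpow_fourier s lambda); have z0 : 0 <= z := sqn_ge0 _.
have ln0 : 0 <= `|lambda| ^+ n by rewrite exprn_ge0.
have sum_ge0 : (0 <= \esum_(sigma in Khat)
    ((rep_dim sigma)%:R%:E * schatten_pow q (@T sigma)))%E.
  by apply: ereal_sup_ubound; exists set0; [exact: fsets_set0|rewrite fsbig_set0].
have [zE|zn] := eqVneq z 0.
  rewrite zE powR0; last by rewrite gt_eqF ?divr_gt0.
  by rewrite mul0r mulr0 mule_ge0.
have zp : 0 < z by rewrite lt_neqAle eq_sym zn.
pose u := ground_tensor lambda Q; have [mu u1] := ground_tensor_unit lambda0 Q1.
pose kappa := 4 * (cutpowV2_mass n s ^+ 2 + 1).
have kappa0 : 0 < kappa by rewrite mulr_gt0// ltr_wpDl ?sqr_ge0.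
have [bT _] := T_fourier Ks.
have coef a b : hmem a -> hmem b -> sqn (hdot (@T sigma a) b) <= kappa * z * hsq a * hsq b.
  move=> ma mb; apply: le_trans (sqn_fourier_dot_le s1 m_metaplectic us (T_fourier Ks) ma mb) _.
  have Ht := L2tensor_inner_space R n (rep_dim sigma).
  by rewrite !ler_wpM2r ?(hsq_ge0 Ht)// /kappa ler_wpM2l// lerDl.
have := schatten_pow_ge (L2tensor_inner_space R n (rep_dim sigma))
  (@L2tensor_fast_complete R n (rep_dim sigma)) (mulr_gt0 kappa0 zp)
  (introT andP (conj q0 q2)) mu mu u1 u1 bT coef.
rewrite (fourier_ground_tensor lambda0 m_metaplectic Q1 sQ s1 us (T_fourier Ks)).
rewrite sqnM sqn_real -/z => sch.
set H2 := gaussian_mass n s (`|lambda| / 4) ^+ 2 in sch.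
have le1 : (((kappa * z) `^ (q / 2 - 1) * (z * H2))%:E <= \esum_(sigma in Khat)
    ((rep_dim sigma)%:R%:E * schatten_pow q (@T sigma)))%E.
  apply: (le_trans sch).
  apply: (@le_trans _ _ ((rep_dim sigma)%:R%:E * schatten_pow q (@T sigma))%E).
    apply: lee_pemull; last by rewrite lee_fin ler1n.
    apply: le_trans sch; rewrite lee_fin; apply: mulr_ge0; first exact: powR_ge0.
    by rewrite mulr_ge0 ?sqr_ge0.
  apply: ereal_sup_ubound; exists [set sigma].
    by split; [exact: finite_set1|move=> _ ->].
  by rewrite fsbig_set1.
apply: le_trans (lee_wpmul2r _ le1); last by rewrite lee_fin.
rewrite -EFinM lee_fin.
have zE : z `^ (q / 2 - 1) * z = z `^ (q / 2).
  by rewrite -[X in _ * X]powRr1// -powRD ?zn ?implybT// subrK.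
rewrite [leLHS](_ : _ = kappa `^ (q / 2 - 1) * z `^ (q / 2) *
    (expR (- 4^-1) ^+ (4 * n) * `|lambda| `^ (- (n%:R * (1 + 2 * s))))); last first.
  by rewrite /schatten_bound -/kappa; ring.
rewrite powRM ?(ltW kappa0)//.
rewrite [leRHS](_ : _ = kappa `^ (q / 2 - 1) * z `^ (q / 2) * (H2 * `|lambda| ^+ n)); last first.
  by rewrite -zE; ring.
by rewrite ler_wpM2l ?mulr_ge0 ?powR_ge0.
Qed.

End lower_bound.

Theorem theorem4p2 (R : realType) (n : nat) (n_gt0 : (0 < n)%N)
    (P : probability (unitary_group R n) R) (P_haar : is_haar P)
    (mu : R -> unitary_group R n -> L2 R n -> L2 R n)
    (mu_metaplectic : forall lambda, lambda != 0 ->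
       is_metaplectic lambda (mu lambda))
    (Khat : set (matrix_rep R n)) (Khat_dual : is_unitary_dual Khat) :
  (forall xi : R, - 2^-1 < xi ->
     f_xi xi \in Lfun (haarG P) 2%:E /\
     compact (closure [set g : heisenberg_motion R n | f_xi xi g != 0])) /\
  (forall q : R, 1 < q -> q < 2 ->
     exists2 xi : R, - 2^-1 < xi &
       forall Fhat : R -> forall sigma : matrix_rep R n,
           L2tensor R n (rep_dim sigma) -> L2tensor R n (rep_dim sigma),
         (forall lambda sigma, lambda != 0 -> Khat sigma ->
            is_fourier_transform P lambda (mu lambda)
              (fun g => (f_xi xi g)%:C) (Fhat lambda sigma)) ->
         (\int[lebesgue_measure]_(lambda in ~` [set 0%R])
            ((\esum_(sigma in Khat)
                ((rep_dim sigma)%:R%:E *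
                 schatten_pow q (Fhat lambda sigma))) *
             (`|lambda| ^+ n)%:E) = +oo)%E).
Proof.
split=> [xi xi2|q q1 q2]; first by split; [exact: f_xi_Lfun2|exact: f_xi_support_compact].
have n0 : 0 <= n%:R :> R by [].
(* With xi = eta - 1/2, the exponent of |lambda| in the density is 2 n eta, and
   the density is not integrable as soon as eta (q + 2 n) < 1 - q / 2. *)
pose D := 2 * (q + 2 * n%:R); have D0 : 0 < D by rewrite mulr_gt0// ltr_wpDr ?mulr_ge0// (lt_trans _ q1).
pose eta := (1 - q / 2) / D.
have eta0 : 0 < eta by rewrite divr_gt0//; lra.
have etaD : eta * D = 1 - q / 2 by rewrite divfK// gt_eqF.
have eta_n : 0 <= eta * n%:R by rewrite mulr_ge0// ltW.
have eta_q : 0 < eta * (q - 1) by rewrite mulr_gt0// subr_gt0.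
have etaE : 2 * (eta * (q - 1)) + 2 * eta + 4 * (eta * n%:R) = 1 - q / 2.
  by rewrite -etaD /D; ring.
pose xi := - 2^-1 + eta.
exists xi; first by rewrite ltrDl.
have xi1 : -1 < xi by rewrite /xi; lra.
have xi0 : xi < 0 by rewrite /xi; lra.
pose eps := n%:R * (1 + 2 * xi).
have epsE : eps = 2 * (eta * n%:R) by rewrite /eps /xi; field.
have eps0 : 0 <= eps by rewrite epsE mulr_ge0.
have eps2 : eps <= 2 by rewrite epsE; lra.
have exponents : (1 + xi) * (q - 1) + eps < - xi.
  have -> : (1 + xi) * (q - 1) = (q - 1) / 2 + eta * (q - 1) by rewrite /xi; field.
  by rewrite epsE /xi; lra.
move=> Fhat Fhat_fourier; apply/eqP/contraT => notoo; exfalso.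
apply: (tail_density_not_integrable xi1 xi0 q1 eps0 eps2 exponents).
pose K := schatten_bound n xi q; have K0 : 0 < K := schatten_bound_gt0 _ _ _.
set I := (\int[_]_(lambda in _) _)%E in notoo.
have le : (\int[lebesgue_measure]_(lambda in ~` [set 0%R])
    (K * tail_density xi q eps lambda)%:E <= I)%E.
  apply: ge0_integral_mono => lambda /eqP lambda0.
  rewrite lee_fin mulr_ge0 ?(ltW K0) ?tail_density_ge0//=.
  have [l1|l1] := boolP (1 <= `|lambda|).
    rewrite /tail_density indicE mem_set// mul1r.
    apply: (schatten_sum_ge xi1 xi0 (lt_trans ltr01 q1) (ltW q2) l1
      (mu_metaplectic _ lambda0) Khat_dual) => sigma Ks.
    exact: Fhat_fourier.
  rewrite /tail_density indicE memNset ?mul0r ?mulr0; last exact/negP.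
  apply: mule_ge0; last by rewrite lee_fin exprn_ge0.
  by apply: ereal_sup_ubound; exists set0; [exact: fsets_set0|rewrite fsbig_set0].
have E : (\int[lebesgue_measure]_(lambda in ~` [set 0%R])
    (K * tail_density xi q eps lambda)%:E =
    \int[lebesgue_measure]_lambda (K * tail_density xi q eps lambda)%:E)%E.
  rewrite integral_mkcond; apply: eq_integral => lambda _.
  rewrite /patch; case: ifPn => // /negP h.
  have -> : lambda = 0 by apply: contrapT => /eqP l0; apply: h; apply/mem_set => /eqP; apply/negP.
  by rewrite /tail_density indicE memNset ?mul0r ?mulr0//= normr0 ler10.
have iK : (@lebesgue_measure R).-integrable setT
    (EFin \o (fun lambda => K * tail_density xi q eps lambda)).
  apply/integrableP; split.
    by apply/measurable_EFinP; apply: measurable_funM => //; exact: measurable_tail_density.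
  apply: (@le_lt_trans _ _ I); last by rewrite ltey.
  apply: le_trans le; rewrite E le_eqVlt; apply/orP; left; apply/eqP.
  apply: eq_integral => lambda _.
  by rewrite /= ger0_norm// mulr_ge0 ?(ltW K0) ?tail_density_ge0.
by apply: integrable_ext (integrable_scale K^-1 iK) => lambda; rewrite mulKf// gt_eqF.
Qed.
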